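(* Let $\gamma\in(0,1]$, $N_\gamma=\lfloor\gamma^{-1}\rfloor$, let $\mathbf W$ be a weakly geometric rough path of Hölder regularity $\gamma$ on $[0,T]$ over $\mathbb R^d$, and let $f=(f_1,\dots,f_d)$ be vector fields on $\mathbb R^n$ of class $C^{2N_\gamma+1}_b$. Then: (i) (Rough transport equation) for every terminal datum $g\in C^{N_\gamma+1}(\mathbb R^n)$ there exists a unique regular solution $u:[0,T]\times\mathbb R^n\to\mathbb R$ of $$-\mathrm du_s=\sum_{i=1}^d\Gamma_iu_s\,\mathrm d\mathbf W^i_s,\qquad u(T,\cdot)=g;$$ (ii) (Rough continuity equation) for every initial datum $\mu\in\mathcal M(\mathbb R^n)$ there exists a unique measure-valued solution $\rho:[0,T]\to\mathcal M(\mathbb R^n)$ of $$\mathrm d\rho_t=\sum_{i=1}^d\operatorname{div}_x(f_i\rho_t)\,\mathrm d\mathbf W^i_t,\qquad\rho_0=\mu.$$ Here ''regular solution'' and ''measure-valued solution'' are understood in the sense of the definitions given in the context.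
   Context: Words and rough paths. Fix $T>0$, $d,n\ge1$. A word is a finite sequence $w=(i_1,\dots,i_p)$ of letters in $\{1,\dots,d\}$, $|w|=p$; $\varepsilon$ is the empty word; $uv$ denotes concatenation. $H_N=\bigoplus_{p=0}^N(\mathbb R^d)^{\otimes p}$ has basis $e_w=e_{i_1}\otimes\cdots\otimes e_{i_p}$, $|w|\le N$, with $e_\varepsilon=\mathbf 1$; $(e_w^* )$ is the dual basis and $\mathbf 1^*=e_\varepsilon^*$. Let $ш$ denote the usual shuffle product of words, extended bilinearly. For $g,h\in H_N^*$ put $\langle g\star h,e_w\rangle=\sum_{uv=w}\langle g,e_u\rangle\langle h,e_v\rangle$. $G^{(N)}$ is the group (under $\star$, with identity $\mathbf 1^*$) of all $g\in H_N^*$ with $\langle g,\mathbf 1\rangle=1$ and $\langle g,x\,ш\,y\rangle=\langle g,x\rangle\langle g,y\rangle$ for $x\in(\mathbb R^d)^{\otimes p}$, $y\in(\mathbb R^d)^{\otimes q}$, $p+q\le N$. A (weakly) geometric rough path of regularity $\gamma$ is a map $\mathbf W:[0,T]\to G^{(N_\gamma)}$ whose increments $\mathbf W_{st}=\mathbf W_s^{-1}\star\mathbf W_t$ satisfy $\sup_{s\ne t}|\langle\mathbf W_{st},e_w\rangle|/|t-s|^{|w|\gamma}<\infty$ for all $|w|\le N_\gamma$ (equivalently, $\mathbf W$ is $\gamma$-Hölder for a homogeneous left-invariant metric on $G^{(N_\gamma)}$). $C^k_b$: functions of class $C^k$ that are bounded together with all derivatives up to order $k$. Differential operators. $\Gamma_i\phi(x)=f_i(x)\cdot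 D\phi(x)$, $\Gamma_w=\Gamma_{i_1}\circ\cdots\circ\Gamma_{i_p}$ for $w=(i_1,\dots,i_p)$, $\Gamma_\varepsilon=\mathrm{id}$. Regular solution of the transport equation. A function $u:[0,T]\times\mathbb R^n\to\mathbb R$ of class $\mathcal C^{\gamma,N_\gamma+1}$ (i.e. $\gamma$-Hölder in time, locally uniformly in $x$, and $N_\gamma+1$ times continuously differentiable in $x$, with these $x$-derivatives bounded on $[0,T]\times K$ for every compact $K$) with $u(T,\cdot)=g$ such that for every word $w$ with $|w|\le N_\gamma$ and every compact $K\subset\mathbb R^n$ there is a constant $C$ with $$\Big|\Gamma_wu_s(x)-\sum_{0\le|v|\le N_\gamma-|w|}\Gamma_{wv}u_t(x)\langle\mathbf W_{st},e_v\rangle\Big|\le C|t-s|^{(N_\gamma+1-|w|)\gamma}$$ for all $s<t$ in $[0,T]$ and $x\in K$. Measure-valued solution of the continuity equation. $\mathcal M(\mathbb R^n)$ is the set of finite Borel measures on $\mathbb R^n$, and $\rho(\phi)=\int\phi\,d\rho$. A map $\rho:[0,T]\to\mathcal M(\mathbb R^n)$ with $\rho_0=\mu$ is a measure-valued solution if for every word $w$ with $|w|\le N_\gamma$ and every bounded subset $B$ of $C^{N_\gamma+1}_b(\mathbb R^n)$ there is a constant $C$ with $$\Big|\rho_t(\Gamma_w\phi)-\sum_{0\le|v|\le N_\gamma-|w|}\rho_s(\Gamma_{vw}\phi)\langle\mathbf W_{st},e_v\rangle\Big|\le C|t-s|^{(N_\gamma+1-|w|)\gamma}$$ for all $s<t$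 in $[0,T]$ and $\phi\in B$. *)

(* Defs.v *)
From HB Require Import structures.
From mathcomp Require Import all_boot all_order all_algebra.
From mathcomp Require Import all_classical all_reals all_analysis.
Set Implicit Arguments.
Unset Strict Implicit.
Unset Printing Implicit Defensive.
Import Order.TTheory GRing.Theory Num.Theory.
Import numFieldNormedType.Exports.
Local Open Scope classical_set_scope.
Local Open Scope ring_scope.

(* Elements of H_N, and of its dual, are given by their coordinates in the
   basis (e_w), |w| <= N, respectively in the dual basis: <g, e_w> is g w. *)
Definition tensor (R : realType) (d N : nat) := {ffun N.-bseq 'I_d -> R}.

Section TruncatedTensors.
Variables (R : realType) (d N : nat).
Implicit Types (g h k x y : tensor R d N).

Definition pairing g x : R := \sum_(w : N.-bseq 'I_d) g w * x w.

(* \mathbf 1 and \mathbf 1^* have the same coordinates. *)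
Definition unit_tensor : tensor R d N := [ffun w : N.-bseq 'I_d => (size w == 0%N)%:R].

Definition homogeneous (p : nat) x : Prop :=
  forall w : N.-bseq 'I_d, size w != p -> x w = 0.

Definition star g h : tensor R d N :=
  [ffun w : N.-bseq 'I_d =>
     \sum_(p : N.-bseq 'I_d * N.-bseq 'I_d | p.1 ++ p.2 == w :> seq 'I_d)
        g p.1 * h p.2].

(* The Neumann series sum_k (1^* - g)^k, finite because 1^* - g is nilpotent
   when <g, 1> = 1; see star_invr, star_invl and star_inv_uniq below. *)
Definition star_inv g : tensor R d N :=
  \sum_(k < N.+1) iter k (star (unit_tensor - g)) unit_tensor.

End TruncatedTensors.

Arguments unit_tensor {R d N}.

(* The shuffles of u and v, listed with multiplicity. *)
Fixpoint shuffles (A : Type) (u : seq A) : seq A -> seq (seq A) :=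
  match u with
  | [::] => fun v => [:: v]
  | a :: u' =>
      fix shuffles_u v :=
        match v with
        | [::] => [:: u]
        | b :: v' => map (cons a) (shuffles u' v) ++ map (cons b) (shuffles_u v')
        end
  end.

(* The part of degree at most N of the shuffle product; nothing is lost on
   homogeneous factors of degrees p and q with p + q <= N. *)
Definition shuffle_prod (R : realType) (d N : nat) (x y : tensor R d N) :
    tensor R d N :=
  [ffun w : N.-bseq 'I_d =>
     \sum_(u : N.-bseq 'I_d) \sum_(v : N.-bseq 'I_d)
       x u * y v * (count_mem (w : seq 'I_d) (shuffles u v))%:R].

Definition group_like (R : realType) (d N : nat) (g : tensor R d N) : Prop :=
  pairing g unit_tensor = 1 /\
  forall (p q : nat) (x y : tensor R d N),
    (p + q <= N)%N -> homogeneous p x -> homogeneous q y ->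
    pairing g (shuffle_prod x y) = pairing g x * pairing g y.

Definition increment (R : realType) (d N : nat) (W : R -> tensor R d N)
    (s t : R) : tensor R d N :=
  star (star_inv (W s)) (W t).

Definition N_of (R : realType) (gamma : R) : nat := Num.truncn gamma^-1.

(* W is only meaningful on [0, T]. *)
Definition geometric_rough_path (R : realType) (d : nat) (T gamma : R)
    (W : R -> tensor R d (N_of gamma)) : Prop :=
  (forall t, 0 <= t <= T -> group_like (W t)) /\
  (forall w : (N_of gamma).-bseq 'I_d, exists C : R,
     forall s t, 0 <= s <= T -> 0 <= t <= T -> s != t ->
       `|increment W s t w| / `|t - s| `^ ((size w)%:R * gamma) <= C).

Section Differentiation.
Variables (R : realType) (n : nat).
Implicit Types (phi : 'rV[R]_n -> R) (J : seq 'I_n).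

Definition partial (j : 'I_n) phi : 'rV[R]_n -> R :=
  fun x => 'D_(delta_mx 0 j) phi x.

Definition partials J phi : 'rV[R]_n -> R := foldr partial phi J.

Definition class_C (k : nat) phi : Prop :=
  forall J, (size J <= k)%N ->
    continuous (partials J phi) /\
    ((size J < k)%N -> forall (j : 'I_n) (x : 'rV[R]_n),
       derivable (partials J phi) x (delta_mx 0 j)).

Definition class_Cb_le (k : nat) (M : R) phi : Prop :=
  class_C k phi /\
  forall J, (size J <= k)%N -> forall x, `|partials J phi x| <= M.

Definition class_Cb (k : nat) phi : Prop := exists M, class_Cb_le k M phi.

Definition bounded_in_Cb (k : nat) (B : set ('rV[R]_n -> R)) : Prop :=
  exists M, forall phi, B phi -> class_Cb_le k M phi.

Definition vector_field_Cb (k : nat) (F : 'rV[R]_n -> 'rV[R]_n) : Prop :=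
  forall j : 'I_n, class_Cb k (fun x => F x 0 j).

Definition lie (F : 'rV[R]_n -> 'rV[R]_n) phi : 'rV[R]_n -> R :=
  fun x => \sum_(j < n) F x 0 j * partial j phi x.

Definition Gamma (d : nat) (f : 'I_d -> 'rV[R]_n -> 'rV[R]_n) (w : seq 'I_d)
    phi : 'rV[R]_n -> R :=
  foldr (fun i psi => lie (f i) psi) phi w.

End Differentiation.

Section Solutions.
Variables (R : realType) (d n : nat) (T gamma : R).
Variables (W : R -> tensor R d (N_of gamma)).
Variables (f : 'I_d -> 'rV[R]_n -> 'rV[R]_n).
Local Notation N := (N_of gamma).

Definition regular_class (u : R -> 'rV[R]_n -> R) : Prop :=
  [/\ forall K : set 'rV[R]_n, compact K -> exists C : R,
        forall s t x, 0 <= s <= T -> 0 <= t <= T -> K x ->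
          `|u t x - u s x| <= C * `|t - s| `^ gamma,
      forall t, 0 <= t <= T -> class_C N.+1 (u t)
    & forall K : set 'rV[R]_n, compact K -> exists C : R,
        forall J : seq 'I_n, (size J <= N.+1)%N ->
        forall t x, 0 <= t <= T -> K x -> `|partials J (u t) x| <= C].

Definition regular_solution (g : 'rV[R]_n -> R) (u : R -> 'rV[R]_n -> R) :
    Prop :=
  [/\ regular_class u,
      u T = g
    & forall (w : N.-bseq 'I_d) (K : set 'rV[R]_n), compact K ->
        exists C : R, forall s t x, 0 <= s -> s < t -> t <= T -> K x ->
          `|Gamma f w (u s) x
            - \sum_(v : N.-bseq 'I_d | (size v <= N - size w)%N)
                Gamma f (w ++ v) (u t) x * increment W s t v|
          <= C * `|t - s| `^ ((N.+1 - size w)%:R * gamma)].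

Definition borel_space := g_sigma_algebraType (@open 'rV[R]_n).

Definition finite_borel_measure := {finite_measure set borel_space -> \bar R}.

Definition integrate (rho : finite_borel_measure) (phi : 'rV[R]_n -> R) : R :=
  \int[rho]_x phi x.

(* A MathComp-Analysis measure also has (meaningless) values on non-measurable
   sets, so measures are compared on Borel sets only. *)
Definition same_measure (rho rho' : finite_borel_measure) : Prop :=
  forall A : set borel_space, measurable A -> rho A = rho' A.

Definition measure_solution (mu : finite_borel_measure)
    (rho : R -> finite_borel_measure) : Prop :=
  same_measure (rho 0) mu /\
  forall (w : N.-bseq 'I_d) (B : set ('rV[R]_n -> R)), bounded_in_Cb N.+1 B ->
    exists C : R, forall s t phi, 0 <= s -> s < t -> t <= T -> B phi ->
      `|integrate (rho t) (Gamma f w phi)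
        - \sum_(v : N.-bseq 'I_d | (size v <= N - size w)%N)
            integrate (rho s) (Gamma f (v ++ w) phi) * increment W s t v|
      <= C * `|t - s| `^ ((N.+1 - size w)%:R * gamma).

End Solutions.

Section StarInverse.
Variables (R : realType) (d N : nat).
Implicit Types (g h k x y : tensor R d N).
Local Notation one := (@unit_tensor R d N).
Local Notation word := (N.-bseq 'I_d).

Lemma starE g h w : star g h w =
  \sum_(u : word) \sum_(v : word) g u * h v * (u ++ v == w :> seq 'I_d)%:R.
Proof.
rewrite ffunE pair_big big_mkcond /=; apply: eq_bigr => p _.
by case: eqP => _; rewrite ?mulr1 ?mulr0.
Qed.

Lemma starDl g h k : star (g + h) k = star g k + star h k.
Proof.
apply/ffunP => w; rewrite [RHS]ffunE !starE -big_split; apply: eq_bigr => u _.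
by rewrite -big_split; apply: eq_bigr => v _; rewrite ffunE !mulrDl.
Qed.

Lemma starDr g h k : star k (g + h) = star k g + star k h.
Proof.
apply/ffunP => w; rewrite [RHS]ffunE !starE -big_split; apply: eq_bigr => u _.
by rewrite -big_split; apply: eq_bigr => v _; rewrite ffunE mulrDr mulrDl.
Qed.

Lemma starNl g k : star (- g) k = - star g k.
Proof.
apply/ffunP => w; rewrite [RHS]ffunE !starE -sumrN; apply: eq_bigr => u _.
by rewrite -sumrN; apply: eq_bigr => v _; rewrite ffunE !mulNr.
Qed.

Lemma starNr g k : star k (- g) = - star k g.
Proof.
apply/ffunP => w; rewrite [RHS]ffunE !starE -sumrN; apply: eq_bigr => u _.
by rewrite -sumrN; apply: eq_bigr => v _; rewrite ffunE mulrN mulNr.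
Qed.

Lemma star1l g : star one g = g.
Proof.
apply/ffunP => w; rewrite starE (bigD1 [bseq]) //= [X in _ + X]big1 ?addr0; last first.
  move=> u; rewrite -val_eqE /= => u0; apply: big1 => v _.
  by rewrite ffunE size_eq0 (negPf u0) !mul0r.
rewrite (bigD1 w) //= [X in _ + X]big1 ?addr0; last first.
  by move=> v /negPf vw; rewrite val_eqE vw mulr0.
by rewrite ffunE /= eqxx mul1r mulr1.
Qed.

Lemma star1r g : star g one = g.
Proof.
apply/ffunP => w; rewrite starE exchange_big (bigD1 [bseq]) //=.
rewrite [X in _ + X]big1 ?addr0; last first.
  move=> u; rewrite -val_eqE /= => u0; apply: big1 => v _.
  by rewrite [one _]ffunE size_eq0 (negPf u0) mulr0 mul0r.
rewrite (bigD1 w) //= [X in _ + X]big1 ?addr0; last first.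
  by move=> v /negPf vw; rewrite cats0 val_eqE vw mulr0.
by rewrite [one _]ffunE /= cats0 eqxx !mulr1.
Qed.

Lemma sum_word_eq (F : seq 'I_d -> R) (s : seq 'I_d) :
  (size s <= N)%N -> \sum_(u : word) F u * (s == u :> seq 'I_d)%:R = F s.
Proof.
move=> sN; rewrite (bigD1 (Bseq sN)) //= eqxx mulr1 big1 ?addr0 //.
by move=> u; rewrite -val_eqE /= eq_sym => /negPf ->; rewrite mulr0.
Qed.

Lemma starA g h k : star g (star h k) = star (star g h) k.
Proof.
apply/ffunP => w; rewrite !starE.
transitivity (\sum_(a : word) \sum_(b : word) \sum_(c : word)
  g a * h b * k c * (a ++ b ++ c == w :> seq 'I_d)%:R).
- apply: eq_bigr => a _.
  under eq_bigr => v _ do rewrite starE mulr_sumr mulr_suml.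
  rewrite exchange_big; apply: eq_bigr => b _.
  under eq_bigr => v _ do rewrite mulr_sumr mulr_suml.
  rewrite exchange_big; apply: eq_bigr => c _.
  case: (leqP (size (b ++ c)) N) => bcN.
    rewrite -(@sum_word_eq (fun s => g a * h b * k c * (a ++ s == w :> seq _)%:R)
      (b ++ c) bcN); apply: eq_bigr => v _.
    by rewrite !mulrA -!mulrA; do 3 congr (_ * _); rewrite mulrC.
  have /negPf -> : a ++ b ++ c != w.
    apply/eqP => E; have := size_bseq w; rewrite -E size_cat leqNgt.
    by rewrite (leq_trans bcN) // leq_addl.
  rewrite mulr0 big1 // => v _; case: eqP => E; rewrite ?mulr0 ?mul0r //.
  by have := size_bseq v; rewrite -E leqNgt bcN.
- rewrite [RHS]exchange_big [LHS]exchange_big; under eq_bigr => b _ do rewrite exchange_big.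
  rewrite exchange_big; apply: eq_bigr => c _.
  under [RHS]eq_bigr => v _ do rewrite starE !mulr_suml.
  rewrite [RHS]exchange_big [LHS]exchange_big; apply: eq_bigr => a _.
  under [RHS]eq_bigr => v _ do rewrite !mulr_suml.
  rewrite [RHS]exchange_big; apply: eq_bigr => b _.
  case: (leqP (size (a ++ b)) N) => abN.
    rewrite catA -(@sum_word_eq (fun s => g a * h b * k c * (s ++ c == w :> seq _)%:R)
      (a ++ b) abN); apply: eq_bigr => v _.
    by rewrite [LHS]mulrAC [X in X * _ = _]mulrAC.
  have /negPf -> : a ++ b ++ c != w.
    apply/eqP => E; have := size_bseq w; rewrite -E catA size_cat leqNgt.
    by rewrite (leq_trans abN) // leq_addr.
  rewrite mulr0 big1 // => v _; case: eqP => E; rewrite ?mulr0 ?mul0r //.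
  by have := size_bseq v; rewrite -E leqNgt abN.
Qed.

Lemma star_sumr (I : finType) g (F : I -> tensor R d N) :
  star g (\sum_i F i) = \sum_i star g (F i).
Proof.
apply: (big_morph (star g)) => [a b|]; first exact: starDr.
by apply/ffunP => w; rewrite starE ffunE big1 // => u _; rewrite big1 // => v _;
  rewrite ffunE mulr0 mul0r.
Qed.

Lemma star_suml (I : finType) g (F : I -> tensor R d N) :
  star (\sum_i F i) g = \sum_i star (F i) g.
Proof.
apply: (big_morph (fun y => star y g)) => [a b|]; first exact: starDl.
by rewrite -(subrr g) starDl starNl !subrr.
Qed.

Lemma pairing_unit g : pairing g one = g [bseq].
Proof.
rewrite /pairing (bigD1 [bseq]) //= ffunE eqxx mulr1 big1 ?addr0 // => w.
by rewrite -val_eqE /= => w0; rewrite ffunE size_eq0 (negPf w0) mulr0.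
Qed.

Lemma iter_star_eq0 x (m : nat) (w : word) :
  x [bseq] = 0 -> (size w < m)%N -> iter m (star x) one w = 0.
Proof.
move=> x0; elim: m w => // m IH w wm; rewrite iterS starE big1 // => u _.
rewrite big1 // => v _; case: eqP => E; last by rewrite mulr0.
have [->|u0] := eqVneq u [bseq]; first by rewrite x0 !mul0r.
rewrite IH ?mulr0 ?mul0r //; move: wm; rewrite -E size_cat ltnS.
apply: leq_trans; rewrite -[X in (X <= _)%N]add1n leq_add2r lt0n size_eq0.
by rewrite -val_eqE /= in u0.
Qed.

Lemma star_invr g : pairing g one = 1 -> star g (star_inv g) = one.
Proof.
rewrite pairing_unit => g1; rewrite /star_inv; set x := one - g.
have x0 : x [bseq] = 0 by rewrite !ffunE g1 subrr.
rewrite -[g](subKr one) -/x starDl starNl star1l star_sumr.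
rewrite big_ord_recl [X in _ - X]big_ord_recr /= opprD addrA addrK.
suff -> : star x (iter N (star x) one) = 0 by rewrite subr0.
by apply/ffunP => w; rewrite -iterS iter_star_eq0 ?ltnS ?size_bseq // ffunE.
Qed.

Lemma star_invl g : pairing g one = 1 -> star (star_inv g) g = one.
Proof.
move=> g1; rewrite -[RHS](star_invr g1) /star_inv; set x := one - g.
have comm m : star (iter m (star x) one) x = star x (iter m (star x) one).
  by elim: m => [|m IH] /=; rewrite ?star1l ?star1r // -starA IH.
suff E y : star y x = star x y -> star y g = star g y.
  by apply: E; rewrite star_sumr star_suml; apply: eq_bigr => i _.
move=> yx; rewrite -[g](subKr one) -/x starDl starDr starNl starNr.
by rewrite star1l star1r yx.
Qed.

Lemma star_inv_uniq g h :
  pairing g one = 1 -> star g h = one -> h = star_inv g.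
Proof.
by move=> g1 gh; rewrite -[LHS]star1l -(star_invl g1) -starA gh star1r.
Qed.

End StarInverse.

(* Main.v *)
(** The Davie map x |-> sum_w <W_st, e_w> Gamma_w id (x) composes up to an error
O(|t-s|^((N+1) gamma)) with (N+1) gamma > 1, so a nonlinear sewing argument in
C^(N+1) turns it into a flow phi_st satisfying the Taylor estimate
psi o phi_st = sum_(|v| < K) Gamma_v psi <W_st, e_v> + O(|t-s|^(K gamma)).
Two identities for Gamma_w on products of words (the space derivative and the
derivative along a dilation of W_st) and the shuffle relation reduce this Taylor
estimate to an induction on K.

Then u_t = g o phi_tT solves the transport equation and the image rho_t of mu
under phi_0t solves the continuity equation. For uniqueness, t |-> u_t(phi_st x)
is Hoelder of exponent (N+1) gamma > 1 for every regular solution u, hence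
constant; so is t |-> rho_t(psi o phi_(t,tau)) for every measure solution rho,
and a finite measure is determined by its integrals of C_b^(N+1) functions
because these approximate indicators of boxes. *)
Require Import Defs.
From HB Require Import structures.
From mathcomp Require Import all_boot all_order all_algebra.
From mathcomp Require Import all_classical all_reals all_analysis.
From mathcomp Require Import ring lra zify.
Set Implicit Arguments.
Unset Strict Implicit.
Unset Printing Implicit Defensive.
Import Order.TTheory GRing.Theory Num.Theory.
Import numFieldNormedType.Exports.
Local Open Scope classical_set_scope.
Local Open Scope ring_scope.

(** * Calculus of C^k functions *)

(** Counting derivatives shapes the construction. A word of length at most N costs at most N - 1
    derivatives of f in the Davie map, so C^(2N+1) fields make that map C^(N+2). One derivative is
    lost in the sewing, because comparing two nearby maps in C^k after composition with a third
    takes a C^(k+1) bound on the third; the flow is C^(N+1), which is what g o phi_tT needs.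
    Repeating such a comparison along a partition would lose derivatives again and again, so
    compositions along two partitions are compared in the sup norm only. Uniform C^(N+1) bounds and
    an equicontinuity estimate for the jets then carry the derivatives to the limit.

    The Taylor estimate is proved for jets in x: with |w| derivatives of the error under control,
    Gamma_w may act on it, which gives the transport equation at every level w. For measures, the
    test functions psi o phi_(t,tau) stay in one bounded set of C_b^(N+1), so the constant of the
    definition is uniform in t, and testing with 1 bounds the mass of rho_t. *)

(** Closed inequalities on both sides: in this form bounds pass to limits, and radii for finitely
    many coordinates combine by a minimum. *)
Lemma continuous_epsP (R : realType) (U W : normedModType R) (phi : U -> W) x :
  {for x, continuous phi} <->
  forall e, 0 < e -> exists2 r, 0 < r & forall y, `|y - x| <= r -> `|phi y - phi x| <= e.
Proof.
split=> [c e e0|H].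
  move/cvgrPdist_le : c => /(_ e e0) /nbhs_normP[r /= r0 rP].
  exists (r / 2); first by rewrite divr_gt0.
  move=> y yx; rewrite distrC; apply: rP; rewrite /= distrC.
  by apply: le_lt_trans yx _; rewrite ltr_pdivrMr // ltr_pMr // ltr1n.
apply/cvgrPdist_le => e e0; have [r r0 rP] := H e e0.
apply/nbhs_normP; exists r => //= y /= yx; rewrite distrC; apply: rP.
by rewrite distrC ltW.
Qed.

Lemma is_derive_epsP (R : realType) (U : normedModType R) (phi : U -> R) x v D :
  is_derive x v phi D <->
  forall e, 0 < e -> exists2 r, 0 < r & forall h, h != 0 -> `|h| <= r ->
    `|h^-1 * (phi (h *: v + x) - phi x) - D| <= e.
Proof.
split=> [H e e0|H].
  have : h^-1 *: ((phi \o shift x) (h *: v) - phi x) @[h --> 0^'] --> 'D_v phi x.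
    by have [+ _] := H.
  rewrite (@derive_val _ _ _ _ _ _ _ H) => /cvgrPdist_le /(_ e e0).
  rewrite /dnbhs /within /= => /nbhs_normP[r /= r0 rP].
  exists (r / 2); first by rewrite divr_gt0.
  move=> h h0 hr; rewrite distrC; apply: rP => //=.
  rewrite sub0r normrN; apply: le_lt_trans hr _.
  by rewrite ltr_pdivrMr // ltr_pMr // ltr1n.
have C : h^-1 *: ((phi \o shift x) (h *: v) - phi x) @[h --> 0^'] --> D.
  apply/cvgrPdist_le => e e0; have [r r0 rP] := H e e0.
  rewrite /dnbhs /within /=; apply/nbhs_normP; exists r => //= h /=.
  by rewrite sub0r normrN => hr h0; rewrite distrC; apply: rP => //; rewrite ltW.
by apply: DeriveDef; [apply/cvg_ex; exists D | exact: cvg_lim C].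
Qed.

Lemma is_derive_line (R : realType) (U : normedModType R) (phi : U -> R) x v r D :
  is_derive (x + r *: v) v phi D -> is_derive (r : R) (1 : R) (fun s : R => phi (x + s *: v)) D.
Proof.
move/is_derive_epsP => H; apply/is_derive_epsP => e /H[d d0 dP].
exists d => // h h0 hd; have := dP h h0 hd.
by rewrite scalerDl addrCA [h *: (1 : R)]mulr1.
Qed.

(** The one-variable mean value theorem on r |-> phi (x + r v), one case per sign of s. Bounding c
    by |s| instead of locating it keeps later uses free of signs. *)
Lemma mvt_line (R : realType) (U : normedModType R) (phi : U -> R) x v (s : R) :
  (forall r : R, `|r| <= `|s| -> derivable phi (x + r *: v) v) ->
  exists2 c, `|c| <= `|s| & phi (x + s *: v) - phi x = s * 'D_v phi (x + c *: v).
Proof.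
move=> dphi; pose g (r : R) := phi (x + r *: v).
have dg r : `|r| <= `|s| -> is_derive (r : R) (1 : R) g ('D_v phi (x + r *: v)).
  by move=> rs; apply: is_derive_line; apply: DeriveDef => //; exact: dphi.
have cg r : `|r| <= `|s| -> {for r, continuous g}.
  move=> rs; apply: differentiable_continuous; apply/derivable1_diffP.
  by have [] := dg r rs.
have g0 : g 0 = phi x by rewrite /g scale0r addr0.
have [s0|s0|->] := ltgtP s 0; last by exists 0; rewrite // scale0r addr0 subrr mul0r.
- have [||c] := @MVT _ g (fun r => 'D_v phi (x + r *: v)) s 0 s0.
  + move=> r; rewrite in_itv /= => /andP[a b]; apply: dg.
    by rewrite !ltr0_norm // lerN2 ltW.
  + apply: continuous_in_subspaceT => r; rewrite inE /= in_itv /= => /andP[a b].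
    by apply: cg; rewrite (ltr0_norm s0) (ler0_norm b) lerN2.
  rewrite in_itv /= => /andP[a b] E; exists c; first by rewrite !ltr0_norm // lerN2 ltW.
  by rewrite -/(g s) -g0 -opprB E sub0r mulrN opprK mulrC.
- have [||c] := @MVT _ g (fun r => 'D_v phi (x + r *: v)) 0 s s0.
  + move=> r; rewrite in_itv /= => /andP[a b]; apply: dg.
    by rewrite !gtr0_norm // ltW.
  + apply: continuous_in_subspaceT => r; rewrite inE /= in_itv /= => /andP[a b].
    by apply: cg; rewrite (gtr0_norm s0) (ger0_norm a).
  rewrite in_itv /= => /andP[a b] E; exists c; first by rewrite !gtr0_norm // ltW.
  by rewrite -/(g s) -g0 E subr0 mulrC.
Qed.

Section RowNorm.
Variables (R : realType) (n : nat).
Implicit Types x y : 'rV[R]_n.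

Lemma coord_le_norm x l : `|x 0 l| <= `|x|.
Proof.
rewrite [leRHS](_ : _ = mx_norm x) // mx_normrE.
by apply: (@le_bigmax _ _ _ _ (fun ij => `|x ij.1 ij.2|) (0, l)).
Qed.

Lemma row_norm_le x M : 0 <= M -> (forall l, `|x 0 l| <= M) -> `|x| <= M.
Proof.
move=> M0 H; rewrite [leLHS](_ : _ = mx_norm x) // mx_normrE.
by apply/bigmax_leP; split => // -[i l] _ /=; rewrite ord1.
Qed.

End RowNorm.

Section ClassC.
Variables (R : realType) (n : nat).
Local Notation V := 'rV[R]_n.
Local Notation basis j := (delta_mx 0 j : V).
Implicit Types (phi psi : V -> R) (x y : V).

(** The head of J is the outermost derivative. Peeling J from the right exposes the derivative taken
    first, which is the shape required by inductions on the order k of [class_C]. *)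
Lemma partials_rcons J j phi :
  partials (rcons J j) phi = partials J (partial j phi).
Proof. by rewrite /partials foldr_rcons. Qed.

Lemma class_C0 phi : class_C 0 phi <-> continuous phi.
Proof.
split=> [/(_ [::] isT)[]//|c J]; rewrite leqn0 size_eq0 => /eqP ->.
by split.
Qed.

Lemma class_CS k phi : class_C k.+1 phi <->
  [/\ continuous phi, forall j x, derivable phi x (basis j)
    & forall j, class_C k (partial j phi)].
Proof.
split=> [H|[c d H] J].
  split; first by case: (H [::] isT).
  - by case: (H [::] isT) => _ /(_ isT).
  - by move=> j J Jk; rewrite -partials_rcons -(ltnS _ k) -(size_rcons J j); apply: H; rewrite size_rcons.
case: (lastP J) => [|K j]; first by split=> // _ j x; apply: d.
rewrite size_rcons ltnS partials_rcons => Kk; have [? D] := H j K Kk.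
by split=> // ?; apply: D.
Qed.

Lemma class_C_le k m phi : (m <= k)%N -> class_C k phi -> class_C m phi.
Proof.
move=> mk H J Jm; have [? D] := H J (leq_trans Jm mk).
by split=> // Jm'; apply: D; exact: leq_trans Jm' mk.
Qed.

Lemma class_C_cont k phi : class_C k phi -> continuous phi.
Proof. by move=> /(_ [::] isT)[]. Qed.

Lemma class_C_derivable k phi j x : class_C k.+1 phi -> derivable phi x (basis j).
Proof. by case/class_CS. Qed.

Lemma class_C_partial k phi j : class_C k.+1 phi -> class_C k (partial j phi).
Proof. by case/class_CS. Qed.

Lemma class_C_partials k J phi m : class_C k phi -> (size J + m <= k)%N ->
  class_C m (partials J phi).
Proof.
elim/last_ind: J k phi => [|J j IH] [|k] phi H //=.
- by move=> mk; exact: class_C_le H.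
- by move=> mk; exact: class_C_le H.
- by rewrite size_rcons.
rewrite size_rcons addSn ltnS partials_rcons => Jk.
by apply: IH Jk; exact: class_C_partial.
Qed.

(* Only partial derivatives are assumed, so the increment is taken along the
   sides of the box spanned by x and x + h, one coordinate at a time. *)
Lemma increment_along_axes phi x (h : V) :
  (forall j y, derivable phi y (basis j)) ->
  exists2 xi : 'I_n -> V, (forall l, `|xi l - x| <= `|h|) &
    phi (x + h) - phi x = \sum_l h 0 l * partial l phi (xi l).
Proof.
move=> d; pose hm (m : nat) : V := \row_l (if (l < m)%N then h 0 l else 0).
have S (l : 'I_n) : exists2 y : V, `|y - x| <= `|h| &
    phi (x + hm l.+1) - phi (x + hm l) = h 0 l * partial l phi y.
  have -> : x + hm l.+1 = (x + hm l) + h 0 l *: basis l.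
    rewrite -addrA; congr (_ + _); apply/rowP => i; rewrite !mxE /=.
    by rewrite ltnS leq_eqVlt -val_eqE; case: eqP => [/ord_inj ->|_] /=;
      rewrite ?ltnn ?mulr1 ?add0r ?mulr0 ?addr0.
  have [//|c cs ->] := @mvt_line _ _ phi (x + hm l) (basis l) (h 0 l) _.
  exists (x + hm l + c *: basis l) => //.
  rewrite [X in `|X|](_ : _ = hm l + c *: basis l); last by rewrite addrC !addrA addNr add0r.
  apply: row_norm_le => // i; rewrite !mxE /=.
  case: (eqVneq i l) => [->|_]; rewrite ?ltnn ?mulr1 ?mulr0 ?add0r ?addr0.
    exact: le_trans cs (coord_le_norm h l).
  by case: ifP => _; rewrite ?normr0 ?coord_le_norm.
have [xi xiP] := choice (fun l => let: ex_intro2 y a b := S l in ex_intro _ y (conj a b)).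
exists xi => [l|]; first by have [] := xiP l.
under eq_bigr => l _ do rewrite -(xiP l).2.
rewrite -(big_mkord xpredT (fun m => phi (x + hm m.+1) - phi (x + hm m))).
rewrite telescope_sumr //; congr (phi (_ + _) - phi _).
  by apply/rowP => l; rewrite mxE ltn_ord.
by apply/rowP => l; rewrite !mxE addr0.
Qed.

(** A chain rule that never forms a Fréchet derivative: the increment of phi is expanded along the
    axes, and the intermediate points tend to B u, where the partial derivatives of phi are
    continuous. *)
Lemma is_derive_comp (U : normedModType R) phi (B : U -> V) (u v : U) (D : 'I_n -> R) :
  class_C 1 phi -> (forall l, is_derive u v (fun w => B w 0 l) (D l)) ->
  is_derive u v (fun w => phi (B w)) (\sum_l partial l phi (B u) * D l).
Proof.
move=> Cphi dB; apply/is_derive_epsP => e e0.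
pose Mx := 1 + \sum_l `|partial l phi (B u)| + \sum_l `|D l|.
have Mx0 : 0 < Mx.
  by rewrite /Mx -addrA ltr_pwDl // addr_ge0 // sumr_ge0.
have sum_ge (F : 'I_n -> R) l : `|F l| <= \sum_i `|F i|.
  by rewrite (bigD1 l) //= lerDl sumr_ge0.
have sum0 (F : 'I_n -> R) : 0 <= \sum_i `|F i| by rewrite sumr_ge0.
have PM l : `|partial l phi (B u)| <= Mx.
  have := sum_ge (fun l => partial l phi (B u)) l; have := sum0 D; rewrite /Mx; lra.
have DM l : `|D l| <= Mx.
  have := sum_ge D l; have := sum0 (fun l => partial l phi (B u)); rewrite /Mx; lra.
(* Each of the n summands of the error is at most (Mx + 1) eta + Mx eta: [Mx] bounds the partial
   derivatives of phi at B u and the D l, and eta <= 1 bounds the difference quotients of B by Mx +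
   1. *)
pose eta := Num.min 1 (e / ((n%:R + 1) * (Mx + Mx + 1))).
have n0 : 0 < n%:R + 1 :> R by rewrite ltr_pwDr.
have K0 : 0 < (n%:R + 1) * (Mx + Mx + 1) by apply: mulr_gt0 => //; lra.
have eta0 : 0 < eta by rewrite lt_min ltr01 divr_gt0.
have eta1 : eta <= 1 by rewrite ge_min lexx.
have etae : n%:R * ((Mx + Mx + 1) * eta) <= e.
  have: eta <= e / ((n%:R + 1) * (Mx + Mx + 1)) by rewrite ge_min lexx orbT.
  rewrite ler_pdivlMr //.
  have -> : eta * ((n%:R + 1) * (Mx + Mx + 1)) =
    n%:R * ((Mx + Mx + 1) * eta) + (Mx + Mx + 1) * eta by ring.
  by apply: le_trans; rewrite lerDl mulr_ge0 ?ltW //; lra.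
have [r r0 rP] : exists2 r, 0 < r & forall y l, `|y - B u| <= r ->
    `|partial l phi y - partial l phi (B u)| <= eta.
  have c l : {for B u, continuous (partial l phi)}.
    exact: (class_C_cont (class_C_partial l Cphi)).
  have [r rP] := choice (fun l => let: ex_intro2 y a b :=
    (continuous_epsP _ _).1 (c l) eta eta0 in ex_intro _ y (conj a b)).
  exists (\big[Num.min/1]_l r l).
    by apply: lt_bigmin => // l _; case: (rP l).
  move=> y l yr; apply: (rP l).2; apply: le_trans yr _; exact: bigmin_le_cond.
have [s s0 sP] : exists2 s, 0 < s & forall (h : R) l, h != 0 -> `|h| <= s ->
    `|h^-1 * (B (h *: v + u) 0 l - B u 0 l) - D l| <= eta.
  have [s sP] := choice (fun l => let: ex_intro2 y a b :=
    (is_derive_epsP _ _ _ _).1 (dB l) eta eta0 in ex_intro _ y (conj a b)).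
  exists (\big[Num.min/1]_l s l).
    by apply: lt_bigmin => // l _; case: (sP l).
  move=> h l h0 hr; apply: (sP l).2 => //; apply: le_trans hr _; exact: bigmin_le_cond.
exists (Num.min s (r / (Mx + 1))); first by rewrite lt_min s0 divr_gt0 //; lra.
move=> h h0; rewrite le_min => /andP[hs hr].
have [|xi xiP E] := @increment_along_axes phi (B u) (B (h *: v + u) - B u).
  by move=> j y; apply: class_C_derivable Cphi.
rewrite addrCA subrr addr0 in E; rewrite E mulr_sumr -sumrB.
have Q l : `|h^-1 * (B (h *: v + u) 0 l - B u 0 l)| <= Mx + 1.
  have := sP h l h0 hs; have := DM l; rewrite !ler_norml; lra.
have xiB l : `|xi l - B u| <= r.
  apply: le_trans (xiP l) _; apply: row_norm_le => [|i]; first exact: ltW.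
  rewrite !mxE -[X in `|X|](mulVKf h0) normrM.
  have M10 : 0 < Mx + 1 by lra.
  have hr' : `|h| * (Mx + 1) <= r by rewrite -ler_pdivlMr.
  by apply: le_trans hr'; rewrite ler_wpM2l.
apply: le_trans (ler_norm_sum _ _ _) _; apply: le_trans etae.
have -> : n%:R * ((Mx + Mx + 1) * eta) = \sum_(l < n) (Mx + Mx + 1) * eta.
  by rewrite sumr_const card_ord mulr_natl.
apply: ler_sum => l _.
have -> : h^-1 * ((B (h *: v + u) - B u) 0 l * partial l phi (xi l)) -
    partial l phi (B u) * D l = h^-1 * (B (h *: v + u) 0 l - B u 0 l) *
    (partial l phi (xi l) - partial l phi (B u)) +
    partial l phi (B u) * (h^-1 * (B (h *: v + u) 0 l - B u 0 l) - D l).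
  by rewrite !mxE; ring.
apply: le_trans (ler_normD _ _) _.
rewrite [leRHS](_ : _ = (Mx + 1) * eta + Mx * eta); last by ring.
by apply: lerD; rewrite normrM; apply: ler_pM => //; [exact: rP|exact: sP].
Qed.

Lemma partialE phi j x D : is_derive x (basis j) phi D -> partial j phi x = D.
Proof. by move=> H; rewrite /partial derive_val. Qed.

Lemma partial_cst (c : R) j : partial j (fun _ : V => c) = fun=> 0.
Proof. by apply/funext => x; rewrite /partial derive_cst. Qed.

Lemma partials_cst0 J : partials J (fun _ : V => 0 : R) = fun=> 0.
Proof. by elim: J => //= j J ->; exact: partial_cst. Qed.

Lemma is_derive_partial k phi j x : class_C k.+1 phi ->
  is_derive x (basis j) phi (partial j phi x).
Proof. by move=> H; apply: DeriveDef => //; apply: class_C_derivable H. Qed.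

Lemma partialB k phi psi j : class_C k.+1 phi -> class_C k.+1 psi ->
  partial j (fun x => phi x - psi x) = fun x => partial j phi x - partial j psi x.
Proof.
move=> Cp Cq; apply/funext => x; apply: partialE.
by apply: is_deriveB; [exact: is_derive_partial Cp|exact: is_derive_partial Cq].
Qed.

Lemma partialD k phi psi j : class_C k.+1 phi -> class_C k.+1 psi ->
  partial j (fun x => phi x + psi x) = fun x => partial j phi x + partial j psi x.
Proof.
move=> Cp Cq; apply/funext => x; apply: partialE.
by apply: is_deriveD; [exact: is_derive_partial Cp|exact: is_derive_partial Cq].
Qed.

Lemma partialM k phi psi j : class_C k.+1 phi -> class_C k.+1 psi ->
  partial j (fun x => phi x * psi x) =
  fun x => partial j phi x * psi x + phi x * partial j psi x.
Proof.
move=> Cp Cq; apply/funext => x; apply: partialE.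
apply: is_derive_eq; first by apply: is_deriveM;
  [exact: is_derive_partial Cp|exact: is_derive_partial Cq].
by rewrite addrC mulrC.
Qed.

Lemma class_C_cst k (c : R) : class_C k (fun _ : V => c).
Proof.
elim: k c => [|k IH] c; first by apply/class_C0; exact: cst_continuous.
apply/class_CS; split=> [x|j x|j]; first exact: cst_continuous.
  exact: derivable_cst.
by rewrite partial_cst.
Qed.

Lemma class_CD k phi psi : class_C k phi -> class_C k psi ->
  class_C k (fun x => phi x + psi x).
Proof.
elim: k phi psi => [|k IH] phi psi Cp Cq.
  apply/class_C0 => x.
  by apply: continuousD; [exact: (@class_C_cont _ _ Cp)|exact: (@class_C_cont _ _ Cq)].
apply/class_CS; split=> [x|j x|j].
- by apply: continuousD; [exact: (@class_C_cont _ _ Cp)|exact: (@class_C_cont _ _ Cq)].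
- by apply: derivableD; [exact: class_C_derivable Cp|exact: class_C_derivable Cq].
- by rewrite (partialD _ Cp Cq); apply: IH; exact: class_C_partial.
Qed.

Lemma class_CM k phi psi : class_C k phi -> class_C k psi ->
  class_C k (fun x => phi x * psi x).
Proof.
elim: k phi psi => [|k IH] phi psi Cp Cq.
  apply/class_C0 => x.
  by apply: continuousM; [exact: (@class_C_cont _ _ Cp)|exact: (@class_C_cont _ _ Cq)].
apply/class_CS; split=> [x|j x|j].
- by apply: continuousM; [exact: (@class_C_cont _ _ Cp)|exact: (@class_C_cont _ _ Cq)].
- by apply: derivableM; [exact: class_C_derivable Cp|exact: class_C_derivable Cq].
- rewrite (partialM _ Cp Cq); apply: class_CD; apply: IH;
    by [exact: class_C_partial|exact: class_C_le (leqnSn k) _].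
Qed.

Lemma class_CZ k (c : R) phi : class_C k phi -> class_C k (fun x => c * phi x).
Proof. by apply: class_CM; exact: class_C_cst. Qed.

Lemma partialZ k (c : R) phi j : class_C k.+1 phi ->
  partial j (fun x => c * phi x) = fun x => c * partial j phi x.
Proof.
move=> Cp; rewrite (partialM _ (@class_C_cst k.+1 c) Cp) partial_cst.
by apply/funext => x; rewrite mul0r add0r.
Qed.

Lemma class_CB k phi psi : class_C k phi -> class_C k psi ->
  class_C k (fun x => phi x - psi x).
Proof.
move=> Cp Cq; rewrite (_ : (fun x => _) = fun x => phi x + (-1) * psi x).
  by apply: class_CD => //; exact: class_CZ.
by apply/funext => x; rewrite mulN1r.
Qed.

Lemma class_C_sum k (I : Type) (r : seq I) (P : pred I) (F : I -> V -> R) :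
  (forall i, P i -> class_C k (F i)) ->
  class_C k (fun x => \sum_(i <- r | P i) F i x).
Proof.
move=> CF; elim: r => [|i r IH].
  rewrite (_ : (fun x => _) = fun=> 0); first exact: class_C_cst.
  by apply/funext => y; rewrite big_nil.
rewrite (_ : (fun x => _) =
  fun x => (if P i then F i x else 0) + \sum_(i <- r | P i) F i x); last first.
  by apply/funext => y; rewrite big_cons; case: ifP; rewrite ?add0r.
by apply: class_CD => //; have [Pi|_] := boolP (P i); [exact: CF|exact: class_C_cst].
Qed.

Lemma partial_sum k (I : Type) (r : seq I) (P : pred I) (F : I -> V -> R) j :
  (forall i, P i -> class_C k.+1 (F i)) ->
  partial j (fun x => \sum_(i <- r | P i) F i x) =
  fun x => \sum_(i <- r | P i) partial j (F i) x.
Proof.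
move=> CF; elim: r => [|i r IH]; apply/funext => x.
  rewrite (_ : (fun x => _) = fun=> 0) ?partial_cst ?big_nil //.
  by apply/funext => y; rewrite big_nil.
rewrite big_cons; case: ifPn => Pi.
  rewrite (_ : (fun x => _) = fun y => F i y + \sum_(i <- r | P i) F i y); last first.
    by apply/funext => y; rewrite big_cons Pi.
  rewrite (@partialD k) ?IH //; [exact: CF|exact: class_C_sum].
rewrite (_ : (fun x => _) = fun y => \sum_(i <- r | P i) F i y) ?IH //.
by apply/funext => y; rewrite big_cons (negPf Pi).
Qed.

Definition coordf (l : 'I_n) : V -> R := fun x => x 0 l.

Lemma partial_coord l j : partial j (coordf l) = fun=> (j == l)%:R.
Proof.
apply/funext => x; apply: partialE; apply/is_derive_epsP => e e0.
exists 1 => // h h0 _; rewrite /coordf !mxE /= addrK [l == j]eq_sym mulKf //.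
by rewrite subrr normr0 ltW.
Qed.

Lemma class_C_coord k l : class_C k (coordf l).
Proof.
case: k => [|k]; first by apply/class_C0; exact: coord_continuous.
apply/class_CS; split=> [|j x|j]; first exact: coord_continuous.
- have : is_derive x (basis j) (coordf l) ((j == l)%:R : R); last by case.
  apply/is_derive_epsP => e e0.
  exists 1 => // h h0 _; rewrite /coordf !mxE /= addrK [l == j]eq_sym mulKf //.
  by rewrite subrr normr0 ltW.
- by rewrite partial_coord; exact: class_C_cst.
Qed.

Definition class_C_map k (B : V -> V) := forall l, class_C k (fun x => B x 0 l).

Lemma class_C_map_cont k B : class_C_map k B -> continuous B.
Proof.
move=> CB x; apply/continuous_epsP => e e0.
have c l : {for x, continuous (fun x => B x 0 l)} by exact: (class_C_cont (CB l)).
have [r rP] := choice (fun l => let: ex_intro2 y a b :=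
  (continuous_epsP _ _).1 (c l) e e0 in ex_intro _ y (conj a b)).
exists (\big[Num.min/1]_l r l).
  by apply: lt_bigmin => // l _; case: (rP l).
move=> y yr; apply: row_norm_le => [|l]; first exact: ltW.
rewrite !mxE; apply: (rP l).2; apply: le_trans yr _; exact: bigmin_le_cond.
Qed.

Lemma partial_comp k phi B j : class_C k.+1 phi -> class_C_map k.+1 B ->
  partial j (fun x => phi (B x)) =
  fun x => \sum_l partial l phi (B x) * partial j (fun y => B y 0 l) x.
Proof.
move=> Cp CB; apply/funext => x; apply: partialE.
apply: is_derive_comp; first exact: class_C_le Cp.
by move=> l; apply: is_derive_partial (CB l).
Qed.

Lemma class_C_comp k phi B : class_C k phi -> class_C_map k B ->
  class_C k (fun x => phi (B x)).
Proof.
elim: k phi B => [|k IH] phi B Cp CB.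
  apply/class_C0 => x; apply: continuous_comp; first exact: (@class_C_map_cont _ _ CB).
  exact: (@class_C_cont _ _ Cp).
apply/class_CS; split=> [x|j x|j].
- apply: continuous_comp; first exact: (@class_C_map_cont _ _ CB).
  exact: (@class_C_cont _ _ Cp).
- have : is_derive x (basis j) (fun x => phi (B x))
    (\sum_l partial l phi (B x) * partial j (fun y => B y 0 l) x); last by case.
  apply: is_derive_comp; first exact: class_C_le Cp.
  by move=> l; apply: is_derive_partial (CB l).
- rewrite (partial_comp _ Cp CB); apply: class_C_sum => l _.
  apply: class_CM; last exact: class_C_partial (CB l).
  apply: IH; first exact: class_C_partial Cp.
  by move=> i; apply: class_C_le (leqnSn k) (CB i).
Qed.

Lemma class_C_map_comp k A B : class_C_map k A -> class_C_map k B ->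
  class_C_map k (fun x => A (B x)).
Proof. by move=> CA CB l; exact: (class_C_comp (CA l) CB). Qed.

End ClassC.

(** * Limits of real sequences and the mean value theorem on [0, 1] *)

Lemma cvg_seq_epsP (R : realType) (u : nat -> R) l :
  u a @[a --> \oo] --> l <->
  forall e, 0 < e -> exists m, forall a, (m <= a)%N -> `|u a - l| <= e.
Proof.
split=> [/cvgrPdist_le c e /c [m _ mP]|H].
  by exists m => a ma; rewrite distrC; exact: mP.
apply/cvgrPdist_le => e /H [m mP]; exists m => // a /= ma.
by rewrite distrC; exact: mP.
Qed.

Lemma cauchy_seq_cvg (R : realType) (u : nat -> R) :
  (forall e, 0 < e -> exists m, forall a b, (m <= a)%N -> (m <= b)%N -> `|u a - u b| <= e) ->
  exists l : R, u a @[a --> \oo] --> l.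
Proof.
move=> H; apply/cvg_ex.
apply/cauchy_cvgP/cauchy_ballP => e e0.
have e20 : 0 < e / 2 by rewrite divr_gt0.
have [m mP] := H (e / 2) e20.
exists (u @` [set a | (m <= a)%N], u @` [set a | (m <= a)%N]).
  by split; exists m => // a ma; exists a.
move=> [_ _] /= [[a ma <-] [b mb <-]]; rewrite /ball /=.
apply: le_lt_trans (mP a b ma mb) _.
lra.
Qed.

Lemma cvg_seq_le (R : realType) (u : nat -> R) l M :
  u a @[a --> \oo] --> l -> (forall a, `|u a| <= M) -> `|l| <= M.
Proof.
move=> /cvg_seq_epsP H uM; apply/ler_addgt0Pr => e /H[m /(_ m (leqnn m))].
have := uM m; rewrite !ler_norml; lra.
Qed.

Lemma mvt01 (R : realType) (g dg : R -> R) :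
  (forall r : R, is_derive r (1 : R) g (dg r)) ->
  exists2 c, 0 <= c <= 1 & g 1 - g 0 = dg c.
Proof.
move=> H; have [|c] := @MVT _ g dg 0 1 ltr01 (fun r _ => H r).
  apply: continuous_in_subspaceT => r _; apply: differentiable_continuous.
  by apply/derivable1_diffP; case: (H r).
rewrite in_itv /= => /andP[c0 c1] ->; exists c; last by rewrite subr0 mulr1.
by rewrite !ltW.
Qed.

(** * Jets: simultaneous bounds on all partial derivatives up to order k *)

Section Jets.
Variables (R : realType) (n : nat).
Local Notation V := 'rV[R]_n.
Local Notation basis j := (delta_mx 0 j : V).
Implicit Types (phi psi : V -> R) (x y : V).

(** Two functions at two points: phi = psi gives a modulus of continuity, x = y a C^k distance, psi
    = 0 a bound. One composition estimate then serves all three purposes. *)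
Definition jet_close k phi x psi y (M : R) := forall J : seq 'I_n,
  (size J <= k)%N -> `|partials J phi x - partials J psi y| <= M.

Definition jet_le k phi x (M : R) := forall J : seq 'I_n,
  (size J <= k)%N -> `|partials J phi x| <= M.

Lemma jet_close0 phi x psi y M :
  jet_close 0 phi x psi y M <-> `|phi x - psi y| <= M.
Proof.
split=> [/(_ [::] isT) //|H J].
by rewrite leqn0 size_eq0 => /eqP ->.
Qed.

Lemma jet_closeS k phi x psi y M : jet_close k.+1 phi x psi y M <->
  `|phi x - psi y| <= M /\
  forall j, jet_close k (partial j phi) x (partial j psi) y M.
Proof.
split=> [H|[H0 H] J].
  split; first exact: (H [::] isT).
  by move=> j J Jk; rewrite -!partials_rcons; apply: H; rewrite size_rcons.
case/lastP: J => [//|J j]; rewrite size_rcons ltnS !partials_rcons => Jk.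
exact: H.
Qed.

Lemma jet_le_close k phi x y M : jet_le k phi x M <-> jet_close k phi x (fun=> 0) y M.
Proof. by split=> H J Jk; have := H J Jk; rewrite partials_cst0 subr0. Qed.

Lemma jet_leS k phi x M : jet_le k.+1 phi x M <->
  `|phi x| <= M /\ forall j, jet_le k (partial j phi) x M.
Proof.
split=> [/(jet_le_close _ _ _ x) /jet_closeS [+ H]|[H0 H]].
  rewrite subr0 => H0; split=> // j; apply/(jet_le_close _ _ _ x).
  by have := H j; rewrite partial_cst.
apply/(jet_le_close _ _ _ x)/jet_closeS; rewrite subr0; split=> // j.
by rewrite partial_cst; apply/jet_le_close.
Qed.

Lemma jet_le_ge0 k phi x M : jet_le k phi x M -> 0 <= M.
Proof. by move=> /(_ [::] isT); apply: le_trans. Qed.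

Lemma jet_close_ge0 k phi x psi y M : jet_close k phi x psi y M -> 0 <= M.
Proof. by move=> /(_ [::] isT); apply: le_trans. Qed.

Lemma jet_le_mono k k' phi x M M' :
  (k' <= k)%N -> M <= M' -> jet_le k phi x M -> jet_le k' phi x M'.
Proof. by move=> kk MM H J Jk; apply: le_trans MM; apply/H/(leq_trans Jk). Qed.

Lemma jet_close_mono k k' phi x psi y M M' : (k' <= k)%N -> M <= M' ->
  jet_close k phi x psi y M -> jet_close k' phi x psi y M'.
Proof. by move=> kk MM H J Jk; apply: le_trans MM; apply/H/(leq_trans Jk). Qed.

Lemma jet_le_partial k phi x M j : jet_le k.+1 phi x M -> jet_le k (partial j phi) x M.
Proof. by move=> /jet_leS[]. Qed.

Lemma partialsD k phi psi J : class_C k phi -> class_C k psi -> (size J <= k)%N ->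
  partials J (fun x => phi x + psi x) = fun x => partials J phi x + partials J psi x.
Proof.
elim/last_ind: J k phi psi => [//|J j IH] [|k] phi psi Cp Cq; rewrite size_rcons // ltnS => Jk.
by rewrite !partials_rcons (partialD _ Cp Cq) (IH k) //; exact: class_C_partial.
Qed.

Lemma partialsZ k (c : R) phi J : class_C k phi -> (size J <= k)%N ->
  partials J (fun x => c * phi x) = fun x => c * partials J phi x.
Proof.
elim/last_ind: J k phi => [//|J j IH] [|k] phi Cp; rewrite size_rcons // ltnS => Jk.
by rewrite !partials_rcons (partialZ _ _ Cp) (IH k) //; exact: class_C_partial.
Qed.

Lemma partialsB k phi psi J : class_C k phi -> class_C k psi -> (size J <= k)%N ->
  partials J (fun x => phi x - psi x) = fun x => partials J phi x - partials J psi x.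
Proof.
elim/last_ind: J k phi psi => [//|J j IH] [|k] phi psi Cp Cq; rewrite size_rcons // ltnS => Jk.
by rewrite !partials_rcons (partialB _ Cp Cq) (IH k) //; exact: class_C_partial.
Qed.

Lemma jet_le_sub k phi psi x M : class_C k phi -> class_C k psi ->
  jet_le k (fun x => phi x - psi x) x M <-> jet_close k phi x psi x M.
Proof.
by move=> Cp Cq; split=> H J Jk; have := H J Jk; rewrite (partialsB Cp Cq Jk).
Qed.

Lemma jet_closeD k phi psi phi' psi' x y M M' :
  class_C k phi -> class_C k psi -> class_C k phi' -> class_C k psi' ->
  jet_close k phi x phi' y M -> jet_close k psi x psi' y M' ->
  jet_close k (fun x => phi x + psi x) x (fun x => phi' x + psi' x) y (M + M').
Proof.
move=> C1 C2 C3 C4 H H' J Jk; rewrite (partialsD C1 C2 Jk) (partialsD C3 C4 Jk).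
rewrite opprD addrACA; apply: le_trans (ler_normD _ _) _.
by apply: lerD; [exact: H|exact: H'].
Qed.

Lemma jet_leD k phi psi x M M' : class_C k phi -> class_C k psi ->
  jet_le k phi x M -> jet_le k psi x M' ->
  jet_le k (fun x => phi x + psi x) x (M + M').
Proof.
move=> C1 C2 H H' J Jk; rewrite (partialsD C1 C2 Jk).
apply: le_trans (ler_normD _ _) _; by apply: lerD; [exact: H|exact: H'].
Qed.

Lemma jet_leZ k (c : R) phi x M : class_C k phi -> jet_le k phi x M ->
  jet_le k (fun x => c * phi x) x (`|c| * M).
Proof.
move=> C1 H J Jk; rewrite (partialsZ _ C1 Jk) normrM ler_wpM2l //; exact: H.
Qed.

Lemma jet_close_trans k phi x psi y chi z M M' :
  jet_close k phi x psi y M -> jet_close k psi y chi z M' ->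
  jet_close k phi x chi z (M + M').
Proof.
move=> H H' J Jk; apply: le_trans (ler_distD (partials J psi y) _ _) _.
by apply: lerD; [exact: H|exact: H'].
Qed.

Lemma jet_close_sum k (I : Type) (r : seq I) (P : pred I) (F G : I -> V -> R) x y (M : I -> R) :
  (forall i, P i -> class_C k (F i)) -> (forall i, P i -> class_C k (G i)) ->
  (forall i, P i -> jet_close k (F i) x (G i) y (M i)) ->
  jet_close k (fun x => \sum_(i <- r | P i) F i x) x
    (fun x => \sum_(i <- r | P i) G i x) y (\sum_(i <- r | P i) M i).
Proof.
move=> CF CG H; elim: r => [|i r IH].
  rewrite (_ : (fun x => \sum_(i <- [::] | P i) F i x) = fun=> 0); last first.
    by apply/funext => z; rewrite big_nil.
  rewrite (_ : (fun x => \sum_(i <- [::] | P i) G i x) = fun=> 0); last first.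
    by apply/funext => z; rewrite big_nil.
  by move=> J _; rewrite partials_cst0 subrr normr0 big_nil.
rewrite [X in jet_close _ _ _ _ _ X]big_cons.
have E (K : I -> V -> R) : (fun x => \sum_(i <- i :: r | P i) K i x) =
    fun x => if P i then K i x + \sum_(i <- r | P i) K i x else \sum_(i <- r | P i) K i x.
  by apply/funext => z; rewrite big_cons.
rewrite !E; have [Pi|_ //] := boolP (P i).
apply: jet_closeD; [exact: CF|exact: class_C_sum|exact: CG|exact: class_C_sum|exact: H|exact: IH].
Qed.

Lemma jet_le_sum k (I : Type) (r : seq I) (P : pred I) (F : I -> V -> R) x (M : I -> R) :
  (forall i, P i -> class_C k (F i)) ->
  (forall i, P i -> jet_le k (F i) x (M i)) ->
  jet_le k (fun x => \sum_(i <- r | P i) F i x) x (\sum_(i <- r | P i) M i).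
Proof.
move=> CF H; apply/(jet_le_close _ _ _ x).
rewrite (_ : (fun=> 0) = fun x => \sum_(i <- r | P i) (fun=> 0 : R) x); last first.
  by apply/funext => z; rewrite big1.
apply: (@jet_close_sum k I r P F (fun _ _ => 0) x x M CF (fun i _ => @class_C_cst R n k 0)) => i Pi.
by apply/jet_le_close; exact: H.
Qed.

(** The factor 2 ^+ k counts the terms produced by k uses of the product rule. *)
Lemma jet_closeM k phi psi phi' psi' x y a b A B :
  class_C k phi -> class_C k psi -> class_C k phi' -> class_C k psi' ->
  jet_close k phi x phi' y a -> jet_le k psi x B -> jet_le k phi' y A ->
  jet_close k psi x psi' y b ->
  jet_close k (fun x => phi x * psi x) x (fun x => phi' x * psi' x) y
    (2 ^+ k * (a * B + A * b)).
Proof.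
elim: k phi psi phi' psi' => [|k IH] phi psi phi' psi' C1 C2 C3 C4 H1 H2 H3 H4.
  apply/jet_close0; rewrite expr0 mul1r.
  rewrite (_ : _ - _ = (phi x - phi' y) * psi x + phi' y * (psi x - psi' y)); last by ring.
  apply: le_trans (ler_normD _ _) _; rewrite !normrM.
  by apply: lerD; apply: ler_pM; rewrite ?normr_ge0 //;
    [exact: (H1 [::])|exact: (H2 [::])|exact: (H3 [::])|exact: (H4 [::])].
have D (f : V -> R) : class_C k.+1 f -> class_C k f by exact: class_C_le.
move/jet_closeS: (H1) => [H10 H1'] ; move/jet_closeS: (H4) => [H40 H4'].
have Dc (f f' : V -> R) c : jet_close k.+1 f x f' y c -> jet_close k f x f' y c.
  exact: jet_close_mono.
have Dl (f : V -> R) z c : jet_le k.+1 f z c -> jet_le k f z c by exact: jet_le_mono.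
have K0 : 0 <= a * B + A * b.
  by rewrite addr_ge0 // mulr_ge0 ?(jet_le_ge0 H2) ?(jet_le_ge0 H3) ?(jet_close_ge0 H1) ?(jet_close_ge0 H4).
apply/jet_closeS; split.
  have /(_ [::] isT) /= := @IH _ _ _ _ (D _ C1) (D _ C2) (D _ C3) (D _ C4)
    (Dc _ _ _ H1) (Dl _ _ _ H2) (Dl _ _ _ H3) (Dc _ _ _ H4).
  move/le_trans; apply; rewrite ler_wpM2r // ler_weXn2l ?ler1n //.
move=> j; rewrite (partialM _ C1 C2) (partialM _ C3 C4).
rewrite exprS [X in jet_close _ _ _ _ _ X](_ : _ = 2 ^+ k * (a * B + A * b) +
  2 ^+ k * (a * B + A * b)); last by ring.
have P (f : V -> R) : class_C k.+1 f -> forall i, class_C k (partial i f).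
  by move=> Cf i; exact: class_C_partial.
have P1 := P _ C1; have P2 := P _ C2; have P3 := P _ C3; have P4 := P _ C4.
have D1 := D _ C1; have D2 := D _ C2; have D3 := D _ C3; have D4 := D _ C4.
apply: jet_closeD; [exact: class_CM (P1 j) D2|exact: class_CM D1 (P2 j)
  |exact: class_CM (P3 j) D4|exact: class_CM D3 (P4 j)| |].
- exact: (IH _ _ _ _ (P1 j) D2 (P3 j) D4 (H1' j) (Dl _ _ _ H2) (jet_le_partial j H3) (Dc _ _ _ H4)).
- exact: (IH _ _ _ _ D1 (P2 j) D3 (P4 j) (Dc _ _ _ H1) (jet_le_partial j H2) (Dl _ _ _ H3) (H4' j)).
Qed.

Lemma jet_leM k phi psi x A B : class_C k phi -> class_C k psi ->
  jet_le k phi x A -> jet_le k psi x B ->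
  jet_le k (fun x => phi x * psi x) x (2 ^+ k * (A * B)).
Proof.
move=> C1 C2 H1 H2; apply/(jet_le_close _ _ _ x).
rewrite (_ : (fun=> 0) = fun z => (fun _ : V => 0 : R) z * (fun _ : V => 0 : R) z); last first.
  by apply/funext => z; rewrite mul0r.
rewrite (_ : A * B = A * B + 0 * B); last by rewrite mul0r addr0.
have c0 := @class_C_cst R n k 0.
apply: (jet_closeM C1 C2 c0 c0 _ H2).
- by apply/(jet_le_close _ _ _ x).
- by move=> J _; rewrite partials_cst0 normr0.
- by apply/(jet_le_close _ _ _ x).
Qed.

(** The coordinates of a map close to the identity are unbounded; its displacement is bounded
    together with its derivatives, and small. *)
Definition disp (B : V -> V) l : V -> R := fun x => B x 0 l - x 0 l.

Lemma class_C_disp k B l : class_C_map k B -> class_C k (disp B l).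
Proof. by move=> CB; apply: class_CB; [exact: CB|exact: class_C_coord]. Qed.

Lemma partial_disp k B l j : class_C_map k.+1 B ->
  partial j (fun x => B x 0 l) = fun x => (j == l)%:R + partial j (disp B l) x.
Proof.
move=> CB; rewrite /disp (partialB _ (CB l) (@class_C_coord R n k.+1 l)).
by apply/funext => x; rewrite partial_coord addrC subrK.
Qed.

(* The factor (1 + C h) in front of da tends to 1 as B tends to the identity:
   this is what keeps long compositions under control. *)
Lemma jet_close_comp k (H : R) : 0 <= H -> exists2 C, 0 <= C &
  forall a a' B B' x x' da A h db,
  class_C k a -> class_C k a' -> class_C_map k B -> class_C_map k B' -> h <= H ->
  jet_close k a (B x) a' (B' x') da -> jet_le k a' (B' x') A ->
  0 <= h -> (forall l, jet_le k (disp B l) x h) ->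
  (forall l, jet_le k (disp B' l) x' h) -> 0 <= db ->
  (forall l, jet_close k (disp B l) x (disp B' l) x' db) ->
  jet_close k (fun y => a (B y)) x (fun y => a' (B' y)) x'
    ((1 + C * h) * da + C * A * db).
Proof.
move=> H0; elim: k => [|k [C C0 IH]].
  exists 0 => // a a' B B' x x' da A h db _ _ _ _ _ H1 _ _ _ _ _ _.
  by rewrite !mul0r !addr0 mul1r; apply/jet_close0; exact: (H1 [::]).
(* C comes from the lower order; each of the n products of the chain rule adds a Leibniz factor 2 ^+
   k. The coefficient of A * db collects C h from the first factor of a product and 1 + C H from the
   second, whence 1 + 2 C H. *)
exists (C + n%:R * 2 ^+ k * (1 + 2 * C * H)).
  by rewrite addr_ge0 ?mulr_ge0 ?addr_ge0 ?mulr_ge0 ?exprn_ge0.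
move=> a a' B B' x x' da A h db Ca Ca' CB CB' hH H1 H2 h0 H3 H3' db0 H4.
have da0 := jet_close_ge0 H1; have A0 := jet_le_ge0 H2.
set C' := C + _.
have C'0 : 0 <= C' - C.
  by rewrite /C' addrAC subrr add0r !mulr_ge0 ?exprn_ge0 ?addr_ge0 ?mulr_ge0.
have C'C : C <= C' by rewrite -subr_ge0.
have D (f : V -> R) : class_C k.+1 f -> class_C k f by exact: class_C_le.
have P (f : V -> R) j : class_C k.+1 f -> class_C k (partial j f) by exact: class_C_partial.
have DB (f : V -> V) : class_C_map k.+1 f -> class_C_map k f by move=> CF l; apply/D/CF.
have Dl (f : V -> R) z c : jet_le k.+1 f z c -> jet_le k f z c by exact: jet_le_mono.
have Dc (f f' : V -> R) z z' c : jet_close k.+1 f z f' z' c -> jet_close k f z f' z' c.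
  exact: jet_close_mono.
have IHp l : jet_close k (fun y => partial l a (B y)) x
    (fun y => partial l a' (B' y)) x' ((1 + C * h) * da + C * A * db).
  apply: IH => //; try (by apply: P); try (by apply: DB); try (by move=> i; apply: Dl).
  - by case/jet_closeS: H1.
  - exact: jet_le_partial.
  - by move=> i; apply: Dc.
have IHl l : jet_le k (fun y => partial l a' (B' y)) x' ((1 + C * H) * A).
  apply/(jet_le_close _ _ _ x').
  apply: (@jet_close_mono k k _ _ _ _ ((1 + C * h) * A + C * 0 * 0)) => //.
    by rewrite !mulr0 addr0 ler_wpM2r // lerD2l ler_wpM2l.
  apply: (IH (partial l a') (fun=> 0) B' B') => //; try (by apply: P); try (by apply: DB);
    try (by move=> i; apply: Dl).
  - exact: class_C_cst.
  - by apply/(jet_le_close _ _ _ (B' x')); exact: jet_le_partial.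
  - by move=> J _; rewrite partials_cst0 normr0.
  - by move=> i J _; rewrite subrr normr0.
have bnd : (1 + C * h) * da + C * A * db + \sum_(l < n) 2 ^+ k *
    (((1 + C * h) * da + C * A * db) * h + (1 + C * H) * A * db) <=
    (1 + C' * h) * da + C' * A * db.
  rewrite sumr_const card_ord -[X in _ + X]mulr_natl /C' -subr_ge0.
  rewrite (_ : _ - _ = n%:R * 2 ^+ k * (h * da * C * (H - h) + h * da * C * H
    + A * db * C * (H - h))); last by ring.
  have hH' : 0 <= H - h by rewrite subr_ge0.
  by rewrite mulr_ge0 ?addr_ge0 ?mulr_ge0 ?exprn_ge0.
apply/jet_closeS; split.
  have /jet_closeS[+ _] := H1; move/le_trans; apply.
  rewrite mulrDl mul1r -addrA lerDl addr_ge0 ?mulr_ge0 //; exact: le_trans C'C.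
move=> j; rewrite (partial_comp _ Ca CB) (partial_comp _ Ca' CB').
(* Writing F as the identity plus its displacement isolates the term (d_j f) o F, which carries the
   factor 1; all other terms contain a derivative of the displacement, of size h. *)
have E (f : V -> R) (F : V -> V) : class_C_map k.+1 F ->
    (fun x0 => \sum_l partial l f (F x0) * partial j (fun y => F y 0 l) x0) =
    fun x0 => partial j f (F x0) + \sum_l partial l f (F x0) * partial j (disp F l) x0.
  move=> CF; apply/funext => z.
  under eq_bigr => l _ do rewrite (partial_disp _ _ CF) mulrDr.
  rewrite big_split /=; congr (_ + _).
  rewrite (bigD1 j) //= eqxx mulr1 big1 ?addr0 // => i ij.
  by rewrite eq_sym (negPf ij) mulr0.
rewrite (E _ _ CB) (E _ _ CB').
apply: jet_close_mono (leqnn _) bnd _.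
have Cc l : class_C k (fun y => partial l a (B y)) := class_C_comp (P _ l Ca) (DB _ CB).
have Cc' l : class_C k (fun y => partial l a' (B' y)) := class_C_comp (P _ l Ca') (DB _ CB').
have Cd l : class_C k (partial j (disp B l)) := P _ j (class_C_disp l CB).
have Cd' l : class_C k (partial j (disp B' l)) := P _ j (class_C_disp l CB').
apply: jet_closeD; [exact: Cc|by apply: class_C_sum => l _; exact: class_CM (Cc l) (Cd l)
  |exact: Cc'|by apply: class_C_sum => l _; exact: class_CM (Cc' l) (Cd' l)|exact: IHp|].
apply: jet_close_sum => l _;
  [exact: class_CM (Cc l) (Cd l)|exact: class_CM (Cc' l) (Cd' l)|].
apply: (jet_closeM (Cc l) (Cd l) (Cc' l) (Cd' l) (IHp l) _ (IHl l)).
- by apply: jet_le_partial; exact: H3.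
- by case/jet_closeS: (H4 l).
Qed.

Lemma jet_le_comp k (H : R) : 0 <= H -> exists2 C, 0 <= C &
  forall a B x A h, class_C k a -> class_C_map k B -> 0 <= h <= H ->
  jet_le k a (B x) A -> (forall l, jet_le k (disp B l) x h) ->
  jet_le k (fun y => a (B y)) x ((1 + C * h) * A).
Proof.
move=> H0; have [C C0 CP] := jet_close_comp k H0.
exists C => // a B x A h Ca CB /andP[h0 hH] H1 H2.
apply/(jet_le_close _ _ _ x).
rewrite -[X in jet_close _ _ _ _ _ X]addr0 -{2}(mulr0 (C * 0)).
apply: (CP a (fun=> 0) B B x x A 0 h 0 Ca (@class_C_cst R n k 0) CB CB hH _ _ h0 H2 H2 (lexx 0)).
- by apply/(jet_le_close _ _ _ (B x)).
- by move=> J _; rewrite partials_cst0 normr0.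
- by move=> i J _; rewrite subrr normr0.
Qed.

Lemma mean_value phi x y M : class_C 1 phi ->
  (forall r l, 0 <= r <= 1 -> `|partial l phi (y + r *: (x - y))| <= M) ->
  `|phi x - phi y| <= n%:R * M * `|x - y|.
Proof.
move=> C1 H; pose B (r : R) := y + r *: (x - y).
have D r : is_derive (r : R) (1 : R) (fun s => phi (B s))
    (\sum_l partial l phi (B r) * (x - y) 0 l).
  apply: is_derive_comp => // l; apply/is_derive_epsP => e e0; exists 1 => // h h0 _.
  rewrite /B !mxE [h *: (1 : R)]mulr1 [X in _ * X](_ : _ = h * (x 0 l - y 0 l)); last by ring.
  by rewrite mulKf // subrr normr0 ltW.
have [c c01] := mvt01 D.
rewrite /B scale1r scale0r addr0 [y + (x - y)]addrC subrK => ->.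
apply: le_trans (ler_norm_sum _ _ _) _.
rewrite (_ : n%:R * M * `|x - y| = \sum_(l < n) M * `|x - y|); last first.
  by rewrite sumr_const card_ord -[RHS]mulr_natl mulrA.
apply: ler_sum => l _; rewrite normrM; apply: ler_pM => //; first exact: H.
exact: coord_le_norm.
Qed.

(** The source of the loss of one derivative in the sewing: a Lipschitz bound on k-jets uses
    derivatives of order k + 1. *)
Lemma jet_close_mean k phi x y M : class_C k.+1 phi ->
  (forall r, 0 <= r <= 1 -> jet_le k.+1 phi (y + r *: (x - y)) M) ->
  jet_close k phi x phi y (n%:R * M * `|x - y|).
Proof.
move=> Cp H J Jk; apply: mean_value.
  by apply: class_C_partials Cp _; rewrite addn1.
by move=> r l r01; exact: (H r r01 (l :: J)).
Qed.

Lemma segment_in_ball x y z (r s : R) : 0 <= r <= 1 ->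
  `|x - z| <= s -> `|y - z| <= s -> `|y + r *: (x - y) - z| <= s.
Proof.
move=> /andP[r0 r1] xz yz.
rewrite (_ : _ - z = r *: (x - z) + (1 - r) *: (y - z)); last first.
  by apply/rowP => i; rewrite !mxE; ring.
apply: le_trans (ler_normD _ _) _; rewrite !normrZ (ger0_norm r0) ger0_norm ?subr_ge0 //.
rewrite [leRHS](_ : _ = r * s + (1 - r) * s); last by ring.
by apply: lerD; apply: ler_wpM2l; rewrite ?subr_ge0.
Qed.

(** Schwarz's theorem. The second difference of phi over a square of side s does not depend on the
    order of the axes; two uses of the mean value theorem turn it into s^2 times either mixed
    derivative at a point within 2 |s| of x. *)
Lemma partial_comm phi i j : class_C 2 phi ->
  partial i (partial j phi) = partial j (partial i phi).
Proof.
move=> C2.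
have alg (a b c d : R) : a - b - (c - d) = a - c - (b - d) by ring.
have key p q x (s : R) : exists2 z, `|z - x| <= 2 * `|s| &
    phi (x + s *: basis p + s *: basis q) - phi (x + s *: basis p)
    - (phi (x + s *: basis q) - phi x) = s * (s * partial q (partial p phi) z).
  pose g y := phi (y + s *: basis q) - phi y.
  have dg y : is_derive y (basis p) g (partial p phi (y + s *: basis q) - partial p phi y).
    apply: is_deriveB; last exact: is_derive_partial C2.
    apply/is_derive_epsP => e e0.
    have /is_derive_epsP /(_ e e0) [r r0 rP] := is_derive_partial p (y + s *: basis q) C2.
    by exists r => // h h0 hr; have := rP h h0 hr; rewrite addrA.
  have [r _|c cs E] := @mvt_line _ _ g x (basis p) s; first by have [] := dg (x + r *: basis p).
  have [r _|c' cs' E'] := @mvt_line _ _ (partial p phi) (x + c *: basis p) (basis q) s.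
    exact: class_C_derivable (class_C_partial p C2).
  exists (x + c *: basis p + c' *: basis q).
    rewrite (_ : _ - x = c *: basis p + c' *: basis q); last by rewrite addrC !addrA addNr add0r.
    have nb (r : R) l : `|r *: basis l| <= `|r|.
      apply: row_norm_le => // k; rewrite !mxE /=; case: eqVneq => _; by rewrite ?mulr1 ?mulr0 ?normr0.
    rewrite mulr_natl mulr2n; apply: le_trans (ler_normD _ _) _.
    by apply: lerD; apply: le_trans (nb _ _) _.
  have [_ gE] := dg (x + c *: basis p).
  by rewrite gE E' in E; exact: E.
apply/funext => x; apply/eqP; rewrite -subr_eq0 -normr_le0.
apply/ler_addgt0Pr => e e0; rewrite add0r.
have e20 : 0 < e / 2 by rewrite divr_gt0.
have c p q : {for x, continuous (partial q (partial p phi))}.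
  exact: (class_C_cont (class_C_partial q (class_C_partial p C2))).
have [r1 r10 r1P] := (continuous_epsP _ _).1 (c i j) _ e20.
have [r2 r20 r2P] := (continuous_epsP _ _).1 (c j i) _ e20.
pose s := Num.min r1 r2 / 2.
have s0 : 0 < s by rewrite divr_gt0 // lt_min r10.
have [z1 z1x E1] := key i j x s; have [z2 z2x E2] := key j i x s.
have E : partial j (partial i phi) z1 = partial i (partial j phi) z2.
  have s1 := lt0r_neq0 s0; apply/(mulfI s1)/(mulfI s1).
  apply: (etrans (esym E1)); apply: (etrans _ E2).
  by rewrite [x + _ + s *: basis j]addrAC alg.
have sr : 2 * `|s| = Num.min r1 r2 by rewrite (gtr0_norm s0) /s mulrC divfK ?pnatr_eq0.
have := r1P z1; rewrite sr le_min in z1x; case/andP: z1x => z1x _ /(_ z1x).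
have := r2P z2; rewrite sr le_min in z2x; case/andP: z2x => _ z2x /(_ z2x).
rewrite E; move: (partial i (partial j phi) z2) (partial i (partial j phi) x).
move: (partial j (partial i phi) x) => p q r; clear; rewrite !ler_norml; lra.
Qed.

(** Pointwise convergence suffices once the jets are equicontinuous uniformly in the index a. By the
    mean value theorem, difference quotients approximate the derivatives uniformly in a, so the
    derivatives are Cauchy at each point and their limit is the derivative of F; then induct on
    k. *)
Lemma class_C_lim k (Fs : nat -> V -> R) F :
  (forall a, class_C k (Fs a)) ->
  (forall x, Fs a x @[a --> \oo] --> F x) ->
  (forall e, 0 < e -> exists2 r, 0 < r & forall a x y,
     `|x - y| <= r -> jet_close k (Fs a) x (Fs a) y e) ->
  class_C k F /\ forall J, (size J <= k)%N -> forall x,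
    partials J (Fs a) x @[a --> \oo] --> partials J F x.
Proof.
elim: k Fs F => [|k IH] Fs F CF FsF eqc.
  split; last by move=> J; rewrite leqn0 size_eq0 => /eqP ->.
  apply/class_C0 => x; apply/continuous_epsP => e /eqc[r r0 rP].
  exists r => // y yx; apply: (@cvg_seq_le _ (fun a => Fs a y - Fs a x)).
    by apply: cvgB; exact: FsF.
  by move=> a; exact: (rP a y x yx [::]).
have cF : continuous F.
  move=> x; apply/continuous_epsP => e /eqc[r r0 rP].
  exists r => // y yx; apply: (@cvg_seq_le _ (fun a => Fs a y - Fs a x)).
    by apply: cvgB; exact: FsF.
  by move=> a; exact: (rP a y x yx [::]).
have quot j x e : 0 < e -> exists2 r, 0 < r & forall a h, h != 0 -> `|h| <= r ->
    `|h^-1 * (Fs a (h *: basis j + x) - Fs a x) - partial j (Fs a) x| <= e.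
  move=> /eqc[r r0 rP]; exists r => // a h h0 hr.
  have [s _|c ch] := @mvt_line _ _ (Fs a) x (basis j) h.
    exact: class_C_derivable (CF a).
  rewrite [x + h *: _]addrC => ->; rewrite mulKf //.
  apply: (rP a _ x _ [:: j]) => //; rewrite addrC addKr.
  apply: row_norm_le => [|l]; first exact: ltW.
  rewrite !mxE /=; apply: le_trans hr; apply: le_trans ch.
  by case: eqVneq => _; rewrite ?mulr1 ?mulr0 ?normr0.
have [G GP] : exists G : 'I_n -> V -> R, forall j x, partial j (Fs a) x @[a --> \oo] --> G j x.
  suff H jx : exists g : R, partial jx.1 (Fs a) jx.2 @[a --> \oo] --> g.
    have [G GP] := choice H; by exists (fun j x => G (j, x)) => j x; exact: (GP (j, x)).
  case: jx => j x /=; apply: cauchy_seq_cvg => e e0.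
  have e40 : 0 < e / 4 by rewrite divr_gt0.
  have [r r0 rP] := quot j x _ e40.
  have : r^-1 * (Fs a (r *: basis j + x) - Fs a x) @[a --> \oo] -->
         r^-1 * (F (r *: basis j + x) - F x).
    by apply: cvgM; [exact: cvg_cst|apply: cvgB; exact: FsF].
  move=> /cvg_seq_epsP /(_ _ e40) [m mP]; exists m => a b ma mb.
  have rr : `|r| <= r by rewrite gtr0_norm.
  have := rP a r (lt0r_neq0 r0) rr; have := rP b r (lt0r_neq0 r0) rr.
  have := mP a ma; have := mP b mb; rewrite !ler_norml; lra.
have dF j x : is_derive x (basis j) F (G j x).
  apply/is_derive_epsP => e /(quot j x)[r r0 rP]; exists r => // h h0 hr.
  apply: (@cvg_seq_le _ (fun a => h^-1 * (Fs a (h *: basis j + x) - Fs a x) - partial j (Fs a) x)).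
    apply: cvgB; last exact: GP.
    by apply: cvgM; [exact: cvg_cst|apply: cvgB; exact: FsF].
  by move=> a; exact: rP.
have pF j : partial j F = G j by apply/funext => x; exact: partialE.
have IHj j : class_C k (partial j F) /\ forall J, (size J <= k)%N -> forall x,
    partials J (partial j (Fs a)) x @[a --> \oo] --> partials J (partial j F) x.
  apply: IH => [a|x|e /eqc[r r0 rP]].
  - exact: class_C_partial.
  - by rewrite pF; exact: GP.
  - by exists r => // a x y xy; case/jet_closeS: (rP a x y xy).
split.
  apply/class_CS; split=> // j; by case: (IHj j).
move=> J; case/lastP: J => [_ x|J j]; first exact: FsF.
rewrite size_rcons ltnS => Jk x; rewrite partials_rcons.
under eq_fun do rewrite partials_rcons.
by case: (IHj j) => _; apply.
Qed.

End Jets.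

(** * Shuffles and group-like elements *)

Section ShuffleAlgebra.
Variables (R : realType) (A : eqType).
Implicit Types (u v w : seq A) (F G : seq A -> seq A -> R).

Lemma shuffles_nil u : shuffles u [::] = [:: u].
Proof. by case: u. Qed.

Lemma shuffles_cons a u b v : shuffles (a :: u) (b :: v) =
  map (cons a) (shuffles u (b :: v)) ++ map (cons b) (shuffles (a :: u) v).
Proof. by []. Qed.

Lemma size_shuffles u v w : w \in shuffles u v -> size w = (size u + size v)%N.
Proof.
elim: u v w => [|a u IHu] v w; first by rewrite inE => /eqP ->.
elim: v w => [|b v IHv] w; first by rewrite inE => /eqP ->; rewrite addn0.
rewrite shuffles_cons mem_cat => /orP[] /mapP[w' w'P ->] /=.
  by rewrite (IHu _ _ w'P) addSn.
by rewrite (IHv _ w'P) addnS.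
Qed.

(** The deconcatenation coproduct of w, tested against F. *)
Definition deconc w F : R := \sum_(i < (size w).+1) F (take i w) (drop i w).

Lemma deconc_cons a w F :
  deconc (a :: w) F = F [::] (a :: w) + deconc w (fun p q => F (a :: p) q).
Proof. by rewrite /deconc big_ord_recl. Qed.

Lemma deconc_nil F : deconc [::] F = F [::] [::].
Proof. by rewrite /deconc big_ord_recl big_ord0 addr0. Qed.

Lemma deconcD w F G : deconc w (fun p q => F p q + G p q) = deconc w F + deconc w G.
Proof. exact: big_split. Qed.

Lemma eq_deconc w F G : F =2 G -> deconc w F = deconc w G.
Proof. by move=> FG; apply: eq_bigr => i _. Qed.

(** The bialgebra identity: cutting a shuffle of u and v is the same as cutting u and v and
    shuffling heads with heads and tails with tails. Double induction, according to the word that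
    supplies the first letter. *)
Lemma deconc_shuffles u v F :
  \sum_(w <- shuffles u v) deconc w F =
  deconc u (fun u1 u2 => deconc v (fun v1 v2 =>
    \sum_(p <- shuffles u1 v1) \sum_(q <- shuffles u2 v2) F p q)).
Proof.
elim: u v F => [|a u IHu] v F.
  rewrite deconc_nil big_seq1; apply: eq_deconc => p q.
  by rewrite !big_seq1.
elim: v F => [|b v IHv] F.
  rewrite big_seq1; apply: eq_deconc => p q.
  by rewrite deconc_nil !shuffles_nil !big_seq1.
have E c (t : seq (seq A)) : \sum_(q <- map (cons c) t) deconc q F =
    \sum_(q <- t) F [::] (c :: q) + \sum_(q <- t) deconc q (fun p q => F (c :: p) q).
  by rewrite big_map -big_split; apply: eq_bigr => q _; exact: deconc_cons.
rewrite shuffles_cons big_cat /= !E IHu IHv [RHS]deconc_cons.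
set S1 := \sum_(i <- _) _; set X1 := deconc u _; set S2 := \sum_(i <- _) _.
set X2 := deconc (a :: u) _; rewrite deconc_cons -/shuffles.
have -> : \sum_(p <- shuffles (@nil A) [::])
    \sum_(q <- shuffles (a :: u) (b :: v)) F p q = S1 + S2.
  by rewrite big_seq1 shuffles_cons big_cat !big_map.
set T1 := deconc v _; set T2 := deconc u _.
(* [Y] gathers the cuts with both heads non-empty whose shuffled head starts with b. It occurs on
   both sides, and splitting it off leaves sums that match term by term. *)
pose Y := deconc u (fun u1 u2 => deconc v (fun v1 v2 =>
  \sum_(p <- shuffles (a :: u1) v1) \sum_(q <- shuffles u2 v2) F (b :: p) q)).
have -> : X2 = T1 + Y.
  rewrite /X2 deconc_cons; congr (_ + _).
  by apply: eq_deconc => v1 v2; rewrite !big_seq1.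
suff -> : T2 = X1 + Y by rewrite addrACA -!addrA; congr (_ + (_ + _)); rewrite addrCA.
rewrite /T2 /X1 /Y -deconcD; apply: eq_deconc => u1 u2.
rewrite !deconc_cons !shuffles_nil !big_seq1 -addrA; congr (_ + _).
rewrite -deconcD; apply: eq_deconc => v1 v2.
by rewrite shuffles_cons big_cat !big_map.
Qed.

(** The unshuffle coproduct: all ways to distribute the letters of w over two subwords, with
    multiplicity, just as the Leibniz rule distributes a composition of derivations over a
    product. *)
Fixpoint splits w : seq (seq A * seq A) :=
  if w is a :: w' then
    [seq (a :: p.1, p.2) | p <- splits w'] ++ [seq (p.1, a :: p.2) | p <- splits w']
  else [:: ([::], [::])].

Lemma size_splits w p : p \in splits w -> (size p.1 + size p.2)%N = size w.
Proof.
elim: w p => [|a w IH] p /=; first by rewrite inE => /eqP ->.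
by rewrite mem_cat => /orP[] /mapP[q qw ->] /=; rewrite ?addSn ?addnS (IH _ qw).
Qed.

Lemma size_splits_le w p : p \in splits w ->
  (size p.1 <= size w)%N /\ (size p.2 <= size w)%N.
Proof. by move/size_splits <-; rewrite leq_addr leq_addl. Qed.

(** Adjointness of unshuffling and shuffling, by induction on w: its first letter must be the first
    letter of u or of v. *)
Lemma count_splits u v w :
  count_mem (u, v) (splits w) = count_mem w (shuffles u v).
Proof.
elim: w u v => [|c w IH] u v.
  have H : (count_mem [::] (shuffles u v) = ((u == [::]) && (v == [::])))%N.
    case: u v => [|a u] [|b v] //=.
    rewrite count_cat !count_map !(@eq_count _ _ pred0) ?count_pred0 //.
  by rewrite H /= addn0 xpair_eqE ![[::] == _]eq_sym.
rewrite /= count_cat !count_map.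
have E1 : count (preim (fun p : seq A * seq A => (c :: p.1, p.2)) (pred1 (u, v))) (splits w)
   = if u is a :: u' then (if a == c then count_mem w (shuffles u' v) else 0)%N else 0%N.
  case: u => [|a u]; first by rewrite -(count_pred0 (splits w)); apply: eq_count => p.
  have [->|ac] := eqVneq a c.
    by rewrite -IH; apply: eq_count => -[p q]; rewrite /= !xpair_eqE eqseq_cons eqxx.
  rewrite -(count_pred0 (splits w)); apply: eq_count => -[p q] /=.
  by rewrite xpair_eqE eqseq_cons eq_sym (negPf ac).
have E2 : count (preim (fun p : seq A * seq A => (p.1, c :: p.2)) (pred1 (u, v))) (splits w)
   = if v is b :: v' then (if b == c then count_mem w (shuffles u v') else 0)%N else 0%N.
  case: v E1 => [|b v] E1; first by rewrite -(count_pred0 (splits w)); apply: eq_count => -[p q] /=; rewrite xpair_eqE andbF.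
  have [->|bc] := eqVneq b c.
    by rewrite -IH; apply: eq_count => -[p q]; rewrite /= !xpair_eqE eqseq_cons eqxx.
  rewrite -(count_pred0 (splits w)); apply: eq_count => -[p q] /=.
  by rewrite xpair_eqE eqseq_cons [c == b]eq_sym (negPf bc) andbF.
rewrite E1 E2 => {E1 E2}.
have M a (s : seq (seq A)) : count_mem (c :: w) (map (cons a) s) =
    if a == c then count_mem w s else 0%N.
  rewrite count_map; have [->|ac] := eqVneq a c.
    by apply: eq_count => q; rewrite /= eqseq_cons eqxx.
  by rewrite -(count_pred0 s); apply: eq_count => q; rewrite /= eqseq_cons (negPf ac).
case: u v => [|a u] [|b v].
- by [].
- rewrite /= !addn0 eqseq_cons add0n; case: eqVneq => //= _.
- by rewrite addn0 !shuffles_nil /= !addn0 eqseq_cons; case: eqVneq.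
- by rewrite shuffles_cons count_cat !M.
Qed.

End ShuffleAlgebra.

Section GroupLike.
Variables (R : realType) (d N : nat).
Local Notation word := (N.-bseq 'I_d).
Implicit Types (g h k : tensor R d N) (u v w : seq 'I_d).

(** Extension by 0 beyond length N: words can then be cut and concatenated without carrying length
    bounds. *)
Definition ext g w : R := if insub w is Some b then g b else 0.

Lemma ext_bseq g (b : word) : ext g b = g b.
Proof. by rewrite /ext valK. Qed.

Lemma ext_big g w : (N < size w)%N -> ext g w = 0.
Proof. by move=> Nw; rewrite /ext insubF // leqNgt Nw. Qed.

Lemma extE g w (wN : (size w <= N)%N) : ext g w = g (Bseq wN).
Proof. by rewrite -ext_bseq. Qed.

Lemma ext_unit w : ext unit_tensor w = (size w == 0%N)%:R.
Proof.
have [wN|Nw] := leqP (size w) N; first by rewrite (extE _ wN) ffunE.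
by rewrite ext_big // gtn_eqF // (leq_ltn_trans _ Nw).
Qed.

Lemma sum_count g (s : seq (seq 'I_d)) :
  \sum_(w : word) g w * (count_mem (w : seq 'I_d) s)%:R = \sum_(w <- s) ext g w.
Proof.
elim: s => [|a s IH]; first by rewrite big_nil big1 // => w _; rewrite mulr0.
rewrite big_cons -IH /=; under eq_bigr do rewrite natrD mulrDr.
rewrite big_split /=; congr (_ + _).
have [aN|Na] := leqP (size a) N.
  rewrite -(@sum_word_eq R d N (ext g) a aN).
  by apply: eq_bigr => w _; rewrite ext_bseq.
rewrite ext_big // big1 // => w _; case: eqP => E; rewrite ?mulr0 //.
by move: Na; rewrite E ltnNge size_bseq.
Qed.

Lemma ext_star g h w : (size w <= N)%N ->
  ext (star g h) w = deconc w (fun p q => ext g p * ext h q).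
Proof.
move=> wN; rewrite (extE _ wN) starE /deconc.
pose F (s t : seq 'I_d) := ext g s * ext h t.
have E (i : 'I_(size w).+1) : ext g (take i w) * ext h (drop i w) =
  \sum_(u : word) \sum_(v : word) g u * h v *
    ((take i w == u :> seq _)%:R * (drop i w == v :> seq _)%:R).
  have tN : (size (take i w) <= N)%N by rewrite size_take_min (leq_trans (geq_minr _ _)).
  have dN : (size (drop i w) <= N)%N by rewrite size_drop (leq_trans (leq_subr _ _)).
  rewrite -(sum_word_eq (ext g) tN) -(sum_word_eq (ext h) dN) mulr_suml.
  apply: eq_bigr => u _; rewrite mulr_sumr; apply: eq_bigr => v _.
  by rewrite !ext_bseq; ring.
rewrite [RHS](eq_bigr _ (fun i _ => E i)) [RHS]exchange_big; apply: eq_bigr => u _.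
rewrite [RHS]exchange_big; apply: eq_bigr => v _; rewrite -mulr_sumr; congr (_ * _).
have [uvw|nuvw] := eqVneq (u ++ v : seq 'I_d) w.
  have un : (size u < (size w).+1)%N by rewrite ltnS -uvw size_cat leq_addr.
  have tu : take (size u) w = u by rewrite -uvw take_size_cat.
  have dv : drop (size u) w = v by rewrite -uvw drop_size_cat.
  rewrite (bigD1 (Ordinal un)) //= tu dv !eqxx mulr1.
  rewrite big1 ?addr0 // => i; rewrite -val_eqE /= => iu.
  case: eqP => [E1|]; rewrite ?mul0r //.
  case/eqP: iu; rewrite -E1 size_take; case: ltnP => // wi.
  apply/eqP; rewrite eqn_leq wi andbT.
  by have := ltn_ord i; rewrite ltnS.
rewrite big1 // => i _; case: eqP => [E1|]; rewrite ?mul0r //.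
case: eqP => [E2|]; rewrite ?mulr0 //.
by case/eqP: nuvw; rewrite -E1 -E2 cat_take_drop.
Qed.

(** Group-likeness read on words. It is stated for functions on all words so that it also applies to
    the dilated coefficients of the Davie expansions. *)
Definition shuffle_char (a : seq 'I_d -> R) : Prop := a [::] = 1 /\
  forall u v, (size u + size v <= N)%N -> a u * a v = \sum_(w <- shuffles u v) a w.

Lemma shuffle_char_ext g : group_like g -> shuffle_char (ext g).
Proof.
move=> [g1 gS]; split; first by rewrite -g1 pairing_unit -ext_bseq.
move=> u v uv.
have uN : (size u <= N)%N by apply: leq_trans uv; exact: leq_addr.
have vN : (size v <= N)%N by apply: leq_trans uv; exact: leq_addl.
pose e (b : word) : tensor R d N := [ffun w => (b == w)%:R].
have eh (b : word) p : size b = p -> homogeneous p (e b).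
  by move=> <- w wb; rewrite ffunE; case: (eqVneq b w) wb => // ->; rewrite eqxx.
have pe k (b : word) : pairing k (e b) = k b.
  rewrite /pairing (bigD1 b) //= ffunE eqxx mulr1 big1 ?addr0 // => w wb.
  by rewrite ffunE eq_sym (negPf wb) mulr0.
have := gS _ _ _ _ uv (eh (Bseq uN) _ erefl) (eh (Bseq vN) _ erefl).
rewrite !pe -!extE => <-; rewrite -sum_count /pairing; apply: eq_bigr => w _; congr (_ * _).
rewrite ffunE (bigD1 (Bseq uN)) //= [X in _ + X]big1 ?addr0; last first.
  by move=> b bu; rewrite big1 // => c _; rewrite ffunE eq_sym (negPf bu) !mul0r.
rewrite (bigD1 (Bseq vN)) //= [X in _ + X]big1 ?addr0; last first.
  by move=> b bu; rewrite !ffunE [_ == b]eq_sym (negPf bu) mulr0 mul0r.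
by rewrite !ffunE !eqxx !mul1r.
Qed.

Lemma shuffle_char_unit : shuffle_char (ext unit_tensor).
Proof.
split; first by rewrite ext_unit.
move=> u v _; rewrite !ext_unit; case: u => [|a u]; first by rewrite big_seq1 ext_unit mul1r.
rewrite mul0r big_seq big1 // => w /size_shuffles E; by rewrite ext_unit E.
Qed.

Lemma sum_shuffles_star g h u v : (size u + size v <= N)%N ->
  \sum_(w <- shuffles u v) ext (star g h) w =
  deconc u (fun u1 u2 => deconc v (fun v1 v2 =>
    (\sum_(p <- shuffles u1 v1) ext g p) * \sum_(q <- shuffles u2 v2) ext h q)).
Proof.
move=> uv; transitivity (\sum_(w <- shuffles u v) deconc w (fun p q => ext g p * ext h q)).
  rewrite !big_seq; apply: eq_bigr => w /size_shuffles ws.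
  by rewrite ext_star // ws.
rewrite deconc_shuffles; apply: eq_deconc => u1 u2; apply: eq_deconc => v1 v2.
by rewrite mulr_suml; apply: eq_bigr => p _; rewrite mulr_sumr.
Qed.

Lemma deconc_mul u v (a b : seq 'I_d -> R) :
  deconc u (fun u1 u2 => deconc v (fun v1 v2 => (a u1 * a v1) * (b u2 * b v2))) =
  deconc u (fun p q => a p * b q) * deconc v (fun p q => a p * b q).
Proof.
rewrite /deconc mulr_suml; apply: eq_bigr => i _; rewrite mulr_sumr.
by apply: eq_bigr => j _; ring.
Qed.

Lemma shuffle_char_star g h :
  shuffle_char (ext g) -> shuffle_char (ext h) -> shuffle_char (ext (star g h)).
Proof.
move=> [g1 gS] [h1 hS]; split; first by rewrite ext_star // deconc_nil g1 h1 mulr1.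
move=> u v uv; rewrite sum_shuffles_star //.
have uN : (size u <= N)%N by apply: leq_trans uv; exact: leq_addr.
have vN : (size v <= N)%N by apply: leq_trans uv; exact: leq_addl.
rewrite !ext_star // -deconc_mul; apply: eq_bigr => i _; apply: eq_bigr => j _.
rewrite gS ?hS // ?size_take_min ?size_drop; apply: leq_trans uv; apply: leq_add;
  by rewrite ?geq_minr ?leq_subr.
Qed.

(* Both <k, u sh v> and <k, u><k, v> are convolution inverses of
   <g, u sh v> = <g, u><g, v>. *)
Lemma shuffle_char_inv g k :
  shuffle_char (ext g) -> star k g = unit_tensor -> shuffle_char (ext k).
Proof.
move=> [g1 gS] kg; have k1 : ext k [::] = 1.
  have := ext_star k g (leq0n N : (size [::] <= N)%N).
  by rewrite kg ext_unit deconc_nil g1 mulr1.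
split=> // u v; have [m] := ubnP (size u + size v); elim: m u v => // m IH u v uvm uv.
have uN : (size u <= N)%N by apply: leq_trans uv; exact: leq_addr.
have vN : (size v <= N)%N by apply: leq_trans uv; exact: leq_addl.
have [_ oneS] := shuffle_char_unit.
pose D p q := (\sum_(w <- shuffles p q) ext k w) - ext k p * ext k q.
have D0 p q : (size p + size q < size u + size v)%N -> D p q = 0.
  move=> pq; rewrite /D IH ?subrr //; first exact: leq_trans pq uvm.
  exact: ltnW (leq_trans pq uv).
(* The convolution of the defect [D] with g on each factor vanishes, because k * g is the unit and
   the unit is a character. By induction only the full cut survives, with coefficient 1, so D u v =
   0. *)
have : deconc u (fun u1 u2 => deconc v (fun v1 v2 => D u1 v1 * (ext g u2 * ext g v2))) = 0.
  have E1 := sum_shuffles_star k g uv; rewrite kg -(oneS u v uv) -kg in E1.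
  rewrite !ext_star // -deconc_mul in E1.
  apply/eqP; rewrite -[X in _ == X](subrr (deconc u (fun u1 u2 =>
    deconc v (fun v1 v2 => ext k u1 * ext k v1 * (ext g u2 * ext g v2))))).
  rewrite {1}E1 /deconc -sumrB; apply/eqP/eq_bigr => i _.
  rewrite -sumrB; apply: eq_bigr => j _; rewrite /D mulrBl gS //.
  rewrite !size_drop; apply: leq_trans uv; apply: leq_add; exact: leq_subr.
rewrite /deconc big_ord_recr big1 /= ?add0r; last first.
  move=> i _; apply: big1 => j _; rewrite D0 ?mul0r //.
  rewrite !size_take_min -addSn leq_add ?geq_minr //.
  by apply: leq_ltn_trans (geq_minl _ _) _.
rewrite big_ord_recr big1 /= ?add0r; last first.
  move=> i _; rewrite D0 ?mul0r //.
  rewrite !size_take_min -addnS leq_add ?geq_minr //.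
  by apply: leq_ltn_trans (geq_minl _ _) _.
by rewrite !take_size !drop_size g1 !mulr1 /D => /eqP; rewrite subr_eq0 => /eqP.
Qed.

Lemma incrementM (W : R -> tensor R d N) r s t : group_like (W s) ->
  increment W r t = star (increment W r s) (increment W s t).
Proof.
move=> [W1 _]; rewrite /increment -starA [star (W s) _]starA star_invr //.
by rewrite star1l.
Qed.

Lemma increment_refl (W : R -> tensor R d N) s : group_like (W s) ->
  increment W s s = unit_tensor.
Proof. by move=> [W1 _]; rewrite /increment star_invl. Qed.

Lemma shuffle_char_increment (W : R -> tensor R d N) s t :
  group_like (W s) -> group_like (W t) -> shuffle_char (ext (increment W s t)).
Proof.
move=> Ws Wt; apply: shuffle_char_star; last exact: shuffle_char_ext.
apply: (shuffle_char_inv (shuffle_char_ext Ws)).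
by rewrite star_invl //; case: Ws.
Qed.

Lemma sum_pairs_count (s : seq (seq 'I_d * seq 'I_d)) (X : seq 'I_d -> seq 'I_d -> R) :
  (forall p, p \in s -> (size p.1 <= N)%N && (size p.2 <= N)%N) ->
  \sum_(p <- s) X p.1 p.2 = \sum_(u : word) \sum_(v : word)
     X u v * (count_mem (u : seq 'I_d, v : seq 'I_d) s)%:R.
Proof.
elim: s => [|[a b] s IH] H.
  by rewrite big_nil big1 // => u _; rewrite big1 // => v _; rewrite mulr0.
have /andP[/= aN bN] := H _ (mem_head _ _).
rewrite big_cons IH => [|p ps]; last by apply: H; rewrite inE ps orbT.
under [RHS]eq_bigr => u _ do under eq_bigr => v _ do rewrite /= natrD mulrDr.
under [RHS]eq_bigr => u _ do rewrite big_split.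
rewrite big_split /=; congr (_ + _).
rewrite (bigD1 (Bseq aN)) //= [X in _ + X]big1 ?addr0; last first.
  move=> u; rewrite -val_eqE /= => ua; apply: big1 => v _.
  by rewrite xpair_eqE [_ == u :> seq _]eq_sym (negPf ua) mulr0.
rewrite (bigD1 (Bseq bN)) //= big1 ?addr0 ?eqxx ?mulr1 // => v.
by rewrite -val_eqE /= => vb; rewrite xpair_eqE [_ == v :> seq _]eq_sym (negPf vb) andbF mulr0.
Qed.

(** The entry point of the shuffle relation: by [count_splits] the coefficient of X u v on the left
    is the sum of a over the shuffles of u and v, that is a u * a v. The bound K <= N + 1 keeps
    these shuffles within length N. *)
Lemma sum_splits_char (a : seq 'I_d -> R) K (X : seq 'I_d -> seq 'I_d -> R) :
  shuffle_char a -> (K <= N.+1)%N ->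
  \sum_(w : word | (size w < K)%N) a w * \sum_(p <- splits w) X p.1 p.2 =
  \sum_(u : word) \sum_(v : word | (size u + size v < K)%N) a u * a v * X u v.
Proof.
move=> [_ aS] KN.
transitivity (\sum_(w : word | (size w < K)%N) \sum_(u : word) \sum_(v : word)
    a w * X u v * (count_mem (w : seq 'I_d) (shuffles u v))%:R).
  apply: eq_bigr => w _; rewrite sum_pairs_count => [|p /size_splits ps]; last first.
    by have := size_bseq w; rewrite -ps; lia.
  rewrite mulr_sumr; apply: eq_bigr => u _; rewrite mulr_sumr; apply: eq_bigr => v _.
  by rewrite count_splits mulrA.
rewrite exchange_big; apply: eq_bigr => u _.
rewrite exchange_big [RHS]big_mkcond; apply: eq_bigr => v _ /=.
have [uv|uv] := ltnP (size u + size v) K; last first.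
  rewrite big1 // => w wK; rewrite (count_memPn _) ?mulr0 //.
  by apply/negP => /size_shuffles E; move: wK; rewrite E ltnNge uv.
rewrite aS; last by rewrite -ltnS; exact: leq_trans uv KN.
have -> : \sum_(w <- shuffles u v) a w =
    \sum_(w : word) a w * (count_mem (w : seq 'I_d) (shuffles u v))%:R.
  transitivity (\sum_(w <- shuffles u v) ext [ffun b : word => a b] w).
    rewrite !big_seq; apply: eq_bigr => w /size_shuffles ws.
    have wN : (size w <= N)%N by rewrite ws -ltnS; exact: leq_trans uv KN.
    by rewrite (extE _ wN) ffunE.
  by rewrite -sum_count; apply: eq_bigr => w _; rewrite ffunE.
rewrite mulr_suml big_mkcond; apply: eq_bigr => w _.
case: ltnP => wK; first by rewrite mulrAC.
rewrite (count_memPn _) ?mulr0 ?mul0r //.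
by apply/negP => /size_shuffles E; move: wK; rewrite E leqNgt uv.
Qed.

End GroupLike.

(** * Words of vector fields *)

Section Lie.
Variables (R : realType) (n : nat).
Local Notation V := 'rV[R]_n.
Implicit Types (phi psi : V -> R) (x : V) (F : V -> V).

Lemma class_C_lie k F phi : class_C_map k F -> class_C k.+1 phi -> class_C k (lie F phi).
Proof.
move=> CF Cp; apply: class_C_sum => j _; apply: class_CM; first exact: CF.
exact: class_C_partial.
Qed.

Lemma jet_le_lie k F phi x A M : class_C_map k F -> class_C k.+1 phi ->
  (forall j, jet_le k (fun x => F x 0 j) x A) -> jet_le k.+1 phi x M ->
  jet_le k (lie F phi) x (n%:R * 2 ^+ k * A * M).
Proof.
move=> CF Cp HF Hp.
rewrite [X in jet_le _ _ _ X](_ : _ = \sum_(j < n) 2 ^+ k * (A * M)); last first.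
  by rewrite sumr_const card_ord -[RHS]mulr_natl !mulrA.
have Cj (j : 'I_n) : class_C k (partial j phi) := class_C_partial j Cp.
apply: jet_le_sum => j _; first exact: class_CM (CF j) (Cj j).
exact: jet_leM (CF j) (Cj j) (HF j) (jet_le_partial j Hp).
Qed.

Lemma lieZ F (c : R) phi : class_C 1 phi ->
  lie F (fun x => c * phi x) = fun x => c * lie F phi x.
Proof.
move=> Cp; apply/funext => x; rewrite /lie mulr_sumr; apply: eq_bigr => j _.
by rewrite (partialZ _ _ Cp); ring.
Qed.

Lemma lieB F phi psi : class_C 1 phi -> class_C 1 psi ->
  lie F (fun x => phi x - psi x) = fun x => lie F phi x - lie F psi x.
Proof.
move=> Cp Cq; apply/funext => x; rewrite /lie -sumrB; apply: eq_bigr => j _.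
by rewrite (partialB _ Cp Cq) mulrBr.
Qed.

Lemma lie_sum F (I : Type) (r : seq I) (P : pred I) (G : I -> V -> R) :
  (forall i, P i -> class_C 1 (G i)) ->
  lie F (fun x => \sum_(i <- r | P i) G i x) =
  fun x => \sum_(i <- r | P i) lie F (G i) x.
Proof.
move=> CG; apply/funext => x; rewrite /lie exchange_big; apply: eq_bigr => j _.
by rewrite (partial_sum _ _ CG) mulr_sumr.
Qed.

Lemma lieM F phi psi : class_C 1 phi -> class_C 1 psi ->
  lie F (fun x => phi x * psi x) = fun x => lie F phi x * psi x + phi x * lie F psi x.
Proof.
move=> Cp Cq; apply/funext => x; rewrite /lie mulr_suml mulr_sumr -big_split /=.
by apply: eq_bigr => j _; rewrite (partialM _ Cp Cq); ring.
Qed.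

Lemma lie_coord F l : lie F (@coordf R n l) = fun x => F x 0 l.
Proof.
apply/funext => x; rewrite /lie (bigD1 l) //= partial_coord eqxx mulr1.
by rewrite big1 ?addr0 // => j jl; rewrite partial_coord (negPf jl) mulr0.
Qed.

(** The commutator of a partial derivative with a field: the extra sum carries the derivatives of
    the coefficients of F. The second derivatives of phi are exchanged by [partial_comm]. *)
Lemma partial_lie F phi j : class_C_map 1 F -> class_C 2 phi ->
  partial j (lie F phi) = fun x =>
    \sum_l partial j (fun y => F y 0 l) x * partial l phi x + lie F (partial j phi) x.
Proof.
move=> CF Cp; have Cl l : class_C 1 (partial l phi) := class_C_partial l Cp.
rewrite /lie (@partial_sum _ _ 0); last by move=> l _; apply: class_CM.
apply/funext => x; rewrite -big_split /=; apply: eq_bigr => l _.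
by rewrite (partialM _ (CF l) (Cl l)) (partial_comm j l Cp).
Qed.

End Lie.

Section Gamma.
Variables (R : realType) (d n m : nat) (f : 'I_d -> 'rV[R]_n -> 'rV[R]_n) (A : R).
Hypothesis fC : forall i j, class_Cb_le m A (fun x => f i x 0 j).
Local Notation V := 'rV[R]_n.
Implicit Types (phi psi : V -> R) (x : V) (w u v : seq 'I_d).

Lemma class_C_field k i : (k <= m)%N -> class_C_map k (f i).
Proof. by move=> km j; apply: class_C_le km _; have [] := fC i j. Qed.

Lemma Gamma_cat u v phi : Gamma f (u ++ v) phi = Gamma f u (Gamma f v phi).
Proof. by rewrite /Gamma foldr_cat. Qed.

Lemma class_C_Gamma k w phi : (k + size w <= m.+1)%N -> class_C (k + size w) phi ->
  class_C k (Gamma f w phi).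
Proof.
elim: w k => [|i w IH] k /=; first by rewrite addn0.
rewrite addnS ltnS => km Cp; apply: class_C_lie.
  by apply: class_C_field; apply: leq_trans km; exact: leq_addr.
by apply: IH; rewrite addSn.
Qed.

(** One factor per letter, as given by [jet_le_lie] at some order k <= m, for words of at most m + 1
    letters. *)
Definition Gamma_const : R := (1 + n%:R * 2 ^+ m * `|A|) ^+ m.+1.

Lemma Gamma_const_ge1 : 1 <= Gamma_const.
Proof. by apply: exprn_ege1; rewrite lerDl !mulr_ge0 // exprn_ge0. Qed.

Lemma jet_le_Gamma k w phi x M : (k + size w <= m.+1)%N -> class_C (k + size w) phi ->
  jet_le (k + size w) phi x M -> jet_le k (Gamma f w phi) x (Gamma_const * M).
Proof.
move=> km Cp Hp; have M0 := jet_le_ge0 Hp.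
set B := 1 + n%:R * 2 ^+ m * `|A|.
have B1 : 1 <= B by rewrite lerDl !mulr_ge0 // exprn_ge0.
suff H : jet_le k (Gamma f w phi) x (B ^+ size w * M).
  apply: jet_le_mono (leqnn k) _ H; rewrite ler_wpM2r // ler_weXn2l //.
  by apply: leq_trans km; exact: leq_addl.
elim: w k km Cp Hp => [|i w IH] k /=; first by rewrite addn0 expr0 mul1r.
rewrite addnS ltnS => km Cp Hp.
have kn : (k <= m)%N by apply: leq_trans km; exact: leq_addr.
have H1 : jet_le k.+1 (Gamma f w phi) x (B ^+ size w * M) by apply: IH; rewrite ?addSn.
have C1 : class_C k.+1 (Gamma f w phi) by apply: class_C_Gamma; rewrite addSn.
have Hf j : jet_le k (fun x => f i x 0 j) x A.
  move=> J Jk; have [_] := fC i j; apply; exact: leq_trans Jk kn.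
apply: jet_le_mono (leqnn k) _ (jet_le_lie (class_C_field i kn) C1 Hf H1).
rewrite exprS -[leRHS]mulrA; apply: ler_wpM2r; first by rewrite mulr_ge0 // exprn_ge0 // (le_trans _ B1).
have A1 := ler_norm A; have le2 : 2 ^+ k <= 2 ^+ m :> R by rewrite ler_weXn2l ?ler1n.
rewrite /B; apply: (@le_trans _ _ (n%:R * 2 ^+ m * `|A|)); last by rewrite lerDr.
apply: (@le_trans _ _ (n%:R * 2 ^+ k * `|A|)).
  by rewrite ler_wpM2l // mulr_ge0 // exprn_ge0.
by rewrite ler_wpM2r // ler_wpM2l.
Qed.

Lemma GammaB w phi psi : (size w <= m.+1)%N -> class_C (size w) phi -> class_C (size w) psi ->
  Gamma f w (fun x => phi x - psi x) = fun x => Gamma f w phi x - Gamma f w psi x.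
Proof.
elim: w => //= i w IH wm Cp Cq.
have wm' : (1 + size w <= m.+1)%N by [].
rewrite IH; [|exact: ltnW|exact: class_C_le (leqnSn _) Cp|exact: class_C_le (leqnSn _) Cq].
by apply: lieB; [exact: (class_C_Gamma wm' Cp)|exact: (class_C_Gamma wm' Cq)].
Qed.

Lemma Gamma_sum w (I : Type) (r : seq I) (P : pred I) (c : I -> R) (G : I -> V -> R) :
  (size w <= m.+1)%N -> (forall i, P i -> class_C (size w) (G i)) ->
  Gamma f w (fun x => \sum_(i <- r | P i) c i * G i x) =
  fun x => \sum_(i <- r | P i) c i * Gamma f w (G i) x.
Proof.
elim: w => //= i w IH wm CG.
have wm' : (1 + size w <= m.+1)%N by [].
have CG1 j : P j -> class_C 1 (Gamma f w (G j)).
  by move=> Pj; apply: class_C_Gamma => //; exact: CG.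
rewrite IH; [|exact: ltnW|by move=> j Pj; exact: class_C_le (leqnSn _) (CG j Pj)].
rewrite lie_sum; last by move=> j Pj; apply: class_CZ; exact: CG1.
apply/funext => x; apply: eq_bigr => j Pj; by rewrite (lieZ _ _ (CG1 j Pj)).
Qed.

Lemma class_C_Gamma_coord k w l : (k + size w <= m.+1)%N -> class_C k (Gamma f w (coordf l)).
Proof. by move=> km; apply: class_C_Gamma => //; exact: class_C_coord. Qed.

(* The last letter of w turns the (unbounded) coordinate into a component of f. *)
Lemma jet_le_Gamma_coord k w l x : (0 < size w)%N -> (k + size w <= m.+1)%N ->
  jet_le k (Gamma f w (coordf l)) x (Gamma_const * `|A|).
Proof.
case/lastP: w => // w i _; rewrite size_rcons addnS ltnS => km.
rewrite -cats1 Gamma_cat /= lie_coord; apply: jet_le_Gamma.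
- exact: leqW.
- by have [+ _] := fC i l; apply: class_C_le.
- move=> J Jk; have [_ H] := fC i l; apply: le_trans (H J (leq_trans Jk km) x) _.
  exact: ler_norm.
Qed.

(* The chain rule d_j (phi o mu) = sum_l (d_l phi o mu) d_j mu_l, read word by
   word on the formal expansion phi o mu = sum_w a_w Gamma_w phi. *)
Lemma partial_Gamma w phi j : (size w <= m)%N -> class_C (size w).+1 phi ->
  partial j (Gamma f w phi) = fun x => \sum_l \sum_(p <- splits w)
    Gamma f p.1 (partial l phi) x * partial j (Gamma f p.2 (coordf l)) x.
Proof.
elim: w j => [|i w IH] j wm Cp.
  apply/funext => x; rewrite (bigD1 j) //= big_seq1 /= partial_coord eqxx mulr1.
  by rewrite big1 ?addr0 // => l lj; rewrite big_seq1 /= partial_coord eq_sym (negPf lj) mulr0.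
rewrite /= in wm Cp *; have m1 : (1 <= m)%N by exact: leq_trans wm.
have Cf := class_C_field i m1.
have C2 : class_C 2 (Gamma f w phi) by apply: class_C_Gamma; rewrite ?add2n.
have Cs (p : seq 'I_d * seq 'I_d) l : p \in splits w -> class_C 1 (Gamma f p.1 (partial l phi)) /\
    class_C 2 (Gamma f p.2 (coordf l)).
  move=> /size_splits_le[p1 p2]; split.
    apply: class_C_Gamma; first by rewrite add1n ltnS; exact: leq_trans p1 (ltnW wm).
    by rewrite add1n; apply: class_C_partial; apply: class_C_le Cp; rewrite !ltnS.
  by apply: class_C_Gamma_coord; rewrite add2n ltnS; exact: leq_ltn_trans p2 wm.
have wm' : (size w <= m)%N by exact: ltnW.
have Cp' : class_C (size w).+1 phi by exact: class_C_le (leqnSn _) Cp.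
rewrite partial_lie // (IH j wm' Cp').
have -> : lie (f i) (fun x => \sum_l \sum_(p <- splits w)
    Gamma f p.1 (partial l phi) x * partial j (Gamma f p.2 (coordf l)) x) =
  fun x => \sum_l \sum_(p <- splits w)
    (lie (f i) (Gamma f p.1 (partial l phi)) x * partial j (Gamma f p.2 (coordf l)) x +
     Gamma f p.1 (partial l phi) x * lie (f i) (partial j (Gamma f p.2 (coordf l))) x).
  have C1 l (p : seq 'I_d * seq 'I_d) : p \in splits w -> class_C 1 (fun x =>
      Gamma f p.1 (partial l phi) x * partial j (Gamma f p.2 (coordf l)) x).
    by move=> /Cs - /(_ l)[c1 c2]; apply: class_CM => //; exact: class_C_partial.
  rewrite lie_sum; last first.
    move=> l _; under eq_fun do rewrite big_seq; apply: class_C_sum => p; exact: C1.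
  apply/funext => x; apply: eq_bigr => l _.
  under eq_fun do rewrite big_seq.
  rewrite lie_sum; last by move=> p; exact: C1.
  rewrite [RHS]big_seq; apply: eq_bigr => p pw; have [c1 c2] := Cs p l pw.
  by rewrite (lieM _ c1 (class_C_partial j c2)).
apply/funext => x.
(* The new letter i joins either subword. When it joins the second, the derivatives of the
   coefficients of f i and the term [lie (f i) (partial j _)] recombine, by [partial_lie], into the
   derivative of the longer Gamma. *)
have -> : \sum_l partial j (fun y => f i y 0 l) x * partial l (Gamma f w phi) x =
    \sum_l \sum_k partial j (fun y => f i y 0 k) x * \sum_(p <- splits w)
      Gamma f p.1 (partial l phi) x * partial k (Gamma f p.2 (coordf l)) x.
  by rewrite exchange_big; apply: eq_bigr => k _; rewrite (IH k wm' Cp') mulr_sumr.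
rewrite -big_split; apply: eq_bigr => l _ /=.
under eq_bigr => k _ do rewrite mulr_sumr.
rewrite exchange_big -big_split /= big_cat !big_map /= -big_split /=.
rewrite !big_seq; apply: eq_bigr => p pw; have [_ c2] := Cs p l pw.
rewrite (partial_lie _ Cf c2) [in RHS]mulrDr addrCA; congr (_ + (_ + _)).
by rewrite mulr_sumr; apply: eq_bigr => k _; rewrite mulrCA.
Qed.

(* Likewise for the derivative in c of phi o mu when a_w is replaced by c^|w| a_w. *)
Lemma size_Gamma w phi : (size w <= m)%N -> class_C (size w).+1 phi ->
  forall x, (size w)%:R * Gamma f w phi x = \sum_l \sum_(p <- splits w)
    (size p.2)%:R * (Gamma f p.1 (partial l phi) x * Gamma f p.2 (coordf l) x).
Proof.
elim: w => [|i w IH] wm Cp x.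
  by rewrite mul0r big1 // => l _; rewrite big_seq1 /= mul0r.
rewrite /= in wm Cp *.
have Cs (p : seq 'I_d * seq 'I_d) l : p \in splits w -> class_C 1 (Gamma f p.1 (partial l phi)) /\
    class_C 1 (Gamma f p.2 (coordf l)).
  move=> /size_splits_le[p1 p2]; split.
    apply: class_C_Gamma; first by rewrite add1n ltnS; exact: leq_trans p1 (ltnW wm).
    by rewrite add1n; apply: class_C_partial; apply: class_C_le Cp; rewrite !ltnS.
  by apply: class_C_Gamma_coord; rewrite add1n ltnS; exact: leq_trans p2 (ltnW wm).
have wm' : (size w <= m)%N by exact: ltnW.
have Cp' : class_C (size w).+1 phi by exact: class_C_le (leqnSn _) Cp.
have C1 : class_C 1 (Gamma f w phi) by apply: class_C_Gamma; rewrite ?add1n // ltnS.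
(* Of the |w| + 1 copies of the left-hand side, |w| come from the induction hypothesis by the
   product rule ([E2]). The remaining one, [E1], supplies the extra 1 in the weight when i joins the
   second subword. *)
have E1 : lie (f i) (Gamma f w phi) x = \sum_l \sum_(p <- splits w)
    Gamma f p.1 (partial l phi) x * lie (f i) (Gamma f p.2 (coordf l)) x.
  rewrite {1}/lie; under eq_bigr => k _ do rewrite (partial_Gamma _ wm' Cp') mulr_sumr.
  rewrite exchange_big; apply: eq_bigr => l _.
  under eq_bigr => k _ do rewrite mulr_sumr.
  rewrite exchange_big; apply: eq_bigr => p _; rewrite /lie mulr_sumr.
  by apply: eq_bigr => k _; ring.
have E2 : (size w)%:R * lie (f i) (Gamma f w phi) x = \sum_l \sum_(p <- splits w)
    (size p.2)%:R * (lie (f i) (Gamma f p.1 (partial l phi)) x * Gamma f p.2 (coordf l) x +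
     Gamma f p.1 (partial l phi) x * lie (f i) (Gamma f p.2 (coordf l)) x).
  have -> : (size w)%:R * lie (f i) (Gamma f w phi) x =
      lie (f i) (fun y => (size w)%:R * Gamma f w phi y) x by rewrite lieZ.
  rewrite (funext (IH wm' Cp')).
  have Cm l (p : seq 'I_d * seq 'I_d) : p \in splits w -> class_C 1 (fun x =>
      Gamma f p.1 (partial l phi) x * Gamma f p.2 (coordf l) x).
    by move=> /Cs - /(_ l)[c1 c2]; apply: class_CM.
  rewrite lie_sum; last first.
    move=> l _; under eq_fun do rewrite big_seq; apply: class_C_sum => p pw.
    by apply: class_CZ; exact: Cm.
  apply: eq_bigr => l _.
  under eq_fun do rewrite big_seq.
  rewrite lie_sum; last by move=> p pw; apply: class_CZ; exact: Cm.
  rewrite [RHS]big_seq; apply: eq_bigr => p pw; have [c1 c2] := Cs p l pw.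
  by rewrite (lieZ _ _ (Cm l p pw)) (lieM _ c1 c2).
rewrite -[in LHS]addn1 natrD mulrDl mul1r E2 E1 -big_split; apply: eq_bigr => l _ /=.
rewrite -big_split big_cat !big_map /= -big_split /=.
apply: eq_bigr => p _; rewrite -[in RHS]addn1 natrD; ring.
Qed.

End Gamma.

(** * Davie expansions *)

Lemma is_derive_power (R : realType) (r : R) k :
  is_derive (r : R) (1 : R) (fun t : R => t ^+ k) (k%:R * r ^+ k.-1).
Proof.
elim: k => [|k IH]; first by rewrite mul0r; exact: (is_derive_cst (1 : R)).
have -> : (fun t : R => t ^+ k.+1) = (fun t : R => t * t ^+ k).
  by apply/funext => t; rewrite exprS.
have D := @is_deriveM R R id (fun t : R => t ^+ k) r 1 _ _ (is_derive_id r (1 : R)) IH.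
refine (is_derive_eq D _).
rewrite /= [_ *: (1 : R)]mulr1 [r *: _]mulrCA -natr1 mulrDl mul1r; congr (_ + _).
by case: k {IH D} => [|k]; rewrite ?mul0r //= -exprS.
Qed.

Section Davie.
Variables (R : realType) (d n N : nat) (f : 'I_d -> 'rV[R]_n -> 'rV[R]_n) (A H : R).
Hypothesis fC : forall i j, class_Cb_le (2 * N + 1) A (fun x => f i x 0 j).
Hypothesis H0 : 0 <= H.
Local Notation V := 'rV[R]_n.
Local Notation word := (N.-bseq 'I_d).
Local Notation m := (2 * N + 1)%N.
Local Notation CG := (Gamma_const n m A).
Implicit Types (phi : V -> R) (x : V) (a : seq 'I_d -> R).

(** The strict bound makes K the order of the error: K = 0 gives the empty sum and K = N + 1 uses
    all words. *)
Definition expansion K a phi x : R := \sum_(w : word | (size w < K)%N) a w * Gamma f w phi x.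

Definition davie a x : V := \row_l expansion N.+1 a (coordf l) x.

Definition remainder K a phi x : R := phi (davie a x) - expansion K a phi x.

(** With h a multiple of |t - s|^gamma this is the homogeneous bound of a rough path, on all levels
    at once. *)
Definition decay (h : R) a := forall w, `|a w| <= h ^+ size w.

(** The dilation of the tensor algebra; for c from 0 to 1 it joins the unit to a through
    characters. *)
Definition dilation (c : R) a : seq 'I_d -> R := fun w => c ^+ size w * a w.

Definition word_count : R := #|{: word}|%:R.
Definition disp_const : R := word_count * ((1 + H) ^+ N * (CG * `|A|)).

Lemma CG_ge0 : 0 <= CG.
Proof. exact: le_trans ler01 (Gamma_const_ge1 n m A). Qed.

Lemma disp_const_ge0 : 0 <= disp_const.
Proof. by rewrite !mulr_ge0 ?exprn_ge0 ?addr_ge0 ?CG_ge0. Qed.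

Lemma expr_le_mono (h : R) k p q : 0 <= h <= H -> (k <= p)%N -> (p <= q)%N ->
  h ^+ p <= (1 + H) ^+ q * h ^+ k.
Proof.
move=> /andP[h0 hH] kp pq; rewrite -{1}(subnK kp) exprD; apply: ler_wpM2r; first exact: exprn_ge0.
apply: (@le_trans _ _ ((1 + H) ^+ (p - k))).
  rewrite lerXn2r ?nnegrE ?addr_ge0 //; apply: le_trans hH _; by rewrite lerDr.
rewrite ler_weXn2l ?lerDl //; exact: leq_trans (leq_subr _ _) pq.
Qed.

Lemma sum_word_const (P : pred word) (M : R) : 0 <= M ->
  \sum_(w : word | P w) M <= word_count * M.
Proof.
move=> M0; rewrite /word_count mulr_natl -sumr_const [leLHS]big_mkcond /=.
by apply: ler_sum => w _; case: ifP.
Qed.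

Lemma norm_sum_word (P : pred word) (F : word -> R) (M : R) : 0 <= M ->
  (forall w, P w -> `|F w| <= M) -> `|\sum_(w : word | P w) F w| <= word_count * M.
Proof.
move=> M0 FM; apply: le_trans (ler_norm_sum _ _ _) _.
by apply: le_trans (sum_word_const P M0); exact: ler_sum.
Qed.

Lemma dilation1 a : dilation 1 a = a.
Proof. by apply/funext => w; rewrite /dilation expr1n mul1r. Qed.

Lemma shuffle_char_dilation c a : shuffle_char N a -> shuffle_char N (dilation c a).
Proof.
move=> [a1 aS]; split; first by rewrite /dilation expr0 mul1r.
move=> u v uv; rewrite /dilation mulrACA aS // -exprD mulr_sumr !big_seq.
by apply: eq_bigr => w /size_shuffles ->.
Qed.

Lemma decay_dilation c h a : 0 <= c <= 1 -> decay h a -> decay h (dilation c a).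
Proof.
move=> /andP[c0 c1] ah w; rewrite /dilation normrM -[leRHS]mul1r.
by apply: ler_pM => //; rewrite normrX ger0_norm // exprn_ile1.
Qed.

Lemma expansionS K a phi x : a [::] = 1 ->
  expansion K.+1 a phi x =
  phi x + \sum_(w : word | (0 < size w < K.+1)%N) a w * Gamma f w phi x.
Proof.
move=> a1; rewrite /expansion (bigD1 [bseq]) //= a1 mul1r; congr (_ + _).
by apply: eq_bigl => w; rewrite -val_eqE /= lt0n size_eq0 andbC.
Qed.

Lemma expansion_dilation0 K a phi x : a [::] = 1 ->
  expansion K.+1 (dilation 0 a) phi x = phi x.
Proof.
move=> a1; rewrite expansionS ?big1 ?addr0 /dilation ?expr0 ?mul1r //.
by move=> w /andP[w0 _]; rewrite expr0n gtn_eqF // !mul0r.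
Qed.

(** The last letter of a non-empty word already turns the coordinate into a component of f, so at
    most N - 1 derivatives of f are spent, and 2N + 1 - (N - 1) = N + 2. *)
Lemma class_C_davie a : class_C_map N.+2 (davie a).
Proof.
move=> l; rewrite (_ : (fun x => _) = expansion N.+1 a (coordf l)); last first.
  by apply/funext => x; rewrite mxE.
apply: class_C_sum => w wN; apply: class_CZ; apply: (class_C_Gamma_coord fC).
by rewrite !addSn !ltnS; have := size_bseq w; rewrite addn1 mul2n -addnn ltnS leq_add2l.
Qed.

Lemma jet_le_disp_davie a h l x : a [::] = 1 -> decay h a -> 0 <= h <= H ->
  jet_le N.+2 (disp (davie a) l) x (disp_const * h).
Proof.
move=> a1 ah hH; have [h0 _] := andP hH.
rewrite (_ : disp _ _ = fun y => \sum_(w : word | (0 < size w < N.+1)%N)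
    a w * Gamma f w (coordf l) y); last first.
  by apply/funext => y; rewrite /disp mxE expansionS // addrC addKr.
have B0 : 0 <= (1 + H) ^+ N * h * (CG * `|A|).
  by rewrite !mulr_ge0 ?exprn_ge0 ?addr_ge0 ?CG_ge0.
have E : \sum_(w : word | (0 < size w < N.+1)%N) (1 + H) ^+ N * h * (CG * `|A|)
    <= disp_const * h.
  apply: le_trans (sum_word_const _ B0) _.
  by rewrite /disp_const -!mulrA [`|A| * h]mulrC [h * (CG * _)]mulrCA.
have wm (w : word) : (N.+2 + size w <= m.+1)%N.
  by have := size_bseq w; rewrite !addSn !ltnS addn1 mul2n -addnn ltnS leq_add2l.
apply: jet_le_mono (leqnn _) E _; apply: jet_le_sum => w /andP[w0 wN].
  by apply: class_CZ; exact: (class_C_Gamma_coord fC).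
apply: jet_le_mono (leqnn _) _ (jet_leZ (a w) (class_C_Gamma_coord fC l (wm w))
  (jet_le_Gamma_coord fC l x w0 (wm w))).
apply: ler_wpM2r; first by rewrite mulr_ge0 ?CG_ge0.
by apply: le_trans (ah w) _; rewrite -{2}(expr1 h); apply: expr_le_mono.
Qed.

Lemma davie_near a h x : a [::] = 1 -> decay h a -> 0 <= h <= H ->
  `|davie a x - x| <= disp_const * h.
Proof.
move=> a1 ah hH; have [h0 _] := andP hH.
apply: row_norm_le => [|l]; first by rewrite mulr_ge0 // disp_const_ge0.
have := jet_le_disp_davie l x a1 ah hH (isT : (size (@nil 'I_n) <= N.+2)%N).
by rewrite /= /disp !mxE.
Qed.

Lemma is_derive_dilation (P : pred word) a (c : word -> R) (r : R) :
  is_derive (r : R) (1 : R) (fun s : R => \sum_(w : word | P w) dilation s a w * c w)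
    (\sum_(w : word | P w) (size w)%:R * r ^+ (size w).-1 * a w * c w).
Proof.
elim: (index_enum _) => [|w s IH].
  rewrite big_nil (_ : (fun _ => _) = cst 0); first exact: is_derive_cst.
  by apply/funext => t; rewrite big_nil.
rewrite big_cons (_ : (fun _ => _) = fun t => (if P w then t ^+ size w * (a w * c w) else 0) +
    \sum_(j <- s | P j) dilation t a j * c j); last first.
  by apply/funext => t; rewrite big_cons /dilation mulrA; case: (P w); rewrite ?add0r.
rewrite (_ : (if P w then _ else _) = (if P w then (size w)%:R * r ^+ (size w).-1 * a w * c w else 0)
   + \sum_(j <- s | P j) (size j)%:R * r ^+ (size j).-1 * a j * c j); last first.
  by case: (P w); rewrite ?add0r.
apply: is_deriveD; case: (P w); last exact: is_derive_cst.
have X := is_derive_power r (size w).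
have D := @is_deriveM R R (fun t : R => t ^+ size w) (cst (a w * c w)) r 1 _ _ X
  (is_derive_cst _ _ _).
refine (is_derive_eq D _).
by rewrite /= scaler0 add0r [_ *: _]mulrC mulrA.
Qed.

(** The remainder vanishes when a is dilated by 0, since only the empty word survives. The mean
    value theorem in the dilation parameter c reduces order K + 1 to order K: the derivative in c
    consists of order-K remainders of the d_l phi, each multiplied by a velocity [D c l] of size h,
    and of products of total length at least K + 1. The ball around x contains the images of x under
    the Davie maps of all dilations with c in [0, 1]. *)
Lemma remainder_le K : (K <= N.+1)%N -> exists2 C, 0 <= C & forall a h phi x M,
  shuffle_char N a -> decay h a -> 0 <= h <= H -> class_C K phi ->
  (forall y, `|y - x| <= disp_const * H -> jet_le K phi y M) ->
  `|remainder K a phi x| <= C * M * h ^+ K.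
Proof.
elim: K => [_|K IH KN].
  exists 1 => // a h phi x M [a1 aS] ah hH _ HM.
  rewrite /remainder /expansion big_pred0 // subr0 expr0 mulr1 mul1r.
  apply: (HM (davie a x) _ [::]) => //; apply: le_trans (davie_near x a1 ah hH) _.
  by apply: ler_wpM2l; [exact: disp_const_ge0|case/andP: hH].
have [C C0 CP] := IH (ltnW KN).
pose CD := word_count * ((1 + H) ^+ N * (N%:R * (CG * `|A|))).
pose CT := N%:R * CG * (CG * `|A|) * (1 + H) ^+ (N + N).
have CD0 : 0 <= CD by rewrite !mulr_ge0 ?exprn_ge0 ?addr_ge0 ?CG_ge0.
have CT0 : 0 <= CT by rewrite !mulr_ge0 ?exprn_ge0 ?addr_ge0 ?CG_ge0.
have W0 : 0 <= word_count by exact: ler0n.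
exists (n%:R * (C * CD + word_count * (word_count * CT))).
  by apply: mulr_ge0 => //; apply: addr_ge0; [exact: mulr_ge0|exact: mulr_ge0 W0 (mulr_ge0 W0 CT0)].
move=> a h phi x M aS ah hH Cp HM; have [a1 _] := aS; have [h0 hle] := andP hH.
have rad0 : 0 <= disp_const * H by rewrite mulr_ge0 ?disp_const_ge0.
have HMx : jet_le K.+1 phi x M by apply: HM; rewrite subrr normr0.
have M0 := jet_le_ge0 HMx.
pose D (r : R) l := \sum_(v : word | (size v < N.+1)%N)
  (size v)%:R * r ^+ (size v).-1 * a v * Gamma f v (coordf l) x.
have dF (r : R) : is_derive (r : R) (1 : R) (fun s => remainder K.+1 (dilation s a) phi x)
    (\sum_l partial l phi (davie (dilation r a) x) * D r l -
     \sum_(w : word | (size w < K.+1)%N) (size w)%:R * r ^+ (size w).-1 * a w * Gamma f w phi x).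
  apply: is_deriveB; last exact: is_derive_dilation.
  apply: (@is_derive_comp _ _ _ phi (fun s : R => davie (dilation s a) x)).
    by apply: class_C_le Cp.
  move=> l; rewrite (_ : (fun _ => _) = fun s : R => expansion N.+1 (dilation s a) (coordf l) x).
    exact: is_derive_dilation.
  by apply/funext => s; rewrite mxE.
have [c c01] := mvt01 dF; rewrite dilation1 => E.
have z0 : remainder K.+1 (dilation 0 a) phi x = 0.
  rewrite /remainder expansion_dilation0 //.
  rewrite (_ : davie _ x = x) ?subrr //; apply/rowP => l.
  by rewrite mxE expansion_dilation0.
move: E; rewrite z0 subr0 => ->.
have [c0 c1] := andP c01.
have acS := shuffle_char_dilation c aS; have ach := decay_dilation c01 ah.
have wm (w : word) : (size w <= m)%N.
  by apply: leq_trans (size_bseq w) _; rewrite addn1 mul2n -addnn ltnW // ltnS leq_addr.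
pose T l (u v : word) := c ^+ size u * a u * Gamma f u (partial l phi) x *
  ((size v)%:R * c ^+ (size v).-1 * a v * Gamma f v (coordf l) x).
(* [size_Gamma] rewrites |w| Gamma_w phi over unshuffles of w, and the shuffle relation turns the
   result into a double sum over pairs (u, v) of total length at most K. *)
have S2 : \sum_(w : word | (size w < K.+1)%N) (size w)%:R * c ^+ (size w).-1 * a w * Gamma f w phi x
    = \sum_l \sum_(u : word) \sum_(v : word | (size u + size v < K.+1)%N) T l u v.
  transitivity (\sum_l \sum_(w : word | (size w < K.+1)%N) a w * \sum_(p <- splits w)
     (c ^+ (size p.1 + size p.2).-1 * ((size p.2)%:R *
       (Gamma f p.1 (partial l phi) x * Gamma f p.2 (coordf l) x)))).
    rewrite exchange_big; apply: eq_bigr => w wK.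
    have Cw : class_C (size w).+1 phi by exact: class_C_le Cp.
    rewrite -mulr_sumr [_ * a w]mulrC -!mulrA; congr (_ * _).
    rewrite mulrCA (size_Gamma fC (wm w) Cw) mulr_sumr; apply: eq_bigr => l _.
    by rewrite mulr_sumr !big_seq; apply: eq_bigr => p /size_splits ->.
  apply: eq_bigr => l _.
  rewrite (@sum_splits_char R d N a K.+1 (fun u v => c ^+ (size u + size v).-1 * ((size v)%:R *
       (Gamma f u (partial l phi) x * Gamma f v (coordf l) x))) aS KN).
  apply: eq_bigr => u _; apply: eq_bigr => v _; rewrite /T.
  case: (size v) => [|k]; first by rewrite !mul0r !mulr0.
  by rewrite addnS /= exprD; ring.
(* The corresponding part of the chain rule for phi o [davie] is a double sum of the same terms, but
   with the truncation |u| < K and no condition on v. *)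
have S1 : \sum_l expansion K (dilation c a) (partial l phi) x * D c l =
    \sum_l \sum_(u : word) \sum_(v : word) (if (size u < K)%N then T l u v else 0).
  apply: eq_bigr => l _; rewrite /expansion big_mkcond mulr_suml; apply: eq_bigr => u _.
  case: ifP => _; last by rewrite mul0r big1.
  rewrite /D (eq_bigl xpredT) => [|v]; last by rewrite ltnS size_bseq.
  by rewrite mulr_sumr; apply: eq_bigr => v _; rewrite /T /dilation.
have Dle l : `|D c l| <= CD * h.
  have X0 : 0 <= N%:R * ((1 + H) ^+ N * h) * (CG * `|A|).
    by rewrite !mulr_ge0 ?exprn_ge0 ?addr_ge0 ?CG_ge0.
  apply: le_trans (norm_sum_word X0 _) _ => [v vN|]; last first.
    by rewrite le_eqVlt; apply/orP; left; apply/eqP; rewrite /CD; ring.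
  have [v0|v0] := posnP (size v); first by rewrite v0 !mul0r normr0.
  rewrite !normrM normr_nat normrX (ger0_norm c0); apply: ler_pM => //; rewrite ?mulr_ge0 ?exprn_ge0 //.
    apply: ler_pM => //; rewrite ?mulr_ge0 ?exprn_ge0 //.
      rewrite -[leRHS]mulr1; apply: ler_pM; rewrite ?exprn_ge0 ?exprn_ile1 //.
      by rewrite ler_nat.
    by apply: le_trans (ah v) _; rewrite -{2}(expr1 h); apply: expr_le_mono.
  apply: (jet_le_Gamma_coord fC l x v0 _ (isT : (size (@nil 'I_n) <= 0)%N)).
  by rewrite add0n ltnW // ltnS; exact: wm.
(* Terms with v empty carry the factor |v| = 0. For v non-empty, |u| + |v| <= K forces |u| < K, so
   the two truncations differ only by terms of total length at least K + 1, whence h ^+ K.+1. *)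
have Tle l (u v : word) : `|(if (size u < K)%N then T l u v else 0) -
    (if (size u + size v < K.+1)%N then T l u v else 0)| <= CT * M * h ^+ K.+1.
  have B0 : 0 <= CT * M * h ^+ K.+1 by rewrite mulr_ge0 ?exprn_ge0 // mulr_ge0.
  have [v0|v0] := posnP (size v).
    by have -> : T l u v = 0; rewrite ?if_same ?subrr ?normr0 // /T v0 !mul0r mulr0.
  have [uK|uK] := ltnP (size u) K; last first.
    have -> : (size u + size v < K.+1)%N = false.
      by apply/negbTE; rewrite -leqNgt -addn1 leq_add.
    by rewrite subrr normr0.
  have [uvK|uvK] := ltnP (size u + size v) K.+1; first by rewrite subrr normr0.
  rewrite subr0 /T !normrM normr_nat !normrX (ger0_norm c0).
  have huv : `|a u| * `|a v| <= (1 + H) ^+ (N + N) * h ^+ K.+1.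
    apply: (@le_trans _ _ (h ^+ (size u + size v))).
      by rewrite exprD; apply: ler_pM.
    by apply: expr_le_mono => //; rewrite leq_add ?size_bseq.
  have uK1 : ((size u).+1 <= K.+1)%N by rewrite ltnS ltnW.
  have G1 : `|Gamma f u (partial l phi) x| <= CG * M.
    apply: (jet_le_Gamma fC _ _ _ (isT : (size (@nil 'I_n) <= 0)%N)) => //.
    - by rewrite add0n ltnW // ltnS.
    - by rewrite add0n; apply: class_C_partial; exact: class_C_le uK1 Cp.
    - by rewrite add0n; apply: jet_le_partial; exact: jet_le_mono uK1 (lexx M) HMx.
  have G2 : `|Gamma f v (coordf l) x| <= CG * `|A|.
    apply: (jet_le_Gamma_coord fC l x v0 _ (isT : (size (@nil 'I_n) <= 0)%N)).
    by rewrite add0n ltnW // ltnS.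
  have cu : c ^+ size u <= 1 by exact: exprn_ile1.
  have cv : c ^+ (size v).-1 <= 1 by exact: exprn_ile1.
  have sv : (size v)%:R <= N%:R :> R by rewrite ler_nat size_bseq.
  rewrite [leLHS](_ : _ = (c ^+ size u * c ^+ (size v).-1) * ((size v)%:R *
    ((`|Gamma f u (partial l phi) x| * `|Gamma f v (coordf l) x|) * (`|a u| * `|a v|)))); last by ring.
  rewrite [leRHS](_ : _ = (1 * 1) * (N%:R * (((CG * M) * (CG * `|A|)) *
    ((1 + H) ^+ (N + N) * h ^+ K.+1)))); last by rewrite /CT; ring.
  by do !apply: ler_pM => //; rewrite ?mulr_ge0 ?exprn_ge0.
have -> : \sum_l partial l phi (davie (dilation c a) x) * D c l -
     \sum_(w : word | (size w < K.+1)%N) (size w)%:R * c ^+ (size w).-1 * a w * Gamma f w phi x =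
   \sum_l (remainder K (dilation c a) (partial l phi) x * D c l +
     \sum_(u : word) \sum_(v : word) ((if (size u < K)%N then T l u v else 0) -
       (if (size u + size v < K.+1)%N then T l u v else 0))).
  rewrite S2 big_split /= /remainder; under [in RHS]eq_bigr do rewrite mulrBl.
  rewrite sumrB S1 -addrA; congr (_ + _); rewrite -sumrN -[in RHS]sumrN -big_split /=.
  apply: eq_bigr => l _; rewrite -sumrN -[in RHS]sumrN -big_split /=; apply: eq_bigr => u _.
  rewrite sumrB addrA addNr add0r; congr (- _); exact: big_mkcond.
apply: le_trans (ler_norm_sum _ _ _) _.
rewrite [leRHS](_ : _ = \sum_(l < n) (C * M * h ^+ K * (CD * h) +
  word_count * (word_count * (CT * M * h ^+ K.+1)))); last first.
  by rewrite sumr_const card_ord -[RHS]mulr_natl exprS; ring.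
apply: ler_sum => l _; apply: le_trans (ler_normD _ _) _; apply: lerD.
  rewrite normrM; apply: ler_pM => //.
  apply: CP => //; first exact: class_C_partial.
  by move=> y /HM Hy; exact: jet_le_partial.
have B0 : 0 <= CT * M * h ^+ K.+1 by rewrite mulr_ge0 ?exprn_ge0 // mulr_ge0.
have B1 : 0 <= word_count * (CT * M * h ^+ K.+1) by rewrite mulr_ge0.
apply: norm_sum_word => // u _.
by apply: norm_sum_word => // v _; exact: Tle.
Qed.

Lemma size_word_le (w : word) : (size w <= m)%N.
Proof. by apply: leq_trans (size_bseq w) _; rewrite addn1 mul2n -addnn ltnW // ltnS leq_addr. Qed.

Lemma class_C_expansion k K a phi : (k + K <= m.+1)%N -> class_C (k + K) phi ->
  class_C k (expansion K a phi).
Proof.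
move=> kK Cp; apply: class_C_sum => w wK; apply: class_CZ; apply: (class_C_Gamma fC).
  by apply: leq_trans kK; rewrite leq_add2l ltnW.
by apply: class_C_le Cp; rewrite leq_add2l ltnW.
Qed.

Lemma class_C_remainder k K a phi : (k <= N.+2)%N -> (k + K <= m.+1)%N ->
  class_C (k + K) phi -> class_C k (remainder K a phi).
Proof.
move=> kN kK Cp; apply: class_CB; last exact: class_C_expansion.
apply: class_C_comp; first by apply: class_C_le Cp; exact: leq_addr.
by move=> l; apply: class_C_le kN (class_C_davie a l).
Qed.

Lemma partial_davie a j l : partial j (fun x => davie a x 0 l) =
  fun x => \sum_(v : word) a v * partial j (Gamma f v (coordf l)) x.
Proof.
rewrite (_ : (fun x => davie a x 0 l) = fun x => \sum_(v : word) a v * Gamma f v (coordf l) x).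
  have Cv (v : word) : class_C 1 (Gamma f v (coordf l)).
    by apply: (class_C_Gamma_coord fC); rewrite add1n ltnS size_word_le.
  rewrite (@partial_sum _ _ 0) => [|v _]; last exact: class_CZ.
  by apply/funext => x; apply: eq_bigr => v _; rewrite (partialZ _ _ (Cv v)).
apply/funext => x; rewrite mxE; apply: eq_bigl => w; by rewrite ltnS size_bseq.
Qed.

Lemma jet_le_partial_davie a h j l x : a [::] = 1 -> decay h a -> 0 <= h <= H ->
  jet_le N.+1 (partial j (fun x => davie a x 0 l)) x (1 + disp_const * H).
Proof.
move=> a1 ah hH; rewrite (partial_disp l j (class_C_davie a)).
apply: jet_leD; [exact: class_C_cst|exact: class_C_partial (class_C_disp _ (class_C_davie a))| |].
  move=> J _; elim/last_ind: J => [|J i _] /=; first by rewrite ger0_norm ?ler0n // lern1 leq_b1.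
  by rewrite partials_rcons partial_cst partials_cst0 normr0.
apply: jet_le_partial; apply: jet_le_mono (leqnn _) _ (jet_le_disp_davie l x a1 ah hH).
by apply: ler_wpM2l; [exact: disp_const_ge0|case/andP: hH].
Qed.

(** The chain rule for phi o [davie] meets [partial_Gamma] for the expansion. The shuffle relation
    makes the products of total length below K cancel; what is left over has length at least K. *)
Lemma partial_remainder K a phi j : shuffle_char N a -> (K <= N.+1)%N -> class_C K.+1 phi ->
  partial j (remainder K a phi) = fun x =>
    \sum_l remainder K a (partial l phi) x * partial j (fun y => davie a y 0 l) x +
    \sum_l \sum_(u : word) \sum_(v : word | (size u < K <= size u + size v)%N)
      a u * a v * (Gamma f u (partial l phi) x * partial j (Gamma f v (coordf l)) x).
Proof.
move=> aS KN Cp; have C1 : class_C 1 phi by exact: class_C_le Cp.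
have Km : (1 + K <= m.+1)%N by rewrite add1n ltnS (leq_trans KN) // addn1 ltnS mul2n -addnn leq_addr.
have Cd1 : class_C_map 1 (davie a) by move=> l; apply: class_C_le (class_C_davie a l).
rewrite (@partialB _ _ 0); [|exact: class_C_comp|exact: class_C_expansion].
rewrite (partial_comp _ C1 Cd1).
have CG1 (w : word) : (size w < K)%N -> class_C 1 (Gamma f w phi).
  move=> wK; apply: (class_C_Gamma fC); first by rewrite add1n ltnS size_word_le.
  by apply: class_C_le Cp; rewrite add1n ltnS ltnW.
have -> : partial j (expansion K a phi) = fun x => \sum_l \sum_(u : word)
    \sum_(v : word | (size u + size v < K)%N)
    a u * a v * (Gamma f u (partial l phi) x * partial j (Gamma f v (coordf l)) x).
  rewrite (@partial_sum _ _ 0) => [|w wK]; last by apply: class_CZ; exact: CG1.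
  apply/funext => x; transitivity (\sum_l \sum_(w : word | (size w < K)%N) a w *
      \sum_(p <- splits w) Gamma f p.1 (partial l phi) x * partial j (Gamma f p.2 (coordf l)) x).
    rewrite exchange_big; apply: eq_bigr => w wK; rewrite (partialZ _ _ (CG1 w wK)).
    rewrite (partial_Gamma fC) ?size_word_le ?mulr_sumr //.
    by apply: class_C_le Cp; rewrite ltnS ltnW.
  by apply: eq_bigr => l _; exact: (sum_splits_char (fun u v =>
    Gamma f u (partial l phi) x * partial j (Gamma f v (coordf l)) x) aS KN).
apply/funext => x; rewrite /remainder; under [in RHS]eq_bigr do rewrite mulrBl.
rewrite sumrB -addrA; congr (_ + _); set Q := \sum_l _; set S := \sum_l _; set T := \sum_l _.
suff -> : T = Q + S by rewrite opprD addrNK.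
rewrite -big_split; apply: eq_bigr => l _ /=; rewrite partial_davie /expansion mulr_suml.
rewrite big_mkcond -big_split; apply: eq_bigr => u _ /=.
case: ltnP => uK; last first.
  rewrite !big_pred0 ?addr0 // => v; apply/negbTE.
  by rewrite -leqNgt (leq_trans uK) // leq_addr.
rewrite mulr_sumr [X in _ = X + _]big_mkcond [X in _ = _ + X]big_mkcond -big_split /=.
apply: eq_bigr => v _; rewrite [(K <= _)%N]leqNgt; case: ltnP => _ /=; rewrite ?addr0 ?add0r; ring.
Qed.

(** Induction on k through [partial_remainder]. A space derivative does not lower the order in h,
    since the remainders keep order K and the leftover products have length at least K; it costs one
    more derivative of phi. *)
Lemma jet_le_remainder K k : (K <= N.+1)%N -> (k <= N.+1)%N -> exists2 C, 0 <= C &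
  forall a h phi x M, shuffle_char N a -> decay h a -> 0 <= h <= H -> class_C (k + K) phi ->
  (forall y, `|y - x| <= disp_const * H -> jet_le (k + K) phi y M) ->
  jet_le k (remainder K a phi) x (C * M * h ^+ K).
Proof.
move=> KN; elim: k => [_|k IH kN].
  have [C C0 CP] := remainder_le KN; exists C => // a h phi x M aS ah hH Cp HM J.
  by rewrite leqn0 size_eq0 => /eqP -> /=; exact: CP.
have [C C0 CP] := IH (ltnW kN); have [C' C'0 CP'] := remainder_le KN.
pose CY := 1 + CG * `|A|.
have CY0 : 0 <= CY by rewrite addr_ge0 // mulr_ge0 // CG_ge0.
pose CT := 2 ^+ k * (CG * CY) * (1 + H) ^+ (N + N).
have CT0 : 0 <= CT by rewrite mulr_ge0 ?exprn_ge0 ?addr_ge0 // mulr_ge0 ?exprn_ge0 // mulr_ge0 ?CG_ge0.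
have W0 : 0 <= word_count by exact: ler0n.
have P0 : 0 <= 1 + disp_const * H by rewrite addr_ge0 // mulr_ge0 // disp_const_ge0.
pose CR := n%:R * (2 ^+ k * (C * (1 + disp_const * H))) + n%:R * (word_count * (word_count * CT)).
have CR0 : 0 <= CR.
  apply: addr_ge0; first by rewrite mulr_ge0 // mulr_ge0 ?exprn_ge0 // mulr_ge0.
  by rewrite mulr_ge0 // mulr_ge0 // mulr_ge0.
exists (C' + CR); first exact: addr_ge0.
move=> a h phi x M aS ah hH Cp HM; have [a1 _] := aS; have [h0 hle] := andP hH.
have rad0 : 0 <= disp_const * H by rewrite mulr_ge0 ?disp_const_ge0.
have HMx : jet_le (k.+1 + K) phi x M by apply: HM; rewrite subrr normr0.
have M0 := jet_le_ge0 HMx; have hK : 0 <= h ^+ K by exact: exprn_ge0.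
have kK : (k.+1 + K <= m.+1)%N.
  by apply: (@leq_trans (N.+1 + N.+1)); [exact: leq_add|rewrite addn1 mul2n -addnn addSn addnS].
have kn : (k <= N.+1)%N by exact: ltnW.
apply/jet_leS; split.
  apply: (@le_trans _ _ (C' * M * h ^+ K)); last first.
    by apply: ler_wpM2r => //; apply: ler_wpM2r => //; rewrite lerDl.
  apply: CP' => //; first by apply: class_C_le Cp; exact: leq_addl.
  by move=> y /HM; apply: jet_le_mono => //; exact: leq_addl.
move=> j; rewrite partial_remainder //; last by apply: class_C_le Cp; rewrite addSn ltnS leq_addl.
apply: (@jet_le_mono _ _ k k _ _ (CR * M * h ^+ K)) => //.
  by apply: ler_wpM2r => //; apply: ler_wpM2r => //; rewrite lerDr.
have Cd l : class_C k (partial j (fun y => davie a y 0 l)).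
  by apply: class_C_le (class_C_partial j (class_C_davie a l)).
have Cl l : class_C (k + K) (partial l phi) by exact: class_C_partial Cp.
have Cr l : class_C k (remainder K a (partial l phi)).
  by apply: class_C_remainder (Cl l); [exact: leqW|exact: ltnW kK].
have uG (u : word) l : (size u < K)%N -> class_C k (Gamma f u (partial l phi)) /\
    jet_le k (Gamma f u (partial l phi)) x (CG * M).
  move=> uK; have ku : (k + size u <= k + K)%N by rewrite leq_add2l ltnW.
  split; first by apply: (class_C_Gamma fC); [exact: leq_trans ku (ltnW kK)|exact: class_C_le ku (Cl l)].
  apply: (jet_le_Gamma fC); [exact: leq_trans ku (ltnW kK)|exact: class_C_le ku (Cl l)|].
  by apply: jet_le_mono ku (lexx M) (jet_le_partial l HMx).
have kv (v : word) : (k.+1 + size v <= m.+1)%N.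
  apply: (@leq_trans (N.+1 + N)); first exact: leq_add kN (size_bseq v).
  by rewrite addn1 mul2n -addnn addSn leqW.
have vG (v : word) l : class_C k (partial j (Gamma f v (coordf l))) /\
    jet_le k (partial j (Gamma f v (coordf l))) x CY.
  have Cv := class_C_Gamma_coord fC l (kv v).
  split; first exact: class_C_partial Cv.
  have [v0|v0] := posnP (size v).
    rewrite (size0nil v0) /= partial_coord => J _.
    elim/last_ind: J => [|J i _] /=.
      by rewrite ger0_norm ?ler0n // (@le_trans _ _ 1) ?lerDl ?mulr_ge0 ?CG_ge0 // lern1 leq_b1.
    by rewrite partials_rcons partial_cst partials_cst0 normr0.
  apply: jet_le_partial; apply: jet_le_mono (leqnn _) _ (jet_le_Gamma_coord fC l x v0 (kv v)).
  by rewrite lerDr.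
have Ct l (u v : word) : (size u < K)%N -> class_C k (fun x =>
    a u * a v * (Gamma f u (partial l phi) x * partial j (Gamma f v (coordf l)) x)).
  by move=> uK; apply: class_CZ; exact: class_CM (proj1 (uG u l uK)) (proj1 (vG v l)).
have CTM : 0 <= CT * M * h ^+ K by rewrite mulr_ge0 // mulr_ge0.
have Jt l (u v : word) : (size u < K <= size u + size v)%N -> jet_le k (fun x =>
    a u * a v * (Gamma f u (partial l phi) x * partial j (Gamma f v (coordf l)) x)) x
    (CT * M * h ^+ K).
  move=> /andP[uK uvK]; have [cu ju] := uG u l uK; have [cv jv] := vG v l.
  apply: jet_le_mono (leqnn k) _ (jet_leZ (a u * a v) (class_CM cu cv) (jet_leM cu cv ju jv)).
  rewrite [leRHS](_ : _ = (1 + H) ^+ (N + N) * h ^+ K * (2 ^+ k * (CG * M * CY))); last first.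
    by rewrite /CT; ring.
  apply: ler_wpM2r; first by rewrite mulr_ge0 ?exprn_ge0 // mulr_ge0 // mulr_ge0 // CG_ge0.
  apply: (@le_trans _ _ (h ^+ (size u + size v))).
    by rewrite normrM exprD; apply: ler_pM.
  by apply: expr_le_mono => //; apply: leq_add; exact: size_bseq.
rewrite (_ : CR * M * h ^+ K = \sum_(l < n) 2 ^+ k * (C * M * h ^+ K * (1 + disp_const * H)) +
  \sum_(l < n) word_count * (word_count * (CT * M * h ^+ K))); last first.
  by rewrite !sumr_const !card_ord -[X in _ = X + _]mulr_natl -[X in _ = _ + X]mulr_natl /CR; ring.
apply: jet_leD.
- by apply: class_C_sum => l _; exact: class_CM (Cr l) (Cd l).
- apply: class_C_sum => l _; apply: class_C_sum => u _; apply: class_C_sum => v /andP[uK _].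
  exact: Ct.
- apply: jet_le_sum => l _; first exact: class_CM (Cr l) (Cd l).
  apply: jet_leM (Cr l) (Cd l) _ _.
    apply: CP => // y /HM; exact: jet_le_partial.
  by apply: jet_le_mono kn (lexx _) (jet_le_partial_davie j l x a1 ah hH).
- apply: jet_le_sum => l _.
    by apply: class_C_sum => u _; apply: class_C_sum => v /andP[uK _]; exact: Ct.
  have X1 : 0 <= word_count * (CT * M * h ^+ K) by exact: mulr_ge0.
  apply: jet_le_mono (leqnn k) (sum_word_const xpredT X1) _.
  apply: jet_le_sum => u _; first by apply: class_C_sum => v /andP[uK _]; exact: Ct.
  apply: jet_le_mono (leqnn k) (sum_word_const (fun v : word => size u < K <= size u + size v)%N CTM) _.
  apply: jet_le_sum => v uv; last exact: Jt.
  by case/andP: uv => uK _; exact: Ct.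
Qed.

(** Chen's relation. The words of [star g g'] are grouped by their suffix v, and expanding Gamma_v
    of a coordinate along the first map leaves a remainder of order N + 1 - |v|. *)
Lemma davie_comp (g g' : tensor R d N) x l :
  davie (ext g') (davie (ext g) x) 0 l - davie (ext (star g g')) x 0 l =
  \sum_(v : word) ext g' v * remainder (N.+1 - size v) (ext g) (Gamma f v (coordf l)) x.
Proof.
under [RHS]eq_bigr do rewrite /remainder mulrBr.
rewrite sumrB; congr (_ - _); rewrite mxE /expansion.
  by apply: eq_bigl => w; rewrite ltnS size_bseq.
transitivity (\sum_(w : word) \sum_(u : word) \sum_(v : word)
   g u * g' v * (u ++ v == w :> seq 'I_d)%:R * Gamma f w (coordf l) x).
  rewrite (eq_bigl xpredT) => [|w]; last by rewrite ltnS size_bseq.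
  apply: eq_bigr => w _; rewrite ext_bseq starE mulr_suml; apply: eq_bigr => u _.
  by rewrite mulr_suml.
under [RHS]eq_bigr do rewrite big_mkcond mulr_sumr.
rewrite exchange_big [RHS]exchange_big; apply: eq_bigr => u _.
rewrite exchange_big; apply: eq_bigr => v _ /=; rewrite !ext_bseq.
have [uvN|Nuv] := leqP (size (u ++ v)) N.
  rewrite -[in X in if X then _ else _](ltn_add2r (size v)) subnK; last exact: leqW (size_bseq v).
  rewrite -size_cat ltnS uvN -Gamma_cat mulrA [g' v * _]mulrC.
  rewrite -(@sum_word_eq R d N (fun s => g u * g' v * Gamma f s (coordf l) x) _ uvN).
  by apply: eq_bigr => w _; rewrite mulrAC.
rewrite ltn_subRL addnC -size_cat ltnS leqNgt Nuv mulr0 big1 // => w _.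
case: eqP => E; rewrite ?mulr0 ?mul0r //.
by move: Nuv; rewrite E ltnNge size_bseq.
Qed.

(** The coefficient of v contributes h ^+ |v| and its remainder h ^+ (N + 1 - |v|), so every word
    gives the same total order N + 1. *)
Lemma jet_le_davie_comp : exists2 C, 0 <= C & forall (g g' : tensor R d N) h x l,
  shuffle_char N (ext g) -> decay h (ext g) -> decay h (ext g') -> 0 <= h <= H ->
  jet_le N.+1 (fun x => davie (ext g') (davie (ext g) x) 0 l - davie (ext (star g g')) x 0 l) x
    (C * h ^+ N.+1).
Proof.
have KN (v : word) : (N.+1 - size v <= N.+1)%N by exact: leq_subr.
have [C CP] := choice (fun v : word => let: ex_intro2 C a b :=
  jet_le_remainder (KN v) (leqnn N.+1) in ex_intro _ C (conj a b)).
have W0 : 0 <= word_count by exact: ler0n.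
have CS0 : 0 <= \sum_v C v by apply: sumr_ge0 => v _; case: (CP v).
have CA0 : 0 <= CG * `|A| by rewrite mulr_ge0 // CG_ge0.
exists (word_count * ((\sum_v C v) * (CG * `|A|))); first by rewrite mulr_ge0 // mulr_ge0.
move=> g g' h x l gS gh gh' hH; have [h0 _] := andP hH; have [g1 _] := gS.
have hN : 0 <= h ^+ N.+1 by exact: exprn_ge0.
rewrite (_ : (fun x => _) = fun x => \sum_(v : word)
  ext g' v * remainder (N.+1 - size v) (ext g) (Gamma f v (coordf l)) x); last first.
  by apply/funext => y; exact: davie_comp.
have B0 : 0 <= (\sum_v C v) * (CG * `|A|) * h ^+ N.+1 by rewrite mulr_ge0 // mulr_ge0.
have bnd : \sum_(v : word) (\sum_v C v) * (CG * `|A|) * h ^+ N.+1 <=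
    word_count * ((\sum_v C v) * (CG * `|A|)) * h ^+ N.+1.
  by rewrite -[leRHS]mulrA; exact: sum_word_const.
apply: jet_le_mono (leqnn _) bnd _.
have vm (v : word) : (N.+1 + (N.+1 - size v) + size v <= m.+1)%N.
  rewrite -addnA subnK; last exact: leqW (size_bseq v).
  by rewrite addn1 mul2n -addnn addSn addnS.
have vm' (v : word) : (N.+1 + (N.+1 - size v) <= m.+1)%N.
  by apply: leq_trans (vm v); exact: leq_addr.
have Cr (v : word) : class_C N.+1 (remainder (N.+1 - size v) (ext g) (Gamma f v (coordf l))).
  by apply: class_C_remainder; [|exact: vm'|exact: (class_C_Gamma_coord fC l (vm v))].
apply: jet_le_sum => v _; first by apply: class_CZ; exact: Cr.
(* For the empty word the remainder is exactly 0: the Davie map is by definition the full expansion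
   of the coordinates. *)
have [v0|v0] := posnP (size v).
  rewrite (size0nil v0) subn0 (_ : (fun x => _) = fun=> 0).
    by move=> J _; rewrite partials_cst0 normr0.
  by apply/funext => y; rewrite /remainder /= /coordf mxE subrr mulr0.
apply: jet_le_mono (leqnn _) _ (jet_leZ (ext g' v) (Cr v) ((CP v).2 _ h _ x (CG * `|A|)
  gS gh hH (class_C_Gamma_coord fC l (vm v)) _)); last first.
  by move=> y _; exact: (jet_le_Gamma_coord fC l y v0 (vm v)).
rewrite [leRHS](_ : _ = h ^+ size v * ((\sum_v C v) * (CG * `|A|) * h ^+ (N.+1 - size v))); last first.
  rewrite -{1}(subnK (leqW (size_bseq v) : (size v <= N.+1)%N)) exprD; ring.
apply: ler_pM => //; first by rewrite mulr_ge0 ?exprn_ge0 // mulr_ge0 //; case: (CP v).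
apply: ler_wpM2r; first exact: exprn_ge0.
apply: ler_wpM2r => //; rewrite (bigD1 v) //= lerDl; apply: sumr_ge0 => i _; by case: (CP i).
Qed.

End Davie.

(** * Nonlinear sewing *)

Lemma small_powR (R : realType) (C p e : R) : 0 <= C -> 0 < p -> 0 < e ->
  exists2 r, 0 < r & forall x, 0 <= x <= r -> C * x `^ p <= e.
Proof.
move=> C0 p0 e0; have C1 : 0 < C + 1 by rewrite ltr_wpDl.
exists ((e / (C + 1)) `^ p^-1); first by rewrite powR_gt0 // divr_gt0.
move=> x /andP[x0 xr]; apply: (@le_trans _ _ (C * (e / (C + 1)))).
  apply: ler_wpM2l => //.
  have -> : e / (C + 1) = ((e / (C + 1)) `^ p^-1) `^ p.
    by rewrite -powRrM mulVf ?gt_eqF // powRr1 // divr_ge0 ?ltW.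
  by apply: ge0_ler_powR; rewrite ?nnegrE ?powR_ge0 ?(ltW p0).
rewrite mulrCA -[leRHS]mulr1; apply: ler_wpM2l; first exact: ltW.
by rewrite ler_pdivrMr // mul1r lerDl.
Qed.

Lemma half_powR_lt (R : realType) (p : R) : 1 < p -> 2 * (2^-1 : R) `^ p < 1.
Proof.
move=> p1; have p0 : 0 < p by exact: lt_trans p1.
have h0 : 0 <= 2^-1 :> R by [].
rewrite -(mulr_powRB1 h0 p0) mulrA divff // mul1r lt_neqAle powR_eq1.
apply/andP; split.
  rewrite subr_eq0 (gt_eqF p1) orbF negb_or -leNgt h0 andbT.
  by rewrite lt_eqF // invf_lt1 // ltr1n.
rewrite -[leRHS](powRr0 (2^-1)); apply: ger_powR; last by rewrite subr_ge0 ltW.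
by rewrite invr_gt0 ltr0n /= invf_le1 // ler1n.
Qed.

Lemma le_geometric_eq0 (R : realType) (x C q : R) : 0 <= x -> 0 <= q < 1 ->
  (forall k, x <= C * q ^+ k) -> x = 0.
Proof.
move=> x0 /andP[q0 q1] H; apply/eqP; rewrite eq_le x0 andbT.
have : C * q ^+ k @[k --> \oo] --> C * 0.
  apply: cvgM; first exact: cvg_cst.
  by apply: cvg_expr; rewrite ger0_norm.
rewrite mulr0 => /cvg_seq_epsP c; apply/ler_addgt0Pr => e /c[k /(_ k (leqnn k))].
have := H k; rewrite ler_norml; lra.
Qed.

(** * Time partitions and their gap sums *)

Section Splitting.
Variable A : eqType.
Implicit Types (p q : seq A).

Lemma has_split (P : pred A) p : has P p -> exists p1 a p2,
  [/\ p = p1 ++ a :: p2, P a & all (fun b => ~~ P b) p1].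
Proof.
elim: p => //= b p IH; have [Pb _|nPb /= /IH[p1 [a [p2 [-> Pa Pp1]]]]] := boolP (P b).
  by exists [::], b, p.
by exists (b :: p1), a, p2; split=> //=; rewrite nPb.
Qed.

Lemma subseq_split a q p : subseq (a :: q) p -> exists p1 p2,
  p = p1 ++ a :: p2 /\ subseq q p2.
Proof.
elim: p => //= b p IH; case: eqVneq => [->|_] H; first by exists [::], p.
by have [p1 [p2 [-> qp2]]] := IH H; exists (b :: p1), p2.
Qed.

End Splitting.

Section Times.
Variable R : realType.
Implicit Types (s t : R) (p q : seq R).

Lemma path_le_last s p : path <=%R s p -> s <= last s p.
Proof.
elim: p s => //= a p IH s /andP[sa pa]; exact: le_trans sa (IH _ pa).
Qed.

Lemma path_ge s p a : path <=%R s p -> a \in p -> s <= a <= last s p.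
Proof.
elim: p s => //= b p IH s /andP[sb pb]; rewrite inE => /orP[/eqP ->|/IH].
  by rewrite sb path_le_last.
by move=> /(_ _ pb)/andP[ba ->]; rewrite (le_trans sb ba).
Qed.

Lemma path_split s p1 a p2 : path <=%R s (p1 ++ a :: p2) ->
  [/\ path <=%R s p1, last s p1 <= a & path <=%R a p2].
Proof. by rewrite cat_path /= => /and3P[]. Qed.

(** As for [path], the starting time s is kept apart and the list ends with t, so that partitions
    concatenate without repeating the junction. *)
Fixpoint dyadic m s t : seq R :=
  if m is m'.+1 then dyadic m' s ((s + t) / 2) ++ dyadic m' ((s + t) / 2) t else [:: t].

Lemma last_dyadic m s t : last s (dyadic m s t) = t.
Proof. by elim: m s t => [|m IH] s t //=; rewrite last_cat !IH. Qed.

Lemma midpoint_le s t : s <= t -> s <= (s + t) / 2 <= t.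
Proof. move=> st; apply/andP; split; lra. Qed.

Lemma path_dyadic m s t : s <= t -> path <=%R s (dyadic m s t).
Proof.
elim: m s t => [|m IH] s t st /=; first by rewrite st.
have /andP[sr rt] := midpoint_le st.
by rewrite cat_path last_dyadic !IH.
Qed.

Lemma last_sorted s t q : path <=%R s q -> (forall a, a \in q -> a <= t) ->
  t \in s :: q -> last s q = t.
Proof.
move=> pq qt tq; apply/eqP; rewrite eq_le.
have st : s <= t.
  by move: tq; rewrite inE => /orP[/eqP ->//|/(path_ge pq)/andP[]].
apply/andP; split.
  by have := mem_last s q; rewrite inE => /orP[/eqP ->|/qt].
by move: tq; rewrite inE => /orP[/eqP ->|/(path_ge pq)/andP[]] //; rewrite path_le_last.
Qed.

Variable theta : R.
Hypothesis theta1 : 1 < theta.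

(** The total sewing error of a partition. As theta > 1 it tends to 0 along dyadic partitions, each
    bisection multiplying it by the ratio [halving_ratio] = 2^(1 - theta). *)
Fixpoint gap_sum s p : R := if p is a :: p' then (a - s) `^ theta + gap_sum a p' else 0.

Lemma gap_sum_ge0 s p : 0 <= gap_sum s p.
Proof. by elim: p s => //= a p IH s; rewrite addr_ge0 ?powR_ge0. Qed.

Lemma gap_sum_cat s p q : gap_sum s (p ++ q) = gap_sum s p + gap_sum (last s p) q.
Proof. by elim: p s => [|a p IH] s /=; rewrite ?add0r // IH addrA. Qed.

Definition halving_ratio : R := 2 * (2^-1) `^ theta.

Lemma halving_ratio01 : 0 <= halving_ratio < 1.
Proof. by rewrite /halving_ratio half_powR_lt // mulr_ge0 // powR_ge0. Qed.

Lemma half_powR x : 0 <= x -> 2 * (x / 2) `^ theta = halving_ratio * x `^ theta.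
Proof. by move=> x0; rewrite powRM // /halving_ratio mulrA [_ * x `^ _]mulrC; ring. Qed.

Lemma gap_sum_dyadic m s t : s <= t ->
  gap_sum s (dyadic m s t) = halving_ratio ^+ m * (t - s) `^ theta.
Proof.
elim: m s t => [|m IH] s t st /=; first by rewrite expr0 mul1r addr0.
have /andP[sr rt] := midpoint_le st.
rewrite gap_sum_cat last_dyadic !IH //.
have -> : t - (s + t) / 2 = (t - s) / 2 by lra.
have -> : (s + t) / 2 - s = (t - s) / 2 by lra.
rewrite -mulrDr -mulr2n -[_ *+ 2]mulr_natl half_powR ?subr_ge0 // exprSr mulrA //.
Qed.

Lemma ler_theta x y : 0 <= x -> x <= y -> x `^ theta <= y `^ theta.
Proof.
move=> x0 xy; apply: ge0_ler_powR; rewrite ?nnegrE ?(le_trans x0 xy) //.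
by apply: ltW; exact: lt_trans theta1.
Qed.

End Times.

(** * From an almost flow to a flow *)

Section Sewing.
Variables (R : realType) (n k : nat) (T gamma theta C1 C2 : R).
Local Notation V := 'rV[R]_n.
Variable mu : R -> R -> V -> V.
Hypotheses (k0 : (0 < k)%N) (gamma0 : 0 < gamma) (theta1 : 1 < theta).
Hypotheses (T0 : 0 < T) (C1_ge0 : 0 <= C1) (C2_ge0 : 0 <= C2).
Hypothesis mu_class : forall s t, 0 <= s -> s <= t -> t <= T -> class_C_map k.+1 (mu s t).
Hypothesis mu_disp : forall s t l x, 0 <= s -> s <= t -> t <= T ->
  jet_le k.+1 (disp (mu s t) l) x (C1 * (t - s) `^ gamma).
Hypothesis mu_comp : forall s r t l x, 0 <= s -> s <= r -> r <= t -> t <= T ->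
  jet_le k (fun y => mu r t (mu s r y) 0 l - mu s t y 0 l) x (C2 * (t - s) `^ theta).
Implicit Types (s t r e : R) (p q : seq R) (x y : V) (F G : V -> V).

Definition map_near F G e := forall l x, jet_le k (fun y => F y 0 l - G y 0 l) x e.

Lemma map_near_norm F G e x : 0 <= e -> map_near F G e -> `|F x - G x| <= e.
Proof.
move=> e0 H; apply: row_norm_le => // l; rewrite !mxE.
exact: (H l x [::]).
Qed.

Lemma map_near_mono F G e e' : e <= e' -> map_near F G e -> map_near F G e'.
Proof. by move=> ee H l x; apply: jet_le_mono (leqnn _) ee (H l x). Qed.

Lemma class_C_mu s t : 0 <= s -> s <= t -> t <= T -> class_C_map k (mu s t).
Proof. by move=> s0 st tT l; apply: class_C_le (mu_class s0 st tT l). Qed.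

Lemma jet_le_mu s t l x : 0 <= s -> s <= t -> t <= T ->
  jet_le k (disp (mu s t) l) x (C1 * (t - s) `^ gamma).
Proof. by move=> s0 st tT; apply: jet_le_mono (mu_disp l x s0 st tT). Qed.

Lemma mu_id s x : 0 <= s -> s <= T -> mu s s x = x.
Proof.
move=> s0 sT; apply/rowP => l.
have := jet_le_mu l x s0 (lexx s) sT (isT : (size (@nil 'I_n) <= k)%N).
rewrite subrr powR0 ?gt_eqF // mulr0 normr_le0 /disp /= subr_eq0 => /eqP //.
Qed.

Lemma ler_gamma r s : 0 <= r -> r <= s -> r `^ gamma <= s `^ gamma.
Proof.
move=> r0 rs; apply: ge0_ler_powR; rewrite ?nnegrE ?(le_trans r0 rs) //.
exact: ltW.
Qed.

Lemma jet_le_disp_near F s t e l x : class_C_map k F -> 0 <= s -> s <= t -> t <= T ->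
  map_near F (mu s t) e -> jet_le k (disp F l) x (C1 * (t - s) `^ gamma + e).
Proof.
move=> CF s0 st tT H; rewrite addrC.
rewrite (_ : disp F l = fun y => (F y 0 l - mu s t y 0 l) + disp (mu s t) l y); last first.
  by apply/funext => y; rewrite /disp; ring.
have Cm := class_C_mu s0 st tT.
apply: jet_leD; [exact: class_CB (CF l) (Cm l)|exact: class_C_disp|exact: H|exact: jet_le_mu].
Qed.

(** The difference is split into (G - mu_bc) o F, mu_bc o F - mu_bc o mu_ab, and mu_bc o mu_ab -
    mu_ac. In the middle term the identity part of mu_bc passes e1 on unchanged and only its
    displacement, of class C^(k+1), adds a multiple of eta. Hence errors are amplified by 1 + O(eta)
    only. *)
Lemma map_near_comp : exists2 C3, 0 <= C3 & forall a b c F G e1 e2,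
  0 <= a -> a <= b -> b <= c -> c <= T -> class_C_map k F -> class_C_map k G ->
  0 <= e1 -> 0 <= e2 ->
  map_near F (mu a b) e1 -> map_near G (mu b c) e2 -> C1 * (c - a) `^ gamma + e1 <= 1 ->
  map_near (fun x => G (F x)) (mu a c)
    ((1 + C3 * (C1 * (c - a) `^ gamma + e1)) * (e1 + e2) + C2 * (c - a) `^ theta).
Proof.
have [C C0 CP] := jet_close_comp n k (@ler01 R); have [C' C'0 CP'] := jet_le_comp n k (@ler01 R).
exists (C' + ((1 + C) * n%:R + C)); first by rewrite !addr_ge0 // mulr_ge0 // addr_ge0.
move=> a b c F G e1 e2 a0 ab bc cT CF CG e10 e20 HF HG.
set eta := _ + e1 => eta1 l x; have ac := le_trans ab bc; have b0 := le_trans a0 ab.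
have bT := le_trans bc cT.
have eta0 : 0 <= eta by rewrite addr_ge0 // mulr_ge0 // powR_ge0.
have Ceta r : 0 <= r -> r <= c - a -> C1 * r `^ gamma <= eta - e1.
  by move=> r0 rc; rewrite /eta addrK; apply: ler_wpM2l => //; exact: ler_gamma.
have Cab := class_C_mu a0 ab bT; have Cbc := class_C_mu b0 bc cT.
have dF i y : jet_le k (disp F i) y eta.
  apply: jet_le_mono (leqnn k) _ (jet_le_disp_near i y CF a0 ab bT HF).
  by rewrite -lerBrDr Ceta // ?subr_ge0 // lerB.
have dab i y : jet_le k (disp (mu a b) i) y eta.
  apply: jet_le_mono (leqnn k) _ (jet_le_mu i y a0 ab bT).
  by apply: (le_trans (Ceta _ _ _)); rewrite ?subr_ge0 // ?lerB // gerBl.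
have dbc i y : jet_le k.+1 (disp (mu b c) i) y eta.
  apply: jet_le_mono (leqnn k.+1) _ (mu_disp i y b0 bc cT).
  by apply: (le_trans (Ceta _ _ _)); rewrite ?subr_ge0 // ?lerB // gerBl.
have J1 : jet_le k (fun y => G (F y) 0 l - mu b c (F y) 0 l) x ((1 + C' * eta) * e2).
  apply: (CP' (fun z => G z 0 l - mu b c z 0 l) F x e2 eta) => //.
  - exact: class_CB (CG l) (Cbc l).
  - by rewrite eta0.
have J2 : jet_close k (fun y => disp (mu b c) l (F y)) x (fun y => disp (mu b c) l (mu a b y)) x
    ((1 + C * eta) * (n%:R * eta * e1) + C * eta * e1).
  have Cd : class_C k.+1 (disp (mu b c) l) by apply: class_C_disp; exact: mu_class.
  have Cd' : class_C k (disp (mu b c) l) by exact: class_C_disp.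
  apply: (CP _ _ _ _ _ _ _ _ _ _ Cd' Cd' CF Cab eta1) => //.
  - apply: jet_close_mono (leqnn k) _ (jet_close_mean Cd _); last by move=> r _; exact: dbc.
    apply: ler_wpM2l; first by rewrite mulr_ge0.
    exact: map_near_norm.
  - by apply: jet_le_mono (dbc l _).
  - move=> i; apply/jet_le_sub; [exact: class_C_disp|exact: class_C_disp|].
    rewrite (_ : (fun y => _) = fun y => F y 0 i - mu a b y 0 i); first exact: HF.
    by apply/funext => y; rewrite /disp; ring.
have Cd : class_C k (disp (mu b c) l) by exact: class_C_disp.
move/(jet_le_sub x _ (class_C_comp Cd CF) (class_C_comp Cd Cab)) in J2.
have J3 := mu_comp l x a0 ab bc cT.
have c1 := class_CB (class_C_comp (CG l) CF) (class_C_comp (Cbc l) CF).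
have c2 := class_CB (class_C_comp Cd CF) (class_C_comp Cd Cab).
have c3 := class_CB (CF l) (Cab l).
have c4 := class_CB (class_C_comp (Cbc l) Cab) (class_C_mu a0 ac cT l).
rewrite (_ : (fun y => _) = fun y => ((G (F y) 0 l - mu b c (F y) 0 l) +
    (disp (mu b c) l (F y) - disp (mu b c) l (mu a b y))) +
    ((F y 0 l - mu a b y 0 l) + (mu b c (mu a b y) 0 l - mu a c y 0 l))); last first.
  by apply/funext => y; rewrite /disp; ring.
have J := jet_leD (class_CD c1 c2) (class_CD c3 c4) (jet_leD c1 c2 J1 J2) (jet_leD c3 c4 (HF l x) J3).
apply: jet_le_mono (leqnn k) _ J; rewrite -subr_ge0.
rewrite (_ : _ - _ = eta * (C' * e1 + ((1 + C) * n%:R + C) * e2 + C * n%:R * e1 * (1 - eta)));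
  last by ring.
rewrite mulr_ge0 // addr_ge0 ?mulr_ge0 ?subr_ge0 // addr_ge0 ?mulr_ge0 //.
by rewrite addr_ge0 // mulr_ge0 // addr_ge0.
Qed.

Fixpoint chain s p : V -> V := if p is a :: p' then fun x => chain a p' (mu s a x) else id.

Lemma chain_cat s p q x : chain s (p ++ q) x = chain (last s p) q (chain s p x).
Proof. by elim: p s x => //= a p IH s x; rewrite IH. Qed.

Lemma class_C_chain s p : 0 <= s -> path <=%R s p -> last s p <= T -> class_C_map k (chain s p).
Proof.
elim: p s => [|a p IH] s s0 /=; first by move=> _ _ l; exact: class_C_coord.
move=> /andP[sa pa] lT; have aT := le_trans (path_le_last pa) lT.
apply: class_C_map_comp; first exact: IH (le_trans s0 sa) pa lT.
exact: class_C_mu.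
Qed.

(** Strong induction on the number of points. The partition is cut around its middle into two parts
    of length at most half and one step between them. The two halves together contribute kap L (t -
    s)^theta with kap = 2^(1 - theta) < 1, which leaves room for the amplification factors and for
    the defect C2, uniformly in the number of points. *)
Lemma map_near_chain_short : exists2 L, 0 <= L & exists2 delta, 0 < delta & forall p s,
  0 <= s -> path <=%R s p -> last s p <= T -> last s p - s <= delta ->
  map_near (chain s p) (mu s (last s p)) (L * (last s p - s) `^ theta).
Proof.
have [C3 C30 CP] := map_near_comp.
have [kap0 kap1] := andP (halving_ratio01 theta1); set kap := halving_ratio theta in kap0 kap1.
(* For eta <= 1, (1 + C3 eta)^2 <= 1 + eta D. The choice of [eta] then keeps (1 + C3 eta)^2 kap
   below (1 + kap) / 2 < 1 ([fac]). *)
pose D := 1 + 2 * C3 + C3 ^+ 2.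
have D0 : 0 < D by rewrite /D -addrA ltr_pwDl // addr_ge0 ?exprn_ge0 // mulr_ge0.
pose eta := Num.min 1 ((1 - kap) / (2 * D)).
have eta0 : 0 < eta.
  by rewrite lt_min ltr01 divr_gt0 ?subr_gt0 // mulr_gt0.
have eta1 : eta <= 1 by rewrite ge_min lexx.
have etaD : eta * D <= (1 - kap) / 2.
  have : eta <= (1 - kap) / (2 * D) by rewrite ge_min lexx orbT.
  by rewrite ler_pdivlMr ?mulr_gt0 // => ?; lra.
have fac : (1 + C3 * eta) ^+ 2 * kap <= (1 + kap) / 2.
  have e2 : eta ^+ 2 <= eta by rewrite expr2 ler_piMl // ltW.
  have : (1 + C3 * eta) ^+ 2 <= 1 + eta * D.
    rewrite -subr_ge0 /D (_ : _ - _ = eta + C3 ^+ 2 * (eta - eta ^+ 2)); last by ring.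
    by rewrite addr_ge0 ?(ltW eta0) // mulr_ge0 ?exprn_ge0 // subr_ge0.
  move=> le1; have : (1 + C3 * eta) ^+ 2 * kap <= (1 + eta * D) * kap by exact: ler_wpM2r.
  have : eta * D * kap <= (1 - kap) / 2 * 1.
    by apply: ler_pM => //; rewrite ?mulr_ge0 ?(ltW eta0) ?(ltW D0) // ltW.
  by rewrite mulrDl; lra.
(* The solution of the fixed-point equation [LE], in which (2 + C3) C2 bounds the defects added by
   the two junctions. *)
pose L := 2 * (2 + C3) * C2 / (1 - kap).
have L0 : 0 <= L.
  by apply: divr_ge0; [rewrite !mulr_ge0 // addr_ge0|rewrite subr_ge0 ltW].
have LE : (1 + kap) / 2 * L + (2 + C3) * C2 = L.
  by rewrite /L; field; rewrite subr_eq0 gt_eqF.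
have [d1 d10 d1P] := small_powR C1_ge0 gamma0 (divr_gt0 eta0 (@ltr0n R 2)).
pose CL := (1 + C3) * L + C2.
have CL0 : 0 <= CL by rewrite addr_ge0 // mulr_ge0 // addr_ge0.
have theta0 : 0 < theta by exact: lt_trans theta1.
have [d2 d20 d2P] := small_powR CL0 theta0 (divr_gt0 eta0 (@ltr0n R 2)).
exists L => //; exists (Num.min d1 d2); first by rewrite lt_min d10.
move=> p; have [N] := ubnP (size p); elim: N p => // N IH p pN s s0 pp lT lS.
case: p pN pp lT lS => [|b p] pN pp lT lS.
  move=> l x /=; rewrite subrr powR0 ?gt_eqF // mulr0.
  rewrite (_ : (fun y => _) = fun=> 0); first by move=> J _; rewrite partials_cst0 normr0.
  by apply/funext => y; rewrite mu_id ?subrr.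
set q := b :: p in pN pp lT lS *; set t := last s q in lT lS *.
have st : s <= t by exact: path_le_last.
have : has (fun a => (t - s) / 2 <= a - s) q.
  apply/hasP; exists t; first by rewrite /t /q /= mem_last.
  by rewrite ler_pdivrMr // ler_peMr // ?subr_ge0 // ler1n.
(* Here a is the first time at or beyond the midpoint and c, the last time before a, is still in the
   first half. Both [s, c] and [a, t] have length at most (t - s) / 2, whatever the length of the
   step from c to a. *)
move=> /has_split[p1 [a [p2 [qE sa p1a]]]].
have [pp1 l1a pp2] : [/\ path <=%R s p1, last s p1 <= a & path <=%R a p2].
  by apply: path_split; rewrite -qE.
have l2 : last a p2 = t by rewrite /t qE last_cat.
have at_ : a <= t by rewrite -l2; exact: path_le_last.
set c := last s p1 in l1a; have sc : s <= c by exact: path_le_last.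
have cs : c - s <= (t - s) / 2.
  rewrite /c; case: (lastP p1) p1a => [_|p1' z]; first by rewrite subrr divr_ge0 // subr_ge0.
  by rewrite last_rcons all_rcons => /andP[+ _]; rewrite -ltNge => /ltW.
have sizes : (size p1 < N)%N /\ (size p2 < N)%N.
  by move: pN; rewrite qE size_cat /= addnS ltnS => h; split; apply: leq_trans h;
    rewrite ltnS ?leq_addr ?leq_addl.
have ts0 : 0 <= t - s by rewrite subr_ge0.
have a0 : 0 <= a by rewrite (le_trans s0) // (le_trans sc).
have aT : a <= T by exact: le_trans lT.
have c0 : 0 <= c by exact: le_trans sc.
have cT : c <= T by exact: le_trans aT.
pose X := (t - s) `^ theta; have X0 : 0 <= X by exact: powR_ge0.
have [tsd1 tsd2] : t - s <= d1 /\ t - s <= d2.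
  by move: lS; rewrite le_min => /andP[].
have half : L * ((t - s) / 2) `^ theta = L * kap / 2 * X.
  by have := half_powR theta ts0; rewrite -/kap -/X => E; rewrite (_ : _ `^ theta = kap * X / 2); lra.
have H1 : map_near (chain s p1) (mu s c) (L * kap / 2 * X).
  apply: (@map_near_mono _ _ (L * (c - s) `^ theta)).
    by rewrite -half; apply: ler_wpM2l => //; apply: ler_theta => //; rewrite subr_ge0.
  apply: IH => //; first by case: sizes.
  by apply: le_trans lS; rewrite lerB // (le_trans l1a).
have H2 : map_near (chain a p2) (mu a t) (L * kap / 2 * X).
  apply: (@map_near_mono _ _ (L * (t - a) `^ theta)).
    rewrite -half; apply: ler_wpM2l => //; apply: ler_theta => //; first by rewrite subr_ge0.
    lra.
  rewrite -l2; apply: IH => //; rewrite ?l2 //; first by case: sizes.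
  by apply: le_trans lS; rewrite lerB // (le_trans sc).
have Cp1 : class_C_map k (chain s p1) by exact: class_C_chain.
have Cp2 : class_C_map k (chain a p2) by apply: class_C_chain => //; rewrite l2.
pose e1 := L * kap / 2 * X; have e10 : 0 <= e1 by rewrite mulr_ge0 // divr_ge0 // mulr_ge0.
have kX : e1 <= L * X.
  rewrite /e1; apply: ler_wpM2r => //; rewrite -mulrA ler_piMr //; lra.
have ca : (a - s) `^ gamma <= (t - s) `^ gamma by apply: ler_gamma; rewrite ?subr_ge0 ?lerB // (le_trans sc).
have cth : (a - s) `^ theta <= X by apply: ler_theta; rewrite ?subr_ge0 ?lerB // (le_trans sc).
have g2 : C1 * (t - s) `^ gamma <= eta / 2 by apply: d1P; rewrite ts0.
have th2 : CL * X <= eta / 2 by apply: d2P; rewrite ts0.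
have C1a : C1 * (a - s) `^ gamma <= C1 * (t - s) `^ gamma by exact: ler_wpM2l.
have CLX : (1 + C3) * (L * X) + C2 * X = CL * X by rewrite /CL; ring.
have C3LX : 0 <= C3 * (L * X) by rewrite mulr_ge0 // mulr_ge0.
have C2X : 0 <= C2 * X by exact: mulr_ge0.
have e1s : C1 * (a - s) `^ gamma + e1 <= eta by lra.
(* The first half is joined to the middle step, which has error 0; [H4] then joins the result to the
   second half. *)
have H3 : map_near (fun x => mu c a (chain s p1 x)) (mu s a) ((1 + C3 * eta) * e1 + C2 * X).
  have muca : map_near (mu c a) (mu c a) 0.
    move=> l x; rewrite (_ : (fun y => _) = fun=> 0).
      by move=> J _; rewrite partials_cst0 normr0.
    by apply/funext => y; rewrite subrr.
  apply: map_near_mono (CP _ _ _ _ _ _ _ s0 sc l1a aT Cp1 (class_C_mu c0 l1a aT) e10 (lexx 0) H1 muca _).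
    rewrite addr0; apply: lerD; last exact: ler_wpM2l.
    by apply: ler_wpM2r => //; rewrite lerD2l; apply: ler_wpM2l.
  exact: le_trans e1s eta1.
pose e2 := (1 + C3 * eta) * e1 + C2 * X.
have C3e : 0 <= C3 * eta by rewrite mulr_ge0 // ltW.
have e20 : 0 <= e2 by rewrite addr_ge0 // mulr_ge0 // addr_ge0.
have e2s : C1 * (t - s) `^ gamma + e2 <= eta.
  have : C3 * eta * e1 <= C3 * (L * X).
    rewrite -mulrA; apply: ler_wpM2l => //; apply: le_trans kX.
    by rewrite ler_piMl.
  by rewrite /e2 mulrDl mul1r; lra.
have sa_ : s <= a by exact: le_trans sc l1a.
have Cmid : class_C_map k (fun x => mu c a (chain s p1 x)).
  exact: (class_C_map_comp (class_C_mu c0 l1a aT) Cp1).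
have H4 := CP _ _ _ _ _ _ _ s0 sa_ at_ lT Cmid Cp2 e20 e10 H3 H2 (le_trans e2s eta1).
rewrite (_ : chain s q = fun x => chain a p2 (mu c a (chain s p1 x))); last first.
  by apply/funext => x; rewrite qE chain_cat.
apply: map_near_mono H4; rewrite -/X.
apply: (@le_trans _ _ ((1 + C3 * eta) * (e2 + e1) + C2 * X)).
  by rewrite lerD2r; apply: ler_wpM2r; [exact: addr_ge0|rewrite lerD2l; exact: ler_wpM2l].
have LEX : L * X = (1 + kap) / 2 * (L * X) + (2 + C3) * (C2 * X) by rewrite -{1}LE; ring.
rewrite /e2 -subr_ge0 LEX (_ : _ - _ = ((1 + kap) / 2 - (1 + C3 * eta) ^+ 2 * kap) * (L * X) +
  C3 * (1 - eta) * (C2 * X) + (1 + C3 * eta) * (C3 * eta) * e1); last by rewrite /e1; field.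
have Q1 : 0 <= ((1 + kap) / 2 - (1 + C3 * eta) ^+ 2 * kap) * (L * X).
  by apply: mulr_ge0; [rewrite subr_ge0|exact: mulr_ge0].
have Q2 : 0 <= C3 * (1 - eta) * (C2 * X).
  by apply: mulr_ge0 => //; apply: mulr_ge0 => //; rewrite subr_ge0.
have Q3 : 0 <= (1 + C3 * eta) * (C3 * eta) * e1.
  by apply: mulr_ge0 => //; apply: mulr_ge0 => //; exact: addr_ge0.
exact: addr_ge0 (addr_ge0 Q1 Q2) Q3.
Qed.

(* Long chains are cut into pieces of length at most delta. *)
Lemma jet_le_disp_chain : exists2 B, 0 <= B & forall p s l x,
  0 <= s -> path <=%R s p -> last s p <= T -> jet_le k (disp (chain s p) l) x B.
Proof.
have [L L0 [delta d0 DP]] := map_near_chain_short.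
pose B0 := C1 * T `^ gamma + L * T `^ theta.
have B00 : 0 <= B0 by rewrite addr_ge0 // mulr_ge0 // powR_ge0.
have theta0 : 0 < theta by exact: lt_trans theta1.
have Pow s t : 0 <= s -> s <= t -> t <= T ->
    (t - s) `^ gamma <= T `^ gamma /\ (t - s) `^ theta <= T `^ theta.
  move=> s0 st tT; have tsT : t - s <= T by apply: le_trans tT; rewrite gerBl.
  by split; [apply: ler_gamma|apply: ler_theta]; rewrite ?subr_ge0.
have short p s l x : 0 <= s -> path <=%R s p -> last s p <= T -> last s p - s <= delta ->
    jet_le k (disp (chain s p) l) x B0.
  move=> s0 pp lT lS; have sl := path_le_last pp; have [P1 P2] := Pow _ _ s0 sl lT.
  apply: jet_le_mono (leqnn k) _ (jet_le_disp_near l x (class_C_chain s0 pp lT) s0 sl lT (DP p s s0 pp lT lS)).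
  by apply: lerD; exact: ler_wpM2l.
have mu0 s t l x : 0 <= s -> s <= t -> t <= T -> jet_le k (disp (mu s t) l) x B0.
  move=> s0 st tT; have [P1 _] := Pow _ _ s0 st tT.
  apply: jet_le_mono (leqnn k) _ (jet_le_mu l x s0 st tT).
  by rewrite -[leLHS]addr0 lerD ?ler_wpM2l // mulr_ge0 // powR_ge0.
have comp2 Bf Bg : 0 <= Bf -> 0 <= Bg -> exists2 B, 0 <= B & forall F G l,
    class_C_map k F -> class_C_map k G -> (forall l x, jet_le k (disp F l) x Bf) ->
    (forall l x, jet_le k (disp G l) x Bg) ->
    forall x, jet_le k (disp (fun y => G (F y)) l) x B.
  move=> f0 g0; have [C C0 CP] := jet_le_comp n k f0.
  exists ((1 + C * Bf) * Bg + Bf); first by rewrite addr_ge0 // mulr_ge0 // addr_ge0 // mulr_ge0.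
  move=> F G l CF CG HF HG x.
  rewrite (_ : disp _ l = fun y => disp G l (F y) + disp F l y); last first.
    by apply/funext => y; rewrite /disp; ring.
  have Cg := class_C_disp l CG; have Cf := class_C_disp l CF.
  apply: jet_leD; [exact: class_C_comp Cg CF|exact: Cf| |exact: HF].
  by apply: (CP (disp G l) F x Bg Bf Cg CF) => //; rewrite f0 lexx.
suff H : forall M : nat, exists2 B, 0 <= B & forall p s l x, 0 <= s -> path <=%R s p ->
    last s p <= T -> last s p - s <= M%:R * delta -> jet_le k (disp (chain s p) l) x B.
  pose M := (Num.truncn (T / delta)).+1.
  have [B B0' BP] := H M; exists B => // p s l x s0 pp lT; apply: BP => //.
  apply: (@le_trans _ _ T); first by apply: le_trans lT; rewrite gerBl.
  rewrite -ler_pdivrMr //; apply: ltW.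
  by have /andP[_] := truncn_itv (divr_ge0 (ltW T0) (ltW d0)).
elim=> [|M [B Bge0 BP]].
  exists B0 => // p s l x s0 pp lT; rewrite mul0r => lS; apply: short => //.
  exact: le_trans lS (ltW d0).
have [B1 B10 B1P] := comp2 _ _ B00 B00; have [B2 B20 B2P] := comp2 _ _ B10 Bge0.
exists (B0 + B2); first exact: addr_ge0.
move=> p s l x s0 pp lT lS.
have [hs|nhs] := boolP (has (fun a => delta <= a - s) p); last first.
  apply: (@jet_le_mono _ _ k k _ _ B0); rewrite ?lerDl //; apply: short => //.
  move/hasPn: nhs => H; case: p {pp lT lS} H => [|b p] H; first by rewrite /= subrr ltW.
  by rewrite leNgt; apply/negP => /ltW; apply/negP; exact: (H _ (mem_last b p)).
(* The times of p1 stay within delta of s, so p1 is covered by the short case; a is at distance at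
   least delta, so the rest p2 is shorter by delta and falls under the induction on M. *)
have [p1 [a [p2 [qE sa p1a]]]] := has_split hs.
have [pp1 l1a pp2] : [/\ path <=%R s p1, last s p1 <= a & path <=%R a p2].
  by apply: path_split; rewrite -qE.
have l2 : last a p2 = last s p by rewrite qE last_cat.
have at_ : a <= last s p by rewrite -l2; exact: path_le_last.
have sc : s <= last s p1 by exact: path_le_last.
have cs : last s p1 - s <= delta.
  case: (lastP p1) p1a => [_|p1' z]; first by rewrite subrr ltW.
  by rewrite last_rcons all_rcons => /andP[+ _]; rewrite -ltNge => /ltW.
have c0 : 0 <= last s p1 by exact: le_trans sc.
have a0 : 0 <= a by exact: le_trans l1a.
have aT : a <= T by exact: le_trans lT.
have cT : last s p1 <= T by exact: le_trans aT.
have Cp1 := class_C_chain s0 pp1 cT.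
have Cp2 : class_C_map k (chain a p2) by apply: class_C_chain; rewrite // l2.
have Cmu := class_C_mu c0 l1a aT.
have J1 : forall l x, jet_le k (disp (fun y => mu (last s p1) a (chain s p1 y)) l) x B1.
  move=> l' x'; apply: (B1P (chain s p1) _ l' Cp1 Cmu) => l'' x''; first exact: short.
  exact: mu0.
rewrite (_ : chain s p = fun y => chain a p2 (mu (last s p1) a (chain s p1 y))); last first.
  by apply/funext => y; rewrite qE chain_cat.
apply: (@jet_le_mono _ _ k k _ _ B2); rewrite ?lerDr //.
apply: (B2P _ _ l (class_C_map_comp Cmu Cp1) Cp2 J1) => l' x'.
apply: BP => //; rewrite l2 //.
by move: lS; rewrite -natr1 mulrDl mul1r; lra.
Qed.

(** Beyond length delta the bound is cheap: both displacements are bounded by a constant, and (t -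
    s)^theta >= delta^theta. *)
Lemma map_near_chain : exists2 L, 0 <= L & forall p s,
  0 <= s -> path <=%R s p -> last s p <= T ->
  map_near (chain s p) (mu s (last s p)) (L * (last s p - s) `^ theta).
Proof.
have [L L0 [delta d0 DP]] := map_near_chain_short; have [B B0 BP] := jet_le_disp_chain.
have theta0 : 0 < theta by exact: lt_trans theta1.
pose B1 := B + C1 * T `^ gamma.
have B10 : 0 <= B1 by rewrite addr_ge0 // mulr_ge0 // powR_ge0.
have dth : 0 < delta `^ theta by exact: powR_gt0.
exists (L + B1 / delta `^ theta); first by rewrite addr_ge0 // divr_ge0 // ltW.
move=> p s s0 pp lT; have sl := path_le_last pp.
have [lS|lS] := leP (last s p - s) delta.
  apply: map_near_mono (DP p s s0 pp lT lS).
  by apply: ler_wpM2r; [exact: powR_ge0|rewrite lerDl divr_ge0 // ltW].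
apply: (@map_near_mono _ _ B1).
  apply: (@le_trans _ _ (B1 / delta `^ theta * (last s p - s) `^ theta)); last first.
    by apply: ler_wpM2r; [exact: powR_ge0|rewrite lerDr].
  rewrite mulrAC ler_pdivlMr //; apply: ler_wpM2l => //.
  by apply: ler_theta => //; exact: ltW.
move=> l x; have Cc := class_C_chain s0 pp lT; have Cm := class_C_mu s0 sl lT.
rewrite (_ : (fun y => _) = fun y => disp (chain s p) l y + (-1) * disp (mu s (last s p)) l y).
  apply: jet_leD; [exact: class_C_disp|by apply: class_CZ; exact: class_C_disp|exact: BP|].
  apply: jet_le_mono (leqnn k) _ (jet_leZ (-1) (class_C_disp l Cm) (jet_le_mu l x s0 sl lT)).
  rewrite normrN1 mul1r; apply: ler_wpM2l => //; apply: ler_gamma; first by rewrite subr_ge0.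
  by apply: le_trans lT; rewrite gerBl.
by apply/funext => y; rewrite /disp; ring.
Qed.

Lemma chain_lipschitz : exists2 Lip, 0 <= Lip & forall p s x y,
  0 <= s -> path <=%R s p -> last s p <= T ->
  `|chain s p x - chain s p y| <= Lip * `|x - y|.
Proof.
have [B B0 BP] := jet_le_disp_chain.
exists (n%:R * B + 1); first by rewrite addr_ge0 // mulr_ge0.
move=> p s x y s0 pp lT; apply: row_norm_le => [|l].
  by rewrite mulr_ge0 // addr_ge0 // mulr_ge0.
rewrite !mxE (_ : _ - _ = (disp (chain s p) l x - disp (chain s p) l y) + (x - y) 0 l); last first.
  by rewrite /disp !mxE; ring.
apply: le_trans (ler_normD _ _) _; rewrite mulrDl mul1r; apply: lerD; last exact: coord_le_norm.
apply: mean_value.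
  by apply: class_C_le k0 _; apply: class_C_disp; exact: class_C_chain.
move=> r i _; exact: (BP p s l _ s0 pp lT [:: i]).
Qed.

(** The intervals of the coarse partition p are treated one at a time: the fine chain inside an
    interval is replaced by a single mu, at the cost L gap^theta, and this error is carried to the
    end by the Lipschitz constant of the remaining coarse chain. Working in the sup norm lets the
    uniform C^1 bounds suffice. *)
Lemma chain_refine : exists2 C, 0 <= C & forall p q s x,
  0 <= s -> path <=%R s q -> last s q <= T -> subseq p q -> last s p = last s q ->
  `|chain s q x - chain s p x| <= C * gap_sum theta s p.
Proof.
have [L L0 LP] := map_near_chain; have [Lip Lip0 LipP] := chain_lipschitz.
have theta0 : 0 < theta by exact: lt_trans theta1.
exists ((1 + Lip) * L); first by rewrite mulr_ge0 // addr_ge0.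
elim=> [|a p IH] q s x s0 pq lT pq' lE.
  have sT : s <= T by exact: le_trans (path_le_last pq) lT.
  have H := LP q s s0 pq lT; rewrite -lE /= subrr powR0 ?gt_eqF // mulr0 in H.
  by have := map_near_norm x (lexx 0) H; rewrite mu_id //= mulr0.
have [p1 [p2 [qE sp2]]] := subseq_split pq'.
have [pp1 l1a pp2] : [/\ path <=%R s p1, last s p1 <= a & path <=%R a p2].
  by apply: path_split; rewrite -qE.
have l2 : last a p2 = last s q by rewrite qE last_cat.
have at_ : a <= last s q by rewrite -l2; exact: path_le_last.
have sa : s <= a by exact: le_trans (path_le_last pp1) l1a.
have a0 : 0 <= a by exact: le_trans sa.
have aT : a <= T by exact: le_trans lT.
have pa : path <=%R a p.
  have le_tr : transitive (<=%R : rel R) by move=> ? ? ?; exact: le_trans.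
  move: pp2; rewrite !(path_sortedE le_tr) => /andP[al ss].
  rewrite (subseq_sorted le_tr sp2 ss) andbT; apply/allP => z zp.
  exact: (allP al _ (mem_subseq sp2 zp)).
have la : last a p = last a p2 by rewrite l2 -lE.
have lp : last a p <= T by rewrite la l2.
have pr : path <=%R s (rcons p1 a) by rewrite rcons_path pp1.
have -> : chain s q x = chain a p2 (chain s (rcons p1 a) x).
  by rewrite qE -cat_rcons chain_cat last_rcons.
apply: le_trans (ler_distD (chain a p (chain s (rcons p1 a) x)) _ _) _.
rewrite /= mulrDr [leRHS]addrC; apply: lerD.
  by apply: IH => //; rewrite l2.
apply: le_trans (LipP _ _ _ _ a0 pa lp) _.
have := map_near_norm x _ (LP (rcons p1 a) s s0 pr _); rewrite last_rcons => /(_ _ aT) H.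
apply: (@le_trans _ _ (Lip * (L * (a - s) `^ theta))).
  by apply: ler_wpM2l => //; apply: H; rewrite mulr_ge0 // powR_ge0.
rewrite mulrA; apply: ler_wpM2r; first exact: powR_ge0.
by apply: ler_wpM2r => //; rewrite lerDr.
Qed.

(** Both chains are compared with the chain of their common refinement [sort (p ++ q)]; repeated
    times are harmless because paths are only weakly increasing. *)
Lemma chain_compare : exists2 C, 0 <= C & forall p q s t x,
  0 <= s -> t <= T -> path <=%R s p -> path <=%R s q -> last s p = t -> last s q = t ->
  `|chain s p x - chain s q x| <= C * (gap_sum theta s p + gap_sum theta s q).
Proof.
have [C C0 CP] := chain_refine; exists C => // p q s t x s0 tT pp pq lp lq.
have le_tr : transitive (<=%R : rel R) by move=> ? ? ?; exact: le_trans.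
pose m := sort <=%R (p ++ q).
have mem_m a : (a \in m) = (a \in p) || (a \in q) by rewrite mem_sort mem_cat.
have sorted_tail a (l : seq R) : path <=%R a l -> sorted <=%R l by case: l => //= b l /andP[].
have sp : subseq p m.
  by apply: sorted_subseq_sort => //; [exact: le_total|exact: prefix_subseq|exact: sorted_tail pp].
have sq : subseq q m.
  by apply: sorted_subseq_sort => //; [exact: le_total|exact: suffix_subseq|exact: sorted_tail pq].
have pm : path <=%R s m.
  rewrite (path_sortedE le_tr) sort_sorted ?andbT; last exact: le_total.
  apply/allP => a; rewrite mem_m => /orP[/(path_ge pp)|/(path_ge pq)] /andP[] //.
have lm : last s m = t.
  apply: last_sorted pm _ _ => [a|].
    by rewrite mem_m => /orP[/(path_ge pp)|/(path_ge pq)] /andP[_]; rewrite ?lp ?lq.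
  rewrite inE mem_m -{2}lp; have := mem_last s p; rewrite inE -lp => /orP[->//|->].
  by rewrite orbT.
have lmT : last s m <= T by rewrite lm.
apply: le_trans (ler_distD (chain s m x) _ _) _; rewrite mulrDr distrC.
by apply: lerD; apply: CP; rewrite ?lm.
Qed.

(** The limit is taken along dyadic partitions, but the estimate is kept for every partition: those
    through a prescribed intermediate time will give the flow property. *)
Lemma chain_limit : exists2 C, 0 <= C & exists flow : R -> R -> V -> V, forall p s t x,
  0 <= s -> t <= T -> path <=%R s p -> last s p = t ->
  `|chain s p x - flow s t x| <= C * gap_sum theta s p.
Proof.
have [C C0 CP] := chain_compare; exists C => //.
have kap01 := halving_ratio01 theta1; set kap := halving_ratio theta in kap01; have [kap0 kap1] := andP kap01.
have small D e : 0 < e -> exists m, forall a, (m <= a)%N -> D * kap ^+ a <= e.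
  have : D * kap ^+ a @[a --> \oo] --> D * 0.
    by apply: cvgM; [exact: cvg_cst|apply: cvg_expr; rewrite ger0_norm].
  rewrite mulr0 => /cvg_seq_epsP c /c[m mP]; exists m => a /mP.
  by rewrite subr0 => /(le_trans (ler_norm _)).
(* The property is vacuous unless 0 <= s <= t <= T, so that [choice] can be applied to arbitrary
   times. *)
pose P (z : R * R * V * 'I_n) (v : R) := let: (s, t, x, l) := z in
  0 <= s -> s <= t -> t <= T -> chain s (dyadic m s t) x 0 l @[m --> \oo] --> v.
have Pex z : exists v, P z v.
  case: z => -[[s t] x] l; rewrite /P.
  have [s0|] := boolP (0 <= s); last by exists 0.
  have [st|] := boolP (s <= t); last by exists 0.
  have [tT|] := boolP (t <= T); last by exists 0.
  have [|v vP] := @cauchy_seq_cvg R (fun m => chain s (dyadic m s t) x 0 l); last by exists v.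
  move=> e e0; have [m mP] := small (C * (t - s) `^ theta) (e / 2) (divr_gt0 e0 (@ltr0n R 2)).
  exists m => a b ma mb.
  have := coord_le_norm (chain s (dyadic a s t) x - chain s (dyadic b s t) x) l.
  rewrite !mxE => /le_trans; apply.
  have := CP _ _ s t x s0 tT (path_dyadic a st) (path_dyadic b st) (last_dyadic a s t) (last_dyadic b s t).
  move/le_trans; apply; rewrite !gap_sum_dyadic // -/kap.
  have := mP a ma; have := mP b mb; rewrite -!mulrA ![_ `^ _ * _]mulrC => ? ?; lra.
have [lm lmP] := choice Pex.
exists (fun s t x => \row_l lm (s, t, x, l)) => p s t x s0 tT pp lp.
have st : s <= t by rewrite -lp; exact: path_le_last.
apply: row_norm_le => [|l]; first by rewrite mulr_ge0 // gap_sum_ge0.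
rewrite !mxE; apply/ler_addgt0Pr => e e0.
have [m1 m1P] := small (C * (t - s) `^ theta) (e / 2) (divr_gt0 e0 (@ltr0n R 2)).
have [m2 m2P] := (cvg_seq_epsP _ _).1 (lmP (s, t, x, l) s0 st tT) (e / 2) (divr_gt0 e0 (@ltr0n R 2)).
pose m := maxn m1 m2; have := m1P m (leq_maxl _ _); have := m2P m (leq_maxr _ _).
have := coord_le_norm (chain s p x - chain s (dyadic m s t) x) l.
have := CP _ _ s t x s0 tT pp (path_dyadic m st) lp (last_dyadic m s t).
rewrite gap_sum_dyadic // -/kap !mxE.
move: (chain s p x 0 l) (chain s (dyadic m s t) x 0 l) (lm _) (`|chain s p x - _|) => a b g z.
rewrite -!mulrA ![_ `^ _ * _]mulrC mulrDr => h1 h2 h3 h4.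
have := ler_normD (a - b) (b - g); rewrite [a - b + _]addrA subrK; lra.
Qed.

(** A modulus c |x - y| + e behaves asymmetrically under composition: c may grow by a large fixed
    factor, but e is multiplied by 2 + 2 C eta only, independently of c. *)
Lemma disp_comp_modulus Bd Lip : 0 <= Bd -> 0 <= Lip -> exists2 C, 0 <= C & forall F G eta c e l x y,
  class_C_map k F -> class_C_map k G -> 0 <= eta -> eta <= Bd -> 0 <= c -> 0 <= e ->
  (forall i z, jet_le k (disp F i) z eta) -> (forall i z, jet_le k (disp G i) z eta) ->
  `|F x - F y| <= Lip * `|x - y| ->
  (forall i z z', jet_close k (disp F i) z (disp F i) z' (c * `|z - z'| + e)) ->
  (forall i z z', jet_close k (disp G i) z (disp G i) z' (c * `|z - z'| + e)) ->
  jet_close k (disp (fun z => G (F z)) l) x (disp (fun z => G (F z)) l) y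
    (c * ((1 + C * Bd) * Lip + C * Bd + 1) * `|x - y| + (2 + 2 * C * eta) * e).
Proof.
move=> Bd0 Lip0; have [C C0 CP] := jet_close_comp n k Bd0; exists C => //.
move=> F G eta c e l x y CF CG eta0 etaB c0 e0 HF HG FL MF MG.
rewrite (_ : disp _ l = fun z => disp G l (F z) + disp F l z); last first.
  by apply/funext => z; rewrite /disp; ring.
have Cg := class_C_disp l CG; have Cf := class_C_disp l CF.
have d0 : 0 <= c * `|x - y| + e by rewrite addr_ge0 // mulr_ge0.
have dG : jet_close k (disp G l) (F x) (disp G l) (F y) (c * (Lip * `|x - y|) + e).
  apply: jet_close_mono (leqnn k) _ (MG l (F x) (F y)).
  by rewrite lerD2r; apply: ler_wpM2l.
have J := CP _ _ _ _ _ _ _ _ _ _ Cg Cg CF CF etaB dG (HG l (F y)) eta0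
  (fun i => HF i x) (fun i => HF i y) d0 (fun i => MF i x y).
have CGF := class_C_comp Cg CF.
apply: jet_close_mono (leqnn k) _ (jet_closeD CGF Cf CGF Cf J (MF l x y)).
rewrite -subr_ge0 (_ : _ - _ = c * `|x - y| * C * (Lip + 1) * (Bd - eta)); last by ring.
by rewrite mulr_ge0 ?subr_ge0 // mulr_ge0 ?addr_ge0 // !mulr_ge0.
Qed.

(** Uniform equicontinuity of the k-jets, the input of [class_C_lim]. No uniform Lipschitz bound on
    the k-jets of chains is established; the modulus has a part e as small as desired and a slope c
    depending on e. Unfolding bisections makes e small: each doubles e up to the factor 1 + C eta,
    while halving the interval gains 2^(-theta). *)
Lemma chain_modulus e : 0 < e -> exists2 c, 0 <= c & forall m s t l x y,
  0 <= s -> s <= t -> t <= T ->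
  jet_close k (disp (chain s (dyadic m s t)) l) x (disp (chain s (dyadic m s t)) l) y
    (c * `|x - y| + e).
Proof.
have [L L0 LP] := map_near_chain; have [Lip Lip0 LipP] := chain_lipschitz.
have [B B0 BP] := jet_le_disp_chain.
have kap01 := halving_ratio01 theta1; set kap := halving_ratio theta in kap01; have [kap0 kap1] := andP kap01.
have theta0 : 0 < theta by exact: lt_trans theta1.
have Bd0 : 0 <= B + 1 by exact: addr_ge0.
have [C C0 core] := disp_comp_modulus Bd0 Lip0.
pose Y := (1 + C * (B + 1)) * Lip + C * (B + 1) + 1.
have Y0 : 0 <= Y by rewrite !addr_ge0 ?mulr_ge0 // addr_ge0 // mulr_ge0.
pose c0 := n%:R * (C1 * T `^ gamma).
have c00 : 0 <= c0 by rewrite mulr_ge0 // mulr_ge0 // powR_ge0.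
have base s t l x y : 0 <= s -> s <= t -> t <= T ->
    jet_close k (disp (mu s t) l) x (disp (mu s t) l) y (c0 * `|x - y|).
  move=> s0 st tT; apply: (jet_close_mean (class_C_disp l (mu_class s0 st tT))) => r _.
  apply: jet_le_mono (leqnn _) _ (mu_disp l _ s0 st tT).
  apply: ler_wpM2l => //; apply: ler_gamma; first by rewrite subr_ge0.
  by apply: le_trans tT; rewrite gerBl.
have dyC m s t : 0 <= s -> s <= t -> t <= T -> class_C_map k (chain s (dyadic m s t)).
  by move=> s0 st tT; apply: class_C_chain => //; [exact: path_dyadic|rewrite last_dyadic].
have dyB m s t l x : 0 <= s -> s <= t -> t <= T -> jet_le k (disp (chain s (dyadic m s t)) l) x B.
  by move=> s0 st tT; apply: BP => //; [exact: path_dyadic|rewrite last_dyadic].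
have dyL m s t x y : 0 <= s -> s <= t -> t <= T ->
    `|chain s (dyadic m s t) x - chain s (dyadic m s t) y| <= Lip * `|x - y|.
  by move=> s0 st tT; apply: LipP => //; [exact: path_dyadic|rewrite last_dyadic].
have dyN m s t : 0 <= s -> s <= t -> t <= T ->
    map_near (chain s (dyadic m s t)) (mu s t) (L * (t - s) `^ theta).
  move=> s0 st tT; have := LP _ s s0 (path_dyadic m st).
  by rewrite last_dyadic => /(_ tT).
have dyS m s t : chain s (dyadic m.+1 s t) = fun x =>
    chain ((s + t) / 2) (dyadic m ((s + t) / 2) t) (chain s (dyadic m s ((s + t) / 2)) x).
  by apply/funext => x; rewrite /= chain_cat last_dyadic.
(* Chosen so that kap (1 + C eta) <= q < 1: one bisection then multiplies the additive part of the
   modulus by at most q. *)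
pose eta := Num.min 1 ((1 - kap) / (2 * (C + 1))).
have C10 : 0 < C + 1 by rewrite ltr_wpDl.
have eta0 : 0 < eta by rewrite lt_min ltr01 divr_gt0 ?subr_gt0 // mulr_gt0.
have eta1 : eta <= 1 by rewrite ge_min lexx.
have etaB : eta <= B + 1 by apply: le_trans eta1 _; rewrite lerDr.
have etaC : C * eta <= (1 - kap) / 2.
  have : eta <= (1 - kap) / (2 * (C + 1)) by rewrite ge_min lexx orbT.
  by rewrite ler_pdivlMr ?mulr_gt0 // => h; have : 0 <= eta by [exact: ltW]; lra.
pose q := (1 + kap) / 2.
have q01 : 0 <= q < 1 by apply/andP; split; rewrite /q; lra.
have [q0 q1] := andP q01.
have facq : kap * (1 + C * eta) <= q.
  have : kap * (C * eta) <= 1 * ((1 - kap) / 2).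
    by apply: ler_pM => //; [rewrite mulr_ge0 // ltW|exact: ltW].
  by rewrite /q mulrDr; lra.
have e20 : 0 < eta / 2 by rewrite divr_gt0.
have [d1 d10 d1P] := small_powR C1_ge0 gamma0 e20.
have [d2 d20 d2P] := small_powR L0 theta0 e20.
pose delta := Num.min d1 d2; have delta0 : 0 < delta by rewrite lt_min d10.
have dyE m s t l x : 0 <= s -> s <= t -> t <= T -> t - s <= delta ->
    jet_le k (disp (chain s (dyadic m s t)) l) x eta.
  move=> s0 st tT; rewrite le_min => /andP[ts1 ts2].
  apply: jet_le_mono (leqnn k) _ (jet_le_disp_near l x (dyC m s t s0 st tT) s0 st tT (dyN m s t s0 st tT)).
  have ts0 : 0 <= t - s by rewrite subr_ge0.
  have := d1P (t - s); rewrite ts0 ts1 => /(_ isT).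
  by have := d2P (t - s); rewrite ts0 ts2 => /(_ isT); lra.
pose K := 2 * L; have K0 : 0 <= K by rewrite mulr_ge0.
(* b is the number of bisections unfolded. At b = 0 the chain is compared with the single map mu,
   whose k-jets are Lipschitz with constant c0; for m = 0 the chain is mu itself. *)
have short b : exists2 c, 0 <= c & forall m s t l x y, 0 <= s -> s <= t -> t <= T -> t - s <= delta ->
    jet_close k (disp (chain s (dyadic m s t)) l) x (disp (chain s (dyadic m s t)) l) y
      (c * `|x - y| + K * q ^+ b * (t - s) `^ theta).
  elim: b => [|b [c cge0 cP]].
    exists c0 => // m s t l x y s0 st tT _.
    have near z : jet_close k (disp (chain s (dyadic m s t)) l) z (disp (mu s t) l) z
        (L * (t - s) `^ theta).
      have Cd := class_C_disp l (dyC m s t s0 st tT).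
      have Cm := class_C_disp l (class_C_mu s0 st tT).
      apply/(jet_le_sub _ _ Cd Cm).
      rewrite (_ : (fun y => _) = fun y => chain s (dyadic m s t) y 0 l - mu s t y 0 l).
        exact: dyN.
      by apply/funext => w; rewrite /disp; ring.
    have near' : jet_close k (disp (mu s t) l) y (disp (chain s (dyadic m s t)) l) y
        (L * (t - s) `^ theta) by move=> J Jk; rewrite distrC; exact: near.
    apply: jet_close_mono (leqnn k) _
      (jet_close_trans (jet_close_trans (near x) (base s t l x y s0 st tT)) near').
    rewrite le_eqVlt; apply/orP; left; apply/eqP; rewrite expr0 /K; ring.
  exists (c0 + c * Y); first by rewrite addr_ge0 // mulr_ge0.
  move=> m s t l x y s0 st tT tsd.
  have X0 : 0 <= K * q ^+ b.+1 * (t - s) `^ theta by rewrite mulr_ge0 ?powR_ge0 // mulr_ge0 // exprn_ge0.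
  have cY : 0 <= c * Y * `|x - y| by rewrite mulr_ge0 // mulr_ge0.
  case: m => [|m].
    by apply: jet_close_mono (leqnn k) _ (base s t l x y s0 st tT); lra.
  have /andP[sr rt] := midpoint_le st; set r := (s + t) / 2 in sr rt.
  have r0 : 0 <= r by exact: le_trans sr.
  have rT : r <= T by exact: le_trans tT.
  have h1 : r - s = (t - s) / 2 by rewrite /r; lra.
  have h2 : t - r = (t - s) / 2 by rewrite /r; lra.
  have hd : (t - s) / 2 <= delta by have := subr_ge0 s t; rewrite st; lra.
  pose e' := K * q ^+ b * ((t - s) / 2) `^ theta.
  have e'0 : 0 <= e' by rewrite mulr_ge0 ?powR_ge0 // mulr_ge0 // exprn_ge0.
  rewrite dyS -/r.
  apply: jet_close_mono (leqnn k) _ (core _ _ eta c e' l x y (dyC m s r s0 sr rT)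
    (dyC m r t r0 rt tT) (ltW eta0) etaB cge0 e'0 _ _ (dyL m s r x y s0 sr rT) _ _).
  - have ts0 : 0 <= t - s by rewrite subr_ge0.
    have E := half_powR theta ts0; rewrite -/kap in E.
    have -> : (2 + 2 * C * eta) * e' = K * q ^+ b * (kap * (1 + C * eta)) * (t - s) `^ theta.
      transitivity (K * q ^+ b * (1 + C * eta) * (2 * ((t - s) / 2) `^ theta)).
        by rewrite /e'; ring.
      by rewrite E; ring.
    have : K * q ^+ b * (kap * (1 + C * eta)) * (t - s) `^ theta <= K * q ^+ b.+1 * (t - s) `^ theta.
      apply: ler_wpM2r; first exact: powR_ge0.
      by rewrite exprSr [leRHS]mulrA; apply: ler_wpM2l => //; rewrite mulr_ge0 // exprn_ge0.
    rewrite -/Y mulrDl; have : 0 <= c0 * `|x - y| by rewrite mulr_ge0.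
    lra.
  - by move=> i z; apply: dyE; rewrite ?h1.
  - by move=> i z; apply: dyE; rewrite ?h2.
  - by move=> i z z'; have := cP m s r i z z' s0 sr rT; rewrite h1 => /(_ hd).
  - by move=> i z z'; have := cP m r t i z z' r0 rt tT; rewrite h2 => /(_ hd).
(* From intervals of length delta up to T by doubling: each doubling multiplies e by the fixed
   factor 2 + 2 C (B + 1), so the induction hypothesis is used with e divided by it. *)
suff H M : forall e, 0 < e -> exists2 c, 0 <= c & forall m s t l x y,
    0 <= s -> s <= t -> t <= T -> t - s <= 2 ^+ M * delta ->
    jet_close k (disp (chain s (dyadic m s t)) l) x (disp (chain s (dyadic m s t)) l) y
      (c * `|x - y| + e).
  move=> e0; pose M := (Num.truncn (T / delta)).+1.
  have [c cge0 cP] := H M e e0; exists c => // m s t l x y s0 st tT; apply: cP => //.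
  apply: (@le_trans _ _ T); first by apply: le_trans tT; rewrite gerBl.
  rewrite -ler_pdivrMr //; apply: (@le_trans _ _ M%:R).
    by apply: ltW; have /andP[_] := truncn_itv (divr_ge0 (ltW T0) (ltW delta0)).
  by rewrite -natrX ler_nat ltnW // ltn_expl.
elim: M => [|M IH] {}e e0.
  have D0 : 0 <= K * delta `^ theta by rewrite mulr_ge0 // powR_ge0.
  have [b bP] : exists b, K * delta `^ theta * q ^+ b <= e.
    have : K * delta `^ theta * q ^+ a @[a --> \oo] --> K * delta `^ theta * 0.
      by apply: cvgM; [exact: cvg_cst|apply: cvg_expr; rewrite ger0_norm].
    rewrite mulr0 => /cvg_seq_epsP /(_ e e0) [a /(_ a (leqnn a))].
    by rewrite subr0 => /(le_trans (ler_norm _)); exists a.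
  have [c cge0 cP] := short b; exists c => // m s t l x y s0 st tT; rewrite expr0 mul1r => tsd.
  apply: jet_close_mono (leqnn k) _ (cP m s t l x y s0 st tT tsd); rewrite lerD2l.
  apply: le_trans bP; rewrite mulrAC; apply: ler_wpM2r; first exact: exprn_ge0.
  by apply: ler_wpM2l => //; apply: ler_theta => //; rewrite subr_ge0.
have D0 : 0 < 2 + 2 * C * (B + 1) by rewrite ltr_pwDl // !mulr_ge0.
have [c cge0 cP] := IH (e / (2 + 2 * C * (B + 1))) (divr_gt0 e0 D0).
exists (c0 + c * Y); first by rewrite addr_ge0 // mulr_ge0.
move=> m s t l x y s0 st tT tsd.
have cY : 0 <= c * Y * `|x - y| by rewrite mulr_ge0 // mulr_ge0.
have c0xy : 0 <= c0 * `|x - y| by rewrite mulr_ge0.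
case: m => [|m].
  by apply: jet_close_mono (leqnn k) _ (base s t l x y s0 st tT); lra.
have /andP[sr rt] := midpoint_le st; set r := (s + t) / 2 in sr rt.
have r0 : 0 <= r by exact: le_trans sr.
have rT : r <= T by exact: le_trans tT.
have hd : (t - s) / 2 <= 2 ^+ M * delta by rewrite exprS in tsd; lra.
have h1 : r - s <= 2 ^+ M * delta by rewrite (_ : r - s = (t - s) / 2) // /r; lra.
have h2 : t - r <= 2 ^+ M * delta by rewrite (_ : t - r = (t - s) / 2) // /r; lra.
rewrite dyS -/r.
apply: jet_close_mono (leqnn k) _ (core _ _ (B + 1) c _ l x y (dyC m s r s0 sr rT)
  (dyC m r t r0 rt tT) Bd0 (lexx _) cge0 (ltW (divr_gt0 e0 D0)) _ _ (dyL m s r x y s0 sr rT) _ _).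
- have -> : (2 + 2 * C * (B + 1)) * (e / (2 + 2 * C * (B + 1))) = e.
    by rewrite mulrC divfK // gt_eqF.
  by rewrite -/Y mulrDl; lra.
- by move=> i z; apply: jet_le_mono (leqnn k) _ (dyB m s r i z s0 sr rT); rewrite lerDl.
- by move=> i z; apply: jet_le_mono (leqnn k) _ (dyB m r t i z r0 rt tT); rewrite lerDl.
- by move=> i z z'; exact: cP.
- by move=> i z z'; exact: cP.
Qed.

Theorem sewing : exists2 C, 0 <= C & exists flow : R -> R -> V -> V,
  [/\ forall s t, 0 <= s -> s <= t -> t <= T -> class_C_map k (flow s t),
      forall s t, 0 <= s -> s <= t -> t <= T ->
        map_near (flow s t) (mu s t) (C * (t - s) `^ theta)
    & forall r s t x, 0 <= r -> r <= s -> s <= t -> t <= T ->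
        flow r t x = flow s t (flow r s x)].
Proof.
have [L L0 LP] := map_near_chain; have [Lip Lip0 LipP] := chain_lipschitz.
have [C C0 [flow flowP]] := chain_limit.
have kap01 := halving_ratio01 theta1; set kap := halving_ratio theta in kap01; have [kap0 kap1] := andP kap01.
exists L => //; exists flow.
have dyF m s t x : 0 <= s -> s <= t -> t <= T ->
    `|chain s (dyadic m s t) x - flow s t x| <= C * (t - s) `^ theta * kap ^+ m.
  move=> s0 st tT; have := flowP _ s t x s0 tT (path_dyadic m st) (last_dyadic m s t).
  by rewrite gap_sum_dyadic // -/kap [kap ^+ m * _]mulrC mulrA.
have dyC m s t : 0 <= s -> s <= t -> t <= T -> class_C_map k (chain s (dyadic m s t)).
  by move=> s0 st tT; apply: class_C_chain => //; [exact: path_dyadic|rewrite last_dyadic].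
have lim s t l : 0 <= s -> s <= t -> t <= T -> class_C k (disp (flow s t) l) /\
    forall J, (size J <= k)%N -> forall x,
    partials J (disp (chain s (dyadic m s t)) l) x @[m --> \oo] --> partials J (disp (flow s t) l) x.
  move=> s0 st tT; apply: class_C_lim => [m|x|e e0].
  - by apply: class_C_disp; exact: dyC.
  - apply/cvg_seq_epsP => e e0; rewrite /disp.
    have : C * (t - s) `^ theta * kap ^+ a @[a --> \oo] --> C * (t - s) `^ theta * 0.
      by apply: cvgM; [exact: cvg_cst|apply: cvg_expr; rewrite ger0_norm].
    rewrite mulr0 => /cvg_seq_epsP /(_ e e0) [m mP]; exists m => a /mP.
    rewrite subr0 => /(le_trans (ler_norm _)); apply: le_trans; apply: le_trans (dyF a s t x s0 st tT).
    have := coord_le_norm (chain s (dyadic a s t) x - flow s t x) l; rewrite !mxE.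
    by rewrite opprB addrA subrK.
  - have [c c0 cP] := chain_modulus (divr_gt0 e0 (@ltr0n R 2)).
    have c1 : 0 < c + 1 by rewrite ltr_wpDl.
    exists (e / 2 / (c + 1)); first by rewrite !divr_gt0.
    move=> a x y; rewrite ler_pdivlMr // => xy.
    apply: jet_close_mono (leqnn k) _ (cP a s t l x y s0 st tT).
    by have : 0 <= `|x - y| by []; lra.
split.
- move=> s t s0 st tT l; have [Cd _] := lim s t l s0 st tT.
  rewrite (_ : (fun x => _) = fun x => disp (flow s t) l x + coordf l x).
    by apply: class_CD Cd _; exact: class_C_coord.
  by apply/funext => x; rewrite /disp /coordf subrK.
- move=> s t s0 st tT l x; have [Cd cv] := lim s t l s0 st tT.
  have Cm := class_C_disp l (class_C_mu s0 st tT).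
  rewrite (_ : (fun y => _) = fun y => disp (flow s t) l y - disp (mu s t) l y); last first.
    by apply/funext => y; rewrite /disp; ring.
  apply/(jet_le_sub _ _ Cd Cm) => J Jk.
  apply: (@cvg_seq_le _ (fun m => partials J (disp (chain s (dyadic m s t)) l) x -
    partials J (disp (mu s t) l) x)).
    by apply: cvgB; [exact: cv|exact: cvg_cst].
  move=> m; have Cc := class_C_disp l (dyC m s t s0 st tT).
  have /(jet_le_sub _ _ Cc Cm) H : jet_le k (fun y => disp (chain s (dyadic m s t)) l y -
      disp (mu s t) l y) x (L * (t - s) `^ theta).
    rewrite (_ : (fun y => _) = fun y => chain s (dyadic m s t) y 0 l - mu s t y 0 l).
      by have := LP _ s s0 (path_dyadic m st); rewrite last_dyadic => /(_ tT); apply.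
    by apply/funext => y; rewrite /disp; ring.
  exact: H.
- move=> r s t x r0 rs st tT; have rt := le_trans rs st.
  have s0 := le_trans r0 rs; have sT := le_trans st tT.
  apply/eqP; rewrite -subr_eq0 -normr_eq0; apply/eqP.
  pose D1 := (s - r) `^ theta; pose D2 := (t - s) `^ theta.
  apply: (@le_geometric_eq0 _ _ (C * (D1 + D2) + Lip * (C * D1) + C * D2) kap) => // m.
  (* This partition passes through s, so its chain is close both to flow r t and to the composition
     of the two flows, with errors geometric in m. *)
  pose p := dyadic m r s ++ dyadic m s t.
  have pp : path <=%R r p by rewrite cat_path last_dyadic !path_dyadic.
  have lp : last r p = t by rewrite last_cat !last_dyadic.
  have H1 := flowP p r t x r0 tT pp lp.
  rewrite gap_sum_cat last_dyadic !gap_sum_dyadic // -/kap -/D1 -/D2 chain_cat last_dyadic in H1.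
  have H2 := dyF m r s x r0 rs sT.
  have H3 := dyF m s t (flow r s x) s0 st tT.
  have H4 : `|chain s (dyadic m s t) (chain r (dyadic m r s) x) -
      chain s (dyadic m s t) (flow r s x)| <= Lip * (C * D1 * kap ^+ m).
    apply: le_trans (LipP _ _ _ _ s0 (path_dyadic m st) _) _; first by rewrite last_dyadic.
    exact: ler_wpM2l.
  rewrite distrC in H1.
  apply: le_trans (ler_distD (chain s (dyadic m s t) (chain r (dyadic m r s) x)) _ _) _.
  apply: le_trans (lerD H1 (ler_distD (chain s (dyadic m s t) (flow r s x)) _ _)) _.
  apply: le_trans (lerD (lexx _) (lerD H4 H3)) _.
  by rewrite -/D2 le_eqVlt; apply/orP; left; apply/eqP; ring.
Qed.

End Sewing.

(** * The rough flow *)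

Section RoughFlow.
Variables (R : realType) (T gamma : R) (d n : nat).
Local Notation N := (N_of gamma).
Local Notation V := 'rV[R]_n.
Variables (W : R -> tensor R d N) (f : 'I_d -> V -> V).
Hypotheses (hT : 0 < T) (hgamma : 0 < gamma <= 1).
Hypothesis hW : geometric_rough_path T W.
Hypothesis hf : forall i : 'I_d, vector_field_Cb (2 * N + 1) (f i).
Local Notation word := (N.-bseq 'I_d).
Local Notation inc s t := (ext (increment W s t)).

Lemma fields_bounded : exists A, forall i j, class_Cb_le (2 * N + 1) A (fun x => f i x 0 j).
Proof.
have H (ij : 'I_d * 'I_n) : exists M, class_Cb_le (2 * N + 1) M (fun x => f ij.1 x 0 ij.2).
  exact: hf.
have [M MP] := choice H; exists (\sum_ij `|M ij|) => i j.
have [C B] := MP (i, j); split=> // J Jk x; apply: le_trans (B J Jk x) _.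
apply: le_trans (ler_norm _) _; rewrite (bigD1 (i, j)) //= lerDl; exact: sumr_ge0.
Qed.

Lemma gamma_gt0 : 0 < gamma. Proof. by case/andP: hgamma. Qed.

Lemma exponent_gt1 : 1 < N.+1%:R * gamma.
Proof.
rewrite -ltr_pdivrMr ?gamma_gt0 // div1r.
have gV : 0 <= gamma^-1 by rewrite invr_ge0 ltW // gamma_gt0.
by have /andP[_] := truncn_itv gV.
Qed.

Lemma powR_expr (x : R) m : (x `^ gamma) ^+ m = x `^ (m%:R * gamma).
Proof. by rewrite -powR_mulrn ?powR_ge0 // -powRrM mulrC. Qed.

Lemma increment_decay : exists2 C, 0 <= C & forall s t, 0 <= s -> s <= t -> t <= T ->
  decay (C * (t - s) `^ gamma) (inc s t).
Proof.
have [gl hb] := hW; have [C CP] := choice hb.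
(* At least 1, so that the constant is bounded by each of its powers of exponent |w| >= 1. *)
exists (1 + \sum_w `|C w|); first by rewrite addr_ge0 // sumr_ge0.
move=> s t s0 st tT w; set C0 := 1 + _.
have C01 : 1 <= C0 by rewrite lerDl sumr_ge0.
have sT : s <= T by exact: le_trans tT.
have t0 : 0 <= t by exact: le_trans st.
have Ws : group_like (W s) by apply: gl; rewrite s0.
have Wt : group_like (W t) by apply: gl; rewrite t0.
have [g1 _] := shuffle_char_increment Ws Wt.
have h0 : 0 <= C0 * (t - s) `^ gamma by rewrite mulr_ge0 ?powR_ge0 // (le_trans ler01).
have [w0|w0] := posnP (size w); first by rewrite (size0nil w0) expr0 g1 normr1.
have [wN|Nw] := leqP (size w) N; last by rewrite ext_big // normr0 exprn_ge0.
(* The rough path bound is assumed for s != t only; on the diagonal the increment is the unit. *)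
have [Est|nst] := eqVneq s t.
  rewrite -Est increment_refl // ext_unit gtn_eqF // normr0.
  by rewrite subrr powR0 ?gt_eqF ?gamma_gt0 // mulr0 expr0n gtn_eqF.
have lt_st : s < t by rewrite lt_neqAle nst.
rewrite (extE _ wN); have := CP (Bseq wN) s t; rewrite s0 sT t0 tT => /(_ isT isT nst).
have ts0 : 0 < t - s by rewrite subr_gt0.
rewrite (gtr0_norm ts0) ler_pdivrMr ?powR_gt0 //= => /le_trans; apply.
rewrite exprMn powR_expr; apply: ler_wpM2r; first exact: powR_ge0.
apply: (@le_trans _ _ C0); last by apply: ler_eXnr.
apply: le_trans (ler_norm _) _; rewrite /C0 (bigD1 (Bseq wN)) //= addrCA lerDl.
by rewrite addr_ge0 // sumr_ge0.
Qed.

Lemma shuffle_char_inc s t : 0 <= s -> s <= t -> t <= T -> shuffle_char N (inc s t).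
Proof.
move=> s0 st tT; have [gl _] := hW; apply: shuffle_char_increment; apply: gl.
  by rewrite s0 (le_trans st).
by rewrite (le_trans s0 st).
Qed.

(** In the Taylor estimate K is the order of the expansion and k the number of space derivatives of
    the error under control. The error is the sum of psi o flow - psi o mu, from the sewing, and of
    the remainder of the Davie map. *)
Theorem rough_flow : exists2 C, 0 <= C & exists flow : R -> R -> V -> V, [/\
  forall s t, 0 <= s -> s <= t -> t <= T -> class_C_map N.+1 (flow s t),
  forall s t l x, 0 <= s -> s <= t -> t <= T ->
    jet_le N.+1 (disp (flow s t) l) x (C * (t - s) `^ gamma),
  forall r s t x, 0 <= r -> r <= s -> s <= t -> t <= T -> flow r t x = flow s t (flow r s x)
  & forall k K s t psi x M, (0 < K)%N -> (k + K <= N.+1)%N -> 0 <= s -> s <= t -> t <= T ->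
    class_C (k + K) psi -> (forall y, `|y - x| <= C * T `^ gamma -> jet_le (k + K) psi y M) ->
    jet_le k (fun y => psi (flow s t y) - expansion N f K (inc s t) psi y) x
      (C * M * (t - s) `^ (K%:R * gamma))].
Proof.
have [A fC] := fields_bounded; have [C0 C00 incD] := increment_decay.
have theta1 := exponent_gt1; set theta := N.+1%:R * gamma in theta1.
have g0 := gamma_gt0; have Tg0 : 0 <= T `^ gamma by exact: powR_ge0.
pose H := C0 * T `^ gamma; have H0 : 0 <= H by exact: mulr_ge0.
have Pow s t : s <= t -> 0 <= s -> t <= T -> (t - s) `^ gamma <= T `^ gamma.
  move=> st s0 tT; apply: ge0_ler_powR; rewrite ?nnegrE ?(ltW hT) ?subr_ge0 ?(ltW g0) //.
  by apply: le_trans tT; rewrite gerBl.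
have hH s t : 0 <= s -> s <= t -> t <= T -> 0 <= C0 * (t - s) `^ gamma <= H.
  move=> s0 st tT; rewrite mulr_ge0 ?powR_ge0 //=; apply: ler_wpM2l => //; exact: Pow.
pose mu s t := davie N f (inc s t).
have [CD CD0 CDP] := jet_le_davie_comp fC H0.
pose dc := disp_const d n N A H.
have dc0 : 0 <= dc by exact: disp_const_ge0.
have mu_class s t : 0 <= s -> s <= t -> t <= T -> class_C_map N.+2 (mu s t).
  by move=> *; exact: (class_C_davie fC).
have mu_disp s t l x : 0 <= s -> s <= t -> t <= T ->
    jet_le N.+2 (disp (mu s t) l) x (dc * C0 * (t - s) `^ gamma).
  move=> s0 st tT; rewrite -mulrA; apply: (jet_le_disp_davie fC H0) => //; last exact: hH.
  - by case: (shuffle_char_inc s0 st tT).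
  - exact: incD.
have mu_comp s r t l x : 0 <= s -> s <= r -> r <= t -> t <= T ->
    jet_le N.+1 (fun y => mu r t (mu s r y) 0 l - mu s t y 0 l) x
      (CD * C0 ^+ N.+1 * (t - s) `^ theta).
  move=> s0 sr rt tT; have [gl _] := hW; have r0 := le_trans s0 sr; have rT := le_trans rt tT.
  have st := le_trans sr rt.
  rewrite /theta -powR_expr -mulrA -exprMn.
  have -> : mu s t = davie N f (ext (star (increment W s r) (increment W r t))).
    by rewrite /mu (@incrementM _ _ _ W s r t) //; apply: gl; rewrite r0.
  have mono a b h h' : 0 <= h -> h <= h' -> decay h (inc a b) -> decay h' (inc a b).
    by move=> h0 hh D w; apply: le_trans (D w) _; rewrite lerXn2r ?nnegrE // (le_trans h0).
  apply: CDP; [exact: shuffle_char_inc| | |exact: hH].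
  - apply: (mono s r (C0 * (r - s) `^ gamma)); last exact: incD.
      by rewrite mulr_ge0 // powR_ge0.
    apply: ler_wpM2l => //; apply: ge0_ler_powR; rewrite ?nnegrE ?subr_ge0 ?(ltW g0) //.
    by rewrite lerB.
  - apply: (mono r t (C0 * (t - r) `^ gamma)); last exact: incD.
      by rewrite mulr_ge0 // powR_ge0.
    apply: ler_wpM2l => //; apply: ge0_ler_powR; rewrite ?nnegrE ?subr_ge0 ?(ltW g0) //.
    by rewrite lerB.
have C10 : 0 <= dc * C0 by exact: mulr_ge0.
have C20 : 0 <= CD * C0 ^+ N.+1 by rewrite mulr_ge0 // exprn_ge0.
have [CF CF0 [flow [flowC flowN flowM]]] :=
  sewing (ltn0Sn N) g0 theta1 hT C10 C20 mu_class mu_disp mu_comp.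
(* The sewing error has exponent (N + 1) gamma; on [0, T] it is dominated by any lower power K of (t
   - s)^gamma, up to a constant. *)
have near_le s t : 0 <= s -> s <= t -> t <= T ->
    forall K, (K <= N.+1)%N -> (t - s) `^ theta <= (1 + T `^ gamma) ^+ N.+1 * ((t - s) `^ gamma) ^+ K.
  move=> s0 st tT K KN; rewrite -powR_expr; apply: expr_le_mono => //.
  by rewrite powR_ge0 Pow.
pose CB := dc * C0 + CF * (1 + T `^ gamma) ^+ N.+1.
have CB0 : 0 <= CB by rewrite addr_ge0 // mulr_ge0 // exprn_ge0 // addr_ge0.
have flowD s t l x : 0 <= s -> s <= t -> t <= T ->
    jet_le N.+1 (disp (flow s t) l) x (CB * (t - s) `^ gamma).
  move=> s0 st tT.
  apply: jet_le_mono (leqnn _) _ (jet_le_disp_near mu_class mu_disp l x (flowC s t s0 st tT) s0 st tT (flowN s t s0 st tT)).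
  rewrite /CB mulrDl lerD2l -mulrA; apply: ler_wpM2l => //.
  by have := near_le s t s0 st tT 1%N (ltn0Sn N); rewrite expr1.
have muD s t l x : 0 <= s -> s <= t -> t <= T ->
    jet_le N.+1 (disp (mu s t) l) x (CB * (t - s) `^ gamma).
  move=> s0 st tT; apply: jet_le_mono _ _ (mu_disp s t l x s0 st tT) => //.
  by apply: ler_wpM2r; [exact: powR_ge0|rewrite lerDl mulr_ge0 // exprn_ge0 // addr_ge0].
pose Hb := CB * T `^ gamma; have Hb0 : 0 <= Hb by exact: mulr_ge0.
have powK s t : 0 <= s -> s <= t -> t <= T -> CB * (t - s) `^ gamma <= Hb.
  by move=> s0 st tT; apply: ler_wpM2l => //; exact: Pow.
(* Comparing psi at the two nearby images uses one derivative of psi beyond k; it is available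
   because K > 0. *)
have [CC CC0 CCP] : exists2 C, 0 <= C & forall k K s t psi x M, (0 < K)%N -> (k + K <= N.+1)%N ->
    0 <= s -> s <= t -> t <= T -> class_C (k + K) psi ->
    (forall y, `|y - x| <= Hb -> jet_le (k + K) psi y M) ->
    jet_le k (fun y => psi (flow s t y) - psi (mu s t y)) x (C * M * (t - s) `^ (K%:R * gamma)).
  (* Only finitely many orders k occur, so the sum of their constants serves for all of them. *)
  have [C CP] := choice (fun k : 'I_N.+2 => let: ex_intro2 C a b :=
    jet_close_comp n k Hb0 in ex_intro _ C (conj a b)).
  pose CS := \sum_k C k.
  have CS0 : 0 <= CS by apply: sumr_ge0 => k _; case: (CP k).
  pose E := CF * (1 + T `^ gamma) ^+ N.+1.
  have E0 : 0 <= E by rewrite mulr_ge0 // exprn_ge0 // addr_ge0.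
  exists ((1 + CS * Hb) * n%:R * E + CS * E).
    have Z1 : 0 <= 1 + CS * Hb by apply: addr_ge0 => //; exact: mulr_ge0.
    by apply: addr_ge0; [exact: mulr_ge0 (mulr_ge0 Z1 (ler0n R n)) E0|exact: mulr_ge0].
  move=> k K s t psi x M K0 kK s0 st tT Cpsi HM.
  have kN : (k < N.+2)%N by rewrite ltnS; apply: leq_trans kK; exact: leq_addr.
  have kN1 : (k <= N.+1)%N by [].
  have [Ck0 CkP] := CP (Ordinal kN); have CkS : C (Ordinal kN) <= CS.
    by rewrite /CS (bigD1 (Ordinal kN)) //= lerDl; apply: sumr_ge0 => i _; case: (CP i).
  have M0 : 0 <= M by apply: (@jet_le_ge0 _ _ (k + K) psi x); apply: HM; rewrite subrr normr0.
  have Ck : class_C k psi by apply: class_C_le Cpsi; exact: leq_addr.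
  have Ck1 : class_C k.+1 psi by apply: class_C_le Cpsi; rewrite -addn1 leq_add2l.
  have Cf : class_C_map k (flow s t) by move=> l; apply: class_C_le kN1 (flowC s t s0 st tT l).
  have Cm : class_C_map k (mu s t) by move=> l; apply: class_C_le (leqW kN1) (mu_class s t s0 st tT l).
  have nf : `|flow s t x - x| <= Hb.
    apply: row_norm_le => // l; rewrite !mxE; apply: le_trans (powK s t s0 st tT).
    exact: (flowD s t l x s0 st tT [::]).
  have nm : `|mu s t x - x| <= Hb.
    apply: row_norm_le => // l; rewrite mxE [(- x) _ _]mxE; apply: le_trans (powK s t s0 st tT).
    exact: (muD s t l x s0 st tT [::]).
  have P0 : 0 <= (t - s) `^ theta by exact: powR_ge0.
  have e0 : 0 <= CF * (t - s) `^ theta by exact: mulr_ge0.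
  have nfm : `|flow s t x - mu s t x| <= CF * (t - s) `^ theta.
    exact: map_near_norm e0 (flowN s t s0 st tT).
  apply/(jet_le_sub x _ (class_C_comp Ck Cf) (class_C_comp Ck Cm)).
  have da : jet_close k psi (flow s t x) psi (mu s t x) (n%:R * M * (CF * (t - s) `^ theta)).
    apply: jet_close_mono (leqnn k) _ (jet_close_mean Ck1 _).
      by apply: ler_wpM2l; [exact: mulr_ge0|exact: nfm].
    move=> r r01; apply: jet_le_mono (_ : (k.+1 <= k + K)%N) (lexx M) _.
      by rewrite -addn1 leq_add2l.
    by apply: HM; exact: segment_in_ball.
  have dA : jet_le k psi (mu s t x) M.
    by apply: jet_le_mono (HM _ nm) => //; exact: leq_addr.
  have dF i : jet_le k (disp (flow s t) i) x Hb.
    exact: jet_le_mono kN1 (powK s t s0 st tT) (flowD s t i x s0 st tT).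
  have dM i : jet_le k (disp (mu s t) i) x Hb.
    exact: jet_le_mono kN1 (powK s t s0 st tT) (muD s t i x s0 st tT).
  have db i : jet_close k (disp (flow s t) i) x (disp (mu s t) i) x (CF * (t - s) `^ theta).
    apply/(jet_le_sub x _ (class_C_disp i Cf) (class_C_disp i Cm)).
    rewrite (_ : (fun y => _) = fun y => flow s t y 0 i - mu s t y 0 i).
      exact: jet_le_mono kN1 (lexx _) (flowN s t s0 st tT i x).
    by apply/funext => y; rewrite /disp; ring.
  apply: jet_close_mono (leqnn k) _
    (CkP _ _ _ _ _ _ _ _ _ _ Ck Ck Cf Cm (lexx Hb) da dA Hb0 dF dM e0 db).
  have KN : (K <= N.+1)%N by apply: leq_trans kK; exact: leq_addl.
  have := near_le s t s0 st tT K KN; rewrite powR_expr => nK.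
  have X0 : 0 <= (t - s) `^ (K%:R * gamma) by exact: powR_ge0.
  rewrite [leRHS](_ : _ = ((1 + CS * Hb) * n%:R + CS) * M *
    (CF * ((1 + T `^ gamma) ^+ N.+1 * (t - s) `^ (K%:R * gamma)))); last by rewrite /E; ring.
  rewrite [leLHS](_ : _ = ((1 + C (Ordinal kN) * Hb) * n%:R + C (Ordinal kN)) * M *
    (CF * (t - s) `^ theta)); last by ring.
  apply: ler_pM; [|exact: e0| |by apply: ler_wpM2l].
    by rewrite mulr_ge0 // addr_ge0 // mulr_ge0 // addr_ge0 // mulr_ge0.
  apply: ler_wpM2r => //; apply: lerD => //; apply: ler_wpM2r => //.
  by rewrite lerD2l; exact: ler_wpM2r.
have Crem (kK : 'I_N.+2 * 'I_N.+2) : exists C, 0 <= C /\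
  forall a h phi x M, shuffle_char N a -> decay h a -> 0 <= h <= H -> class_C (kK.1 + kK.2) phi ->
  (forall y, `|y - x| <= dc * H -> jet_le (kK.1 + kK.2) phi y M) ->
  jet_le kK.1 (remainder N f kK.2 a phi) x (C * M * h ^+ kK.2).
  have k2 : (kK.2 <= N.+1)%N by rewrite -ltnS.
  have k1 : (kK.1 <= N.+1)%N by rewrite -ltnS.
  have [C c0 cP] := jet_le_remainder fC H0 k2 k1.
  by exists C.
have [CR CRP] := choice Crem.
pose CRS := \sum_kK CR kK.
have CRS0 : 0 <= CRS by apply: sumr_ge0 => i _; case: (CRP i).
have C0K K : (K <= N.+1)%N -> C0 ^+ K <= (1 + C0) ^+ N.+1.
  move=> KN; apply: (@le_trans _ _ ((1 + C0) ^+ K)).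
    by rewrite lerXn2r ?nnegrE ?addr_ge0 // lerDr.
  by rewrite ler_weXn2l // lerDl.
(* The same constant bounds the displacement and the Taylor error and fixes the radius of the ball
   where psi is controlled; hence it must also dominate the displacement of the Davie map. *)
pose Cfin := CB + dc * C0 + (CC + CRS * (1 + C0) ^+ N.+1).
have Q0 : 0 <= CRS * (1 + C0) ^+ N.+1 by rewrite mulr_ge0 // exprn_ge0 // addr_ge0.
exists Cfin; first exact: addr_ge0 (addr_ge0 CB0 C10) (addr_ge0 CC0 Q0).
exists flow; split=> //.
- move=> s t l x s0 st tT; apply: jet_le_mono (leqnn _) _ (flowD s t l x s0 st tT).
  apply: ler_wpM2r; first exact: powR_ge0.
  by rewrite /Cfin; lra.
move=> k K s t psi x M K0 kK s0 st tT Cpsi HM.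
have r1 : Hb <= Cfin * T `^ gamma by apply: ler_wpM2r => //; rewrite /Cfin; lra.
have r2 : dc * H <= Cfin * T `^ gamma.
  by rewrite /H mulrA; apply: ler_wpM2r => //; rewrite /Cfin; lra.
have HM1 y : `|y - x| <= Hb -> jet_le (k + K) psi y M by move=> h; apply: HM; exact: le_trans h r1.
have HM2 y : `|y - x| <= dc * H -> jet_le (k + K) psi y M by move=> h; apply: HM; exact: le_trans h r2.
have J1 := CCP k K s t psi x M K0 kK s0 st tT Cpsi HM1.
have kN : (k < N.+2)%N by rewrite ltnS; apply: leq_trans kK; exact: leq_addr.
have KN : (K < N.+2)%N by rewrite ltnS; apply: leq_trans kK; exact: leq_addl.
have [CR0 CRPk] := CRP (Ordinal kN, Ordinal KN).
have J2 := CRPk _ _ psi x M (shuffle_char_inc s0 st tT) (incD s t s0 st tT) (hH s t s0 st tT) Cpsi HM2.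
have M0 : 0 <= M by apply: (@jet_le_ge0 _ _ (k + K) psi x); apply: HM1; rewrite subrr normr0.
rewrite /= exprMn powR_expr in J2.
have Ck : class_C k psi by apply: class_C_le Cpsi; exact: leq_addr.
have Cf : class_C_map k (flow s t) by move=> l; apply: class_C_le (flowC s t s0 st tT l).
have Cm : class_C_map k (mu s t) by move=> l; apply: class_C_le (leqW _) (mu_class s t s0 st tT l).
have kKm : (k + K <= (2 * N + 1).+1)%N.
  by apply: leq_trans kK _; rewrite addn1 mul2n -addnn !ltnS leqW // leq_addr.
have Cr : class_C k (remainder N f K (inc s t) psi).
  by apply: (class_C_remainder fC) => //; exact: leqW.
rewrite (_ : (fun y => _) = fun y => (psi (flow s t y) - psi (mu s t y)) +
    remainder N f K (inc s t) psi y); last first.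
  by apply/funext => y; rewrite /remainder addrA subrK.
apply: jet_le_mono (leqnn k) _ (jet_leD (class_CB (class_C_comp Ck Cf) (class_C_comp Ck Cm)) Cr J1 J2).
have X0 : 0 <= (t - s) `^ (K%:R * gamma) by exact: powR_ge0.
have CRle : CR (Ordinal kN, Ordinal KN) * C0 ^+ K <= CRS * (1 + C0) ^+ N.+1.
  apply: ler_pM => //; [exact: exprn_ge0| |exact: C0K].
  by rewrite /CRS (bigD1 (Ordinal kN, Ordinal KN)) //= lerDl; apply: sumr_ge0 => i _; case: (CRP i).
rewrite [leLHS](_ : _ = (CC + CR (Ordinal kN, Ordinal KN) * C0 ^+ K) * M * (t - s) `^ (K%:R * gamma));
  last by ring.
apply: ler_wpM2r => //; apply: ler_wpM2r => //; rewrite /Cfin; lra.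
Qed.

End RoughFlow.

(** Telescoping along a dyadic partition bounds the increment by C times a gap sum, which tends to
    0. *)
Lemma holder_constant (R : realType) (theta C s t : R) (F : R -> R) :
  1 < theta -> s <= t ->
  (forall a b, s <= a -> a <= b -> b <= t -> `|F a - F b| <= C * (b - a) `^ theta) ->
  F s = F t.
Proof.
move=> theta1 st HF; have kap01 := halving_ratio01 theta1.
have H p a : s <= a -> path <=%R a p -> last a p <= t ->
    `|F a - F (last a p)| <= C * gap_sum theta a p.
  elim: p a => [|b p IH] a sa /=; first by rewrite subrr normr0 mulr0.
  move=> /andP[ab pb] lt; apply: le_trans (ler_distD (F b) _ _) _; rewrite mulrDr.
  apply: lerD; last by apply: IH => //; exact: le_trans ab.
  by apply: HF => //; exact: le_trans (path_le_last pb) lt.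
apply/eqP; rewrite -subr_eq0 -normr_eq0; apply/eqP.
apply: (@le_geometric_eq0 _ _ (C * (t - s) `^ theta) (halving_ratio theta)) => // k.
have := H _ s (lexx s) (path_dyadic k st); rewrite last_dyadic => /(_ (lexx t)).
by rewrite gap_sum_dyadic // -mulrA [_ `^ _ * _]mulrC.
Qed.

(** * Bounds on balls and on compact sets *)

Section Compactness.
Variables (R : realType) (n : nat).
Local Notation V := 'rV[R]_n.

Lemma compact_ball (r : R) : compact [set y : V | `|y| <= r].
Proof.
apply: bounded_closed_compact.
  by exists r; split; [exact: num_real|move=> M rM y yr; exact: le_trans yr (ltW rM)].
apply: (@closed_comp V R (fun y => `|y|) [set z | z <= r]); last exact: closed_le.
by move=> y _; exact: norm_continuous.
Qed.

Lemma continuous_bounded_on_ball (phi : V -> R) r : continuous phi ->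
  exists M, forall y, `|y| <= r -> `|phi y| <= M.
Proof.
move=> cphi; pose B := [set y : V | `|y| <= r].
have cB : compact B by exact: compact_ball.
have : compact (phi @` B).
  by apply: continuous_compact => //; apply: continuous_subspaceT => x; exact: cphi.
move/compact_bounded => [M [_ MP]]; exists (M + 1) => y yr.
by apply: (MP (M + 1)); [rewrite ltrDl|exists y].
Qed.

Lemma jet_le_on_ball k (g : V -> R) r : class_C k g ->
  exists2 M, 0 <= M & forall y, `|y| <= r -> jet_le k g y M.
Proof.
move=> Cg.
have H (J : k.-bseq 'I_n) : exists M, forall y, `|y| <= r -> `|partials J g y| <= M.
  by apply: continuous_bounded_on_ball; have [] := Cg J (size_bseq J).
have [M MP] := choice H; exists (\sum_J `|M J|); first exact: sumr_ge0.
move=> y yr J Jk; apply: le_trans (MP (Bseq Jk) y yr) _.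
by apply: le_trans (ler_norm _) _; rewrite (bigD1 (Bseq Jk)) //= lerDl sumr_ge0.
Qed.

Lemma compact_norm_le (K : set V) : compact K -> exists2 r, 0 <= r & forall x, K x -> `|x| <= r.
Proof.
move=> /compact_bounded [M [_ MP]]; exists (`|M| + 1); first exact: addr_ge0.
by move=> x Kx; apply: (MP (`|M| + 1)) => //; rewrite (le_lt_trans (ler_norm M)) // ltrDl.
Qed.

End Compactness.

(** * Smooth approximation of boxes *)

Section Sigmoid.
Variable R : realType.

(** Since s' = s (1 - s), all derivatives are polynomials in s, and membership in C_b^k follows by
    induction from |s| <= 1. *)
Definition sigmoid (z : R) : R := (1 + expR (- z))^-1.

Lemma sigmoid_gt0 z : 0 < sigmoid z.
Proof. by rewrite invr_gt0 addr_gt0 // expR_gt0. Qed.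

Lemma sigmoid_lt1 z : sigmoid z < 1.
Proof. by rewrite invf_lt1 ?addr_gt0 ?expR_gt0 // ltrDl expR_gt0. Qed.

Lemma is_derive_sigmoid z : is_derive z (1 : R) sigmoid (sigmoid z * (1 - sigmoid z)).
Proof.
have e0 : 1 + expR (- z) != 0 by rewrite gt_eqF // addr_gt0 // expR_gt0.
have E : is_derive z (1 : R) (fun y : R => 1 + expR (- y)) (- expR (- z)).
  have De : is_derive (- z) (1 : R) expR (expR (- z)) by exact: is_derive_expR.
  have DN : is_derive z (1 : R) (fun y : R => - y) (-1) by apply: is_deriveN.
  have H : is_derive z (1 : R) (fun y : R => expR (- y)) (expR (- z) * -1).
    by apply: (@is_derive1_comp _ expR (fun y => - y)).
  refine (is_derive_eq (is_deriveD (is_derive_cst (1 : R) z (1 : R)) H) _).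
  by rewrite mulrN1 add0r.
refine (is_derive_eq (@is_deriveV _ (fun y : R => 1 + expR (- y)) z _ (1 : R) e0 E) _).
rewrite /sigmoid; set e := expR (- z) in e0 *.
rewrite /GRing.scale /=; field; exact: e0.
Qed.

Lemma sigmoid_le z : sigmoid z <= expR z.
Proof.
by rewrite /sigmoid -[expR z]invrK -expRN lef_pV2 ?posrE ?expR_gt0 ?addr_gt0 ?expR_gt0 // lerDr.
Qed.

Lemma sigmoid_ge z : 1 - sigmoid z <= expR (- z).
Proof.
have e0 := expR_gt0 (- z); rewrite /sigmoid; set e := expR (- z) in e0 *.
have e1 : 0 < 1 + e by rewrite addr_gt0.
rewrite (_ : 1 - _ = e / (1 + e)); first by rewrite ler_pdivrMr // mulrDr mulr1 lerDl mulr_ge0 // ltW.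
by field; rewrite gt_eqF.
Qed.

(* The shift by 1 forces the limit 0, instead of 1/2, at u = 0. *)
Lemma cvg_sigmoid_step (u : R) :
  sigmoid (k%:R * (k%:R * u - 1)) @[k --> \oo] --> (if 0 < u then 1 else 0 : R).
Proof.
have [u0|u0] := ltP 0 u; last first.
  apply: (@squeeze_cvgr _ _ _ _ (fun=> 0) (fun k : nat => expR (- k%:R))).
  - apply: nearW => k; rewrite ltW ?sigmoid_gt0 //=; apply: le_trans (sigmoid_le _) _.
    rewrite ler_expR -[leRHS]mulrN1; apply: ler_wpM2l => //; rewrite lerBlDr addNr.
    exact: mulr_ge0_le0.
  - exact: cvg_cst.
  - exact: cvgn_expR.
apply: (@squeeze_cvgr _ _ _ _ (fun k : nat => 1 - expR (- k%:R)) (fun=> 1)).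
(* For k >= 2 / u the inner factor k u - 1 is at least 1, so the argument of the sigmoid is at least
   k. *)
- have ku : \forall k \near \oo, 2 / u <= (k%:R : R) by exact: nbhs_infty_ger.
  apply: filterS ku => k ku; rewrite [X in _ && X]ltW ?sigmoid_lt1 // andbT lerBlDr -lerBlDl.
  apply: le_trans (sigmoid_ge _) _; rewrite ler_expR lerN2 ler_peMr // lerBrDr.
  by rewrite -ler_pdivrMr.
- by rewrite -[X in _ --> X]subr0; apply: cvgB; [exact: cvg_cst|exact: cvgn_expR].
- exact: cvg_cst.
Qed.

End Sigmoid.

Section Box.
Variables (R : realType) (n : nat).
Local Notation V := 'rV[R]_n.

Lemma is_derive_from_line (U : normedModType R) (phi : U -> R) x v D :
  is_derive (0 : R) (1 : R) (fun s : R => phi (x + s *: v)) D -> is_derive x v phi D.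
Proof.
move/is_derive_epsP => H; apply/is_derive_epsP => e /H[d d0 dP].
exists d => // h h0 hd; have := dP h h0 hd.
by rewrite addr0 [h *: (1 : R)]mulr1 scale0r addr0 [x + _]addrC.
Qed.

Lemma is_derive_ridge (h : R -> R) (c e D : R) l j (x : V) :
  is_derive (c * x 0 l + e) (1 : R) h D ->
  is_derive x (delta_mx 0 j) (fun y : V => h (c * y 0 l + e)) (D * (c * (j == l)%:R)).
Proof.
move=> Dh; apply: is_derive_from_line.
have H : is_derive (0 : R) (1 : R)
    (fun s : R => c * (x + s *: delta_mx 0 j : V) 0 l + e) (c * (j == l)%:R).
  apply/is_derive_epsP => eps eps0; exists 1 => // r r0 _.
  rewrite !mxE eqxx /= [r *: (1 : R)]mulr1 addr0 mul0r addr0 [l == j]eq_sym.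
  by rewrite (_ : _ - _ = 0) ?normr0 ?ltW //; field.
have D0 : is_derive (c * (x + (0 : R) *: delta_mx 0 j : V) 0 l + e) (1 : R) h D.
  by rewrite scale0r addr0.
exact: (@is_derive1_comp _ h _ 0 _ _ D0 H).
Qed.

Lemma class_Cb_leM k A B (phi psi : V -> R) : class_Cb_le k A phi -> class_Cb_le k B psi ->
  class_Cb_le k (2 ^+ k * (A * B)) (fun x => phi x * psi x).
Proof.
move=> [Cp Bp] [Cq Bq]; split; first exact: class_CM.
move=> J Jk x; apply: jet_leM => // K Kk; [exact: Bp|exact: Bq].
Qed.

Lemma class_CbM k (phi psi : V -> R) : class_Cb k phi -> class_Cb k psi ->
  class_Cb k (fun x => phi x * psi x).
Proof. by move=> [A HA] [B HB]; exists (2 ^+ k * (A * B)); exact: class_Cb_leM. Qed.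

Lemma class_Cb_cst k (c : R) : class_Cb k (fun _ : V => c).
Proof.
exists `|c|; split; first exact: class_C_cst.
by move=> J Jk x; case/lastP: J Jk => [|J j] Jk //; rewrite partials_rcons partial_cst partials_cst0 normr0.
Qed.

Lemma class_Cb_prod k (I : Type) (r : seq I) (F : I -> V -> R) :
  (forall i, class_Cb k (F i)) -> class_Cb k (fun x => \prod_(i <- r) F i x).
Proof.
move=> HF; elim: r => [|i r IH].
  rewrite (_ : (fun x => _) = fun=> 1); first exact: class_Cb_cst.
  by apply/funext => x; rewrite big_nil.
rewrite (_ : (fun x => _) = fun x => F i x * \prod_(i <- r) F i x).
  exact: class_CbM.
by apply/funext => x; rewrite big_cons.
Qed.

Lemma class_CbD k (phi psi : V -> R) : class_Cb k phi -> class_Cb k psi ->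
  class_Cb k (fun x => phi x + psi x).
Proof.
move=> [A [Cp Bp]] [B [Cq Bq]]; exists (A + B); split; first exact: class_CD.
move=> J Jk x; apply: (jet_leD Cp Cq _ _ Jk) => K Kk; [exact: Bp|exact: Bq].
Qed.

Lemma class_CbS k M (phi : V -> R) : continuous phi -> (forall x, `|phi x| <= M) ->
  (forall j x, derivable phi x (delta_mx 0 j)) -> (forall j, class_Cb k (partial j phi)) ->
  class_Cb k.+1 phi.
Proof.
move=> cp B0 dp BS; have [B BP] := choice BS.
exists (`|M| + \sum_j `|B j|); split.
  apply/class_CS; split; [exact: cp|exact: dp|by move=> j; exact: (BP j).1].
move=> J; case/lastP: J => [|J j] Jk x.
  by apply: le_trans (B0 x) _; apply: le_trans (ler_norm _) _; rewrite lerDl sumr_ge0.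
rewrite partials_rcons; apply: le_trans ((BP j).2 J _ x) _; first by rewrite size_rcons in Jk.
apply: le_trans (ler_norm _) _; rewrite (bigD1 j) //= addrCA lerDl addr_ge0 //.
exact: sumr_ge0.
Qed.

Lemma class_Cb_sigmoid k (c e : R) l : class_Cb k (fun x : V => sigmoid (c * x 0 l + e)).
Proof.
set s := (fun x : V => _).
have D j x : is_derive x (delta_mx 0 j) s ((s x * (1 - s x)) * (c * (j == l)%:R)).
  by apply: is_derive_ridge; exact: is_derive_sigmoid.
have P j : partial j s = fun x => (s x * (1 + -1 * s x)) * (c * (j == l)%:R).
  by apply/funext => x; rewrite (partialE (D j x)) mulN1r.
have s1 x : `|s x| <= 1 by rewrite ger0_norm ltW // ?sigmoid_gt0 // sigmoid_lt1.
have cs : continuous s.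
  move=> x.
  have c1 : {for x, continuous (fun y : V => c * y 0 l + e)}.
    apply: continuousD; last exact: cst_continuous.
    apply: continuousM; first exact: cst_continuous.
    exact: (@class_C_cont _ _ 0 _ (@class_C_coord R n 0 l)).
  have c2 : {for c * x 0 l + e, continuous (@sigmoid R)}.
    apply: differentiable_continuous; apply/derivable1_diffP.
    by have [] := is_derive_sigmoid (c * x 0 l + e).
  exact: (continuous_comp c1 c2).
elim: k => [|k IH].
  exists 1; split; first exact/class_C0.
  by case=> // _ x; exact: s1.
apply: class_CbS cs s1 _ _ => [j x|j]; first by have [] := D j x.
rewrite P; apply: class_CbM; last exact: class_Cb_cst.
apply: class_CbM => //; apply: class_CbD; first exact: class_Cb_cst.
by apply: class_CbM => //; exact: class_Cb_cst.
Qed.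

End Box.

(** * Borel measures *)

Section BorelMeasures.
Variables (R : realType) (n : nat).
Local Notation V := 'rV[R]_n.
Local Notation B := (borel_space R n).
Implicit Types (mu : finite_borel_measure R n) (phi psi : V -> R).

Lemma measurable_open (A : set V) : open A -> measurable (A : set B).
Proof. by move=> oA; apply: sub_sigma_algebra. Qed.

Lemma measurable_continuous phi : continuous phi -> measurable_fun [set: B] (phi : B -> R).
Proof.
move=> /continuousP cphi; apply: (measurability _ (measurable_realfun.RGenOpens.measurableE R)).
move=> _ [_ [a [b ->] <-]]; rewrite setTI; apply: measurable_open.
by apply: cphi; exact: interval_open.
Qed.

Lemma measurable_continuous_map (F : V -> V) : continuous F ->
  measurable_fun [set: B] (F : B -> B).
Proof.
move=> /continuousP cF; apply: (@measurability _ _ B B setT F (@open V)) => //.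
by move=> _ [A oA <-]; rewrite setTI; apply: measurable_open; exact: cF.
Qed.

Section ImageMeasure.
Variables (mu : finite_borel_measure R n) (F : B -> B).
Hypothesis mF : measurable_fun [set: B] F.

(** The measurability proof is an argument, so that the measure structures declared below can be
    attached to this name and recover it. *)
Definition image_measure of measurable_fun [set: B] F : set B -> \bar R := pushforward mu F.
Local Notation image := (image_measure mF).

Let measurable_preimage (A : set B) : measurable A -> measurable (F @^-1` A).
Proof. by move=> mA; rewrite -[X in measurable X]setTI; exact: mF. Qed.

Let image0 : image set0 = 0%E.
Proof. by rewrite /image_measure /pushforward preimage_set0 measure0. Qed.

Let image_ge0 A : (0 <= image A)%E.
Proof. exact: measure_ge0. Qed.

Let image_sigma_additive : semi_sigma_additive image.
Proof.
move=> A mA tA mUA; rewrite /image_measure /pushforward preimage_bigcup.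
apply: measure_semi_sigma_additive => [i||]; first exact: measurable_preimage.
- by apply/trivIsetP => i j _ _ ij; rewrite -preimage_setI (trivIsetP.1 tA) // preimage_set0.
- by rewrite -preimage_bigcup; exact: measurable_preimage.
Qed.

HB.instance Definition _ := isMeasure.Build _ _ _ image image0 image_ge0 image_sigma_additive.

Let image_fin_num : fin_num_fun image.
Proof. by move=> A mA; apply: fin_num_measure; exact: measurable_preimage. Qed.

HB.instance Definition _ := Measure_isFinite.Build _ _ _ image image_fin_num.

End ImageMeasure.

Definition borel_image (mu : finite_borel_measure R n) (F : V -> V) (cF : continuous F) :
  finite_borel_measure R n := image_measure mu (measurable_continuous_map cF).

Definition mass (mu : finite_borel_measure R n) : R := fine (mu setT).

Lemma mass_ge0 mu : 0 <= mass mu.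
Proof. by rewrite fine_ge0. Qed.

Lemma integrable_bounded mu phi M : continuous phi -> (forall x, `|phi x| <= M) ->
  mu.-integrable setT (EFin \o phi : B -> \bar R).
Proof.
move=> cphi B0; apply: measurable_bounded_integrable => //.
- by apply: fin_num_fun_lty; exact: fin_num_measure.
- exact: measurable_continuous.
- by exists M; split; [exact: num_real|move=> M' MM' x _; exact: le_trans (B0 x) (ltW MM')].
Qed.

Lemma integrate_norm_le mu phi M : continuous phi -> (forall x, `|phi x| <= M) ->
  `|integrate mu phi| <= M * mass mu.
Proof.
move=> cphi B0; have iphi := integrable_bounded mu cphi B0.
rewrite /mass -Rintegral_cst //; apply: le_trans (le_normr_Rintegral _ iphi) _ => //.
apply: le_Rintegral => //.
  exact: (integrable_abse iphi).
have cM : continuous (fun _ : V => M) by exact: cst_continuous.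
by apply: (integrable_bounded mu cM (M := `|M|)).
Qed.

Lemma integrate_image mu (F : V -> V) (cF : continuous F) phi M :
  continuous phi -> (forall x, `|phi x| <= M) ->
  integrate (borel_image mu cF) phi = integrate mu (phi \o F).
Proof.
move=> cphi B0; rewrite /integrate /Rintegral; congr fine.
have cpF : continuous (phi \o F) by move=> x; apply: continuous_comp; [exact: cF|exact: cphi].
have := @integral_pushforward _ _ B B R F (measurable_continuous_map cF) mu setT (EFin \o phi).
rewrite preimage_setT; apply => //.
  by apply/measurable_realfun.measurable_EFinP; exact: measurable_continuous.
by apply: (integrable_bounded mu cpF (M := M)) => x; exact: B0.
Qed.

Lemma integrateB mu phi psi M M' : continuous phi -> (forall x, `|phi x| <= M) ->
  continuous psi -> (forall x, `|psi x| <= M') ->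
  integrate mu (fun x => phi x - psi x) = integrate mu phi - integrate mu psi.
Proof.
move=> cp Bp cq Bq; apply: RintegralB => //.
  exact: (integrable_bounded mu cp Bp).
exact: (integrable_bounded mu cq Bq).
Qed.

Lemma integrate_sum mu (I : Type) (r : seq I) (P : pred I) (c : I -> R) (phi : I -> V -> R) M :
  (forall i, P i -> continuous (phi i)) -> (forall i x, P i -> `|phi i x| <= M) ->
  integrate mu (fun x => \sum_(i <- r | P i) c i * phi i x) =
  \sum_(i <- r | P i) c i * integrate mu (phi i).
Proof.
move=> cp Bp.
(* Integrability of the partial sums is carried through the induction, since each use of additivity
   asks for it. *)
have H : mu.-integrable setT (EFin \o (fun x => \sum_(i <- r | P i) c i * phi i x) : B -> \bar R) /\
  integrate mu (fun x => \sum_(i <- r | P i) c i * phi i x) =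
  \sum_(i <- r | P i) c i * integrate mu (phi i).
  elim: r => [|i r [IH1 IH2]].
    rewrite (_ : (fun x => _) = fun=> 0); last by apply/funext => x; rewrite big_nil.
    split; last by rewrite big_nil /integrate Rintegral_cst // mul0r.
    by apply: (integrable_bounded mu (M := 0)) => [|x]; [exact: cst_continuous|rewrite normr0].
  have [Pi|nPi] := boolP (P i); last first.
    rewrite big_cons (negPf nPi) (_ : (fun x => _) = fun x => \sum_(i <- r | P i) c i * phi i x) //.
    by apply/funext => x; rewrite big_cons (negPf nPi).
  rewrite big_cons Pi (_ : (fun x => _) = fun x => c i * phi i x + \sum_(i <- r | P i) c i * phi i x);
    last by apply/funext => x; rewrite big_cons Pi.
  have i1 := integrable_bounded mu (cp i Pi) (fun x => Bp i x Pi).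
  have i2 : mu.-integrable setT (EFin \o (fun x => c i * phi i x) : B -> \bar R).
    exact: (integrableZl measurableT (c i) i1).
  split; first exact: (integrableD measurableT i2 IH1).
  by rewrite -IH2 -[c i * _](RintegralZl (c i) measurableT i1); exact: (RintegralD measurableT i2 IH1).
by case: H.
Qed.

End BorelMeasures.

Section Boxes.
Variables (R : realType) (n : nat).
Local Notation V := 'rV[R]_n.
Local Notation B := (borel_space R n).

Definition box (a b : V) : set V := [set x | forall j, a 0 j < x 0 j < b 0 j].

Definition boxes : set (set V) := [set A | exists a b, A = box a b].

Lemma boxesI : setI_closed boxes.
Proof.
move=> _ _ [a [b ->]] [a' [b' ->]].
exists (\row_j Num.max (a 0 j) (a' 0 j)), (\row_j Num.min (b 0 j) (b' 0 j)).
apply/seteqP; split=> x /=.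
  move=> [H H'] j; rewrite !mxE gt_max lt_min.
  by have /andP[-> ->] := H j; have /andP[-> ->] := H' j.
move=> H; split=> j; have := H j; rewrite !mxE gt_max lt_min => /andP[/andP[h1 h2] /andP[h3 h4]].
  by rewrite h1.
by rewrite h2.
Qed.

Lemma continuous_coordf j : continuous (fun x : V => x 0 j).
Proof. exact: (@class_C_cont _ _ 0 _ (@class_C_coord R n 0 j)). Qed.

Lemma measurable_box a b : measurable (box a b : set B).
Proof.
rewrite (_ : box a b = \bigcap_(j in [set: 'I_n]) ((fun x : B => (x : V) 0 j) @^-1` `]a 0 j, b 0 j[)).
  apply: fin_bigcap_measurable => [|j _]; first exact: finite_finset.
  rewrite -[X in measurable X]setTI.
  exact: (measurable_continuous (@continuous_coordf j) measurableT (measurable_itv _)).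
apply/seteqP; split=> x H j => [_|]; first by rewrite /= in_itv /=; exact: H.
by have := H j I; rewrite /= in_itv.
Qed.

(** Rational corners make the union countable, so every open set lies in the sigma-algebra generated
    by boxes. A box not contained in A contributes the empty set. *)
Lemma open_bigcup_boxes (A : set V) : open A ->
  A = \bigcup_(q in [set: 'rV[rat]_n * 'rV[rat]_n])
    [set x | box (map_mx ratr q.1) (map_mx ratr q.2) `<=` A /\
             box (map_mx ratr q.1) (map_mx ratr q.2) x].
Proof.
move=> oA; apply/seteqP; split=> x; last first.
  by move=> [q _] /= [sub xq]; exact: sub.
move=> Ax; have /nbhs_normP[e /= e0 eA] : nbhs x A by exact: open_nbhs_nbhs.
have e2 : 0 < e / 2 by rewrite divr_gt0.
have Q j : exists q : rat * rat, x 0 j - e / 2 < ratr q.1 < x 0 j /\ x 0 j < ratr q.2 < x 0 j + e / 2.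
  have /rat_in_itvoo[q] : x 0 j - e / 2 < x 0 j by rewrite gtrDl oppr_lt0.
  have /rat_in_itvoo[r] : x 0 j < x 0 j + e / 2 by rewrite ltrDl.
  by rewrite !in_itv /= => H1 H2; exists (q, r).
have [q qP] := choice Q.
exists (\row_j (q j).1, \row_j (q j).2) => //=; split; last first.
  by move=> j; rewrite !mxE; have [/andP[_ ->] /andP[-> _]] := qP j.
move=> y yb; apply: eA => /=; apply: (@le_lt_trans _ _ (e / 2)); last first.
  by rewrite ltr_pdivrMr // ltr_pMr // ltr1n.
rewrite distrC; apply: row_norm_le => [|j]; first exact: ltW.
have := yb j; rewrite !mxE => /andP[y1 y2]; have [/andP[q1 q2] /andP[q3 q4]] := qP j.
rewrite ler_norml; apply/andP; split.
  by rewrite lerBrDr addrC; apply/ltW/(lt_trans q1).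
by rewrite lerBlDl; apply/ltW/(lt_trans y2).
Qed.

Lemma measurable_boxes : @measurable _ B = <<s boxes >>.
Proof.
apply/seteqP; split; last first.
  apply: smallest_sub; first exact: sigma_algebra_measurable.
  by move=> _ [a [b ->]]; exact: measurable_box.
apply: smallest_sub; first exact: smallest_sigma_algebra.
move=> A /open_bigcup_boxes ->.
apply: (@countable_bigcupT_measurable _ (g_sigma_algebraType boxes)) => [|q].
  exact: countableP.
set b := box _ _; have [sub|nsub] := pselect (b `<=` A); last first.
  by rewrite (_ : [set x | _] = set0) //; apply/seteqP; split=> // x [].
rewrite (_ : [set x | _] = b); last by apply/seteqP; split=> // x [].
by apply: sub_sigma_algebra; eexists; eexists.
Qed.

(** Two steps per coordinate. Since the steps tend to 0 at the threshold itself, the product tends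
    to the indicator of the open box at every point, its boundary included. *)
Definition box_step (a b : V) (k : nat) : V -> R := fun x =>
  \prod_(j < n) (sigmoid (k%:R * (k%:R * (x 0 j - a 0 j) - 1)) *
                 sigmoid (k%:R * (k%:R * (b 0 j - x 0 j) - 1))).

Lemma class_Cb_box_step m a b k : class_Cb m (box_step a b k).
Proof.
apply: class_Cb_prod => j; apply: class_CbM.
  rewrite (_ : (fun x : V => _) = fun x => sigmoid ((k%:R * k%:R) * x 0 j +
    (- (k%:R * k%:R * a 0 j) - k%:R))); first exact: class_Cb_sigmoid.
  by apply/funext => x; congr sigmoid; ring.
rewrite (_ : (fun x : V => _) = fun x => sigmoid ((- (k%:R * k%:R)) * x 0 j +
  (k%:R * k%:R * b 0 j - k%:R))); first exact: class_Cb_sigmoid.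
by apply/funext => x; congr sigmoid; ring.
Qed.

Lemma box_step01 a b k x : 0 <= box_step a b k x <= 1.
Proof.
have S z := sigmoid_gt0 (z : R); have S1 z := sigmoid_lt1 (z : R).
have H j : 0 <= sigmoid (k%:R * (k%:R * (x 0 j - a 0 j) - 1)) *
    sigmoid (k%:R * (k%:R * (b 0 j - x 0 j) - 1)) <= 1.
  apply/andP; split; first by apply: mulr_ge0; exact: ltW.
  by rewrite -[leRHS]mulr1; apply: ler_pM; exact: ltW.
by rewrite prodr_ge0 ?prodr_ile1 // => j _; have /andP[] := H j.
Qed.

Lemma cvg_box_step a b x : box_step a b k x @[k --> \oo] --> (\1_(box a b) x : R).
Proof.
have -> : \1_(box a b) x = \prod_(j < n)
    ((if 0 < x 0 j - a 0 j then 1 else 0) * (if 0 < b 0 j - x 0 j then 1 else 0)) :> R.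
  rewrite indicE; have [|nb] := boolP (x \in box a b).
    rewrite inE => xb; rewrite big1 // => j _; have /andP[h1 h2] := xb j.
    by rewrite !subr_gt0 h1 h2 mulr1.
  have /existsNP[j jP] : ~ box a b x by move=> xb; rewrite mem_set in nb.
  rewrite (bigD1 j) //= !subr_gt0; case: (ltP (a 0 j)) jP => [_|_ _]; last by rewrite !mul0r.
  by case: ltP => // _ _; rewrite mulr0 mul0r.
apply: cvg_big => [|j _]; first exact: mul_continuous.
by apply: cvgM; exact: cvg_sigmoid_step.
Qed.

Lemma cvg_integrate_box_step (mu : finite_borel_measure R n) a b :
  (integrate mu (box_step a b k))%:E @[k --> \oo] --> mu (box a b).
Proof.
have cs k : continuous (box_step a b k).
  by have [M [C0 _]] := class_Cb_box_step 0 a b k; exact: class_C_cont C0.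
have b1 k x : `|box_step a b k x| <= 1.
  by have /andP[h0 h1] := box_step01 a b k x; rewrite ger0_norm.
have -> : (fun k => (integrate mu (box_step a b k))%:E) =
    fun k => (\int[mu]_x (box_step a b k x)%:E)%E.
  apply/funext => k; rewrite /integrate /Rintegral fineK //.
  exact: integrable_fin_num (integrable_bounded mu (cs k) (b1 k)).
have -> : mu (box a b) = (\int[mu]_x (\1_(box a b) x)%:E)%E.
  by rewrite integral_indic ?setIT //; exact: measurable_box.
have c1 : continuous (fun _ : V => 1 : R) by exact: cst_continuous.
have i1 : mu.-integrable setT (fun _ : B => 1%:E).
  by apply: (integrable_bounded mu c1 (M := 1)) => x; rewrite normr1.
apply: (@dominated_cvg _ B R mu setT measurableT _ _ (fun=> 1%:E)) => //.
- move=> k; apply/measurable_realfun.measurable_EFinP; exact: measurable_continuous.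
- by move=> x _; apply: cvg_EFin; [exact: nearW|exact: cvg_box_step].
- by move=> k x _; rewrite lee_fin.
Qed.

(** Open boxes are stable under intersection, generate the Borel sets and exhaust the space, so it
    is enough to compare on them; there dominated convergence passes from [box_step] to the
    indicator. *)
Lemma same_measure_test m (mu nu : finite_borel_measure R n) :
  (forall phi, class_Cb m phi -> integrate mu phi = integrate nu phi) -> same_measure mu nu.
Proof.
move=> H A mA.
apply: (@measure_unique _ R B boxes (fun k => box (const_mx (- k%:R)) (const_mx k%:R))
  measurable_boxes boxesI _ _ mu nu _ _ A mA).
- by move=> k; eexists; eexists.
- apply/seteqP; split=> // x _; exists (Num.truncn `|x|).+1 => // j.
  rewrite !mxE -ltr_norml; apply: le_lt_trans (coord_le_norm x j) _.
  by have /andP[_] := truncn_itv (normr_ge0 x).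
- move=> _ [a [b ->]].
  have E : (fun k => (integrate mu (box_step a b k))%:E) =
      fun k => (integrate nu (box_step a b k))%:E.
    by apply/funext => k; rewrite (H _ (class_Cb_box_step m a b k)).
  have := @cvg_integrate_box_step mu a b; rewrite E => Emu.
  have hE := @ereal_hausdorff R.
  exact: etrans (esym (cvg_lim hE Emu)) (cvg_lim hE (@cvg_integrate_box_step nu a b)).
- move=> k; rewrite -ge0_fin_numE //; apply: fin_num_measure; exact: measurable_box.
Qed.

End Boxes.

(** * Transport and continuity equations *)

Section FlowSolutions.
Variables (R : realType) (T gamma : R) (d n : nat).
Local Notation N := (N_of gamma).
Local Notation V := 'rV[R]_n.
Variables (W : R -> tensor R d N) (f : 'I_d -> V -> V) (A : R).
Hypotheses (hT : 0 < T) (hgamma : 0 < gamma <= 1).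
Hypothesis hW : geometric_rough_path T W.
Hypothesis fC : forall i j, class_Cb_le (2 * N + 1) A (fun x => f i x 0 j).
Local Notation word := (N.-bseq 'I_d).
Local Notation inc s t := (ext (increment W s t)).
Variables (C : R) (flow : R -> R -> V -> V).
Hypothesis C0 : 0 <= C.
Hypothesis flow_class : forall s t, 0 <= s -> s <= t -> t <= T -> class_C_map N.+1 (flow s t).
Hypothesis flow_disp : forall s t l x, 0 <= s -> s <= t -> t <= T ->
  jet_le N.+1 (disp (flow s t) l) x (C * (t - s) `^ gamma).
Hypothesis flow_comp : forall r s t x, 0 <= r -> r <= s -> s <= t -> t <= T ->
  flow r t x = flow s t (flow r s x).
Local Notation rad := (C * T `^ gamma).
Hypothesis flow_taylor : forall k K s t psi x M, (0 < K)%N -> (k + K <= N.+1)%N ->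
  0 <= s -> s <= t -> t <= T -> class_C (k + K) psi ->
  (forall y, `|y - x| <= rad -> jet_le (k + K) psi y M) ->
  jet_le k (fun y => psi (flow s t y) - expansion N f K (inc s t) psi y) x
    (C * M * (t - s) `^ (K%:R * gamma)).

Lemma rad_ge0 : 0 <= rad.
Proof. by rewrite mulr_ge0 // powR_ge0. Qed.

Lemma flow_disp_rad s t l x : 0 <= s -> s <= t -> t <= T ->
  jet_le N.+1 (disp (flow s t) l) x rad.
Proof.
move=> s0 st tT; apply: jet_le_mono (leqnn _) _ (flow_disp l x s0 st tT).
apply: ler_wpM2l => //; apply: ge0_ler_powR; rewrite ?nnegrE ?(ltW hT) ?subr_ge0 //.
  by apply: ltW; exact: gamma_gt0 hgamma.
by apply: le_trans tT; rewrite gerBl.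
Qed.

Lemma flow_near s t x : 0 <= s -> s <= t -> t <= T ->
  `|flow s t x - x| <= C * (t - s) `^ gamma.
Proof.
move=> s0 st tT; apply: row_norm_le => [|l]; first by rewrite mulr_ge0 // powR_ge0.
by rewrite !mxE; exact: (@flow_disp s t l x s0 st tT [::]).
Qed.

Lemma flow_near_rad s t x : 0 <= s -> s <= t -> t <= T -> `|flow s t x - x| <= rad.
Proof.
move=> s0 st tT; apply: row_norm_le => [|l]; first exact: rad_ge0.
by rewrite !mxE; exact: (@flow_disp_rad s t l x s0 st tT [::]).
Qed.

Lemma flow_norm_le s t x r : 0 <= s -> s <= t -> t <= T -> `|x| <= r ->
  `|flow s t x| <= r + rad.
Proof.
move=> s0 st tT xr; rewrite -[flow s t x](subrK x) addrC [r + _]addrC.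
by rewrite addrC; apply: le_trans (ler_normD _ _) _; apply: lerD => //; exact: flow_near_rad.
Qed.

Lemma flow_refl t x : 0 <= t -> t <= T -> flow t t x = x.
Proof.
move=> t0 tT; apply/eqP; rewrite -subr_eq0 -normr_le0.
have := flow_near x t0 (lexx t) tT; rewrite subrr powR0 ?mulr0 //.
by rewrite gt_eqF // (gamma_gt0 hgamma).
Qed.

(** Gamma_w is applied to the defect, whose |w|-jets are bounded by B. As Gamma_w Gamma_v =
    Gamma_(wv), the expansion of order N + 1 - |w| becomes the sum in the definition of a regular
    solution. *)
Lemma Gamma_defect (w : word) s t psi psi' x B :
  class_C N.+1 psi -> class_C N.+1 psi' ->
  jet_le (size w) (fun y => psi' y - expansion N f (N.+1 - size w) (inc s t) psi y) x B ->
  `|Gamma f w psi' x - \sum_(v : word | (size v <= N - size w)%N)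
      Gamma f (w ++ v) psi x * increment W s t v| <= Gamma_const n (2 * N + 1) A * B.
Proof.
move=> Cp Cp' HB; have wN := size_bseq w.
have w2 : (size w + (N.+1 - size w) = N.+1)%N by rewrite subnKC // leqW.
have Nm : (N.+1 <= (2 * N + 1).+1)%N by rewrite addn1 mul2n -addnn !ltnS leqW // leq_addr.
have wm : (size w <= (2 * N + 1).+1)%N by apply: leq_trans Nm; exact: leqW.
have Ce : class_C (size w) (expansion N f (N.+1 - size w) (inc s t) psi).
  by apply: (class_C_expansion fC); rewrite w2.
have Cw' : class_C (size w) psi' by apply: class_C_le Cp'; exact: leqW.
have := jet_le_Gamma fC (w := w) (k := 0) wm (class_CB Cw' Ce) HB
  (isT : (size (@nil 'I_n) <= 0)%N).
rewrite /= (GammaB fC wm Cw' Ce).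
congr (`|_ - _| <= _).
rewrite /expansion (Gamma_sum fC _ _ wm) => [|v vK]; last first.
  apply: (class_C_Gamma fC); last by apply: class_C_le Cp; rewrite -w2 leq_add2l ltnW.
  by apply: leq_trans Nm; rewrite -w2 leq_add2l ltnW.
rewrite subSn //; apply: eq_big => [v|v _]; first by rewrite ltnS.
by rewrite Gamma_cat ext_bseq mulrC.
Qed.

Lemma u_jets k g : class_C k g -> (k <= N.+1)%N -> forall r, exists2 M, 0 <= M &
  forall t x, 0 <= t -> t <= T -> `|x| <= r -> jet_le k (fun y => g (flow t T y)) x M.
Proof.
move=> Cg kN r; have [M M0 MP] := jet_le_on_ball (r + rad) Cg.
have [D D0 DP] := jet_le_comp n k rad_ge0.
exists ((1 + D * rad) * M); first by rewrite mulr_ge0 // addr_ge0 // mulr_ge0 // rad_ge0.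
move=> t x t0 tT xr; apply: (DP g (flow t T) x M rad Cg).
- by move=> l; apply: class_C_le kN (flow_class t0 tT (lexx T) l).
- by rewrite rad_ge0 lexx.
- by apply: MP; exact: flow_norm_le.
- by move=> l; apply: jet_le_mono kN (lexx _) (flow_disp_rad l x t0 tT (lexx T)).
Qed.

(** The value g outside [0, T] is a default: the notion of solution only looks at times in
    [0, T]. *)
Definition transport_solution (g : V -> R) (t : R) : V -> R :=
  if (0 <= t) && (t <= T) then fun x => g (flow t T x) else g.

Lemma transport_exists g : class_C N.+1 g ->
  regular_solution T W f g (transport_solution g).
Proof.
move=> Cg.
have uE t : 0 <= t -> t <= T -> transport_solution g t = fun x => g (flow t T x).
  by rewrite /transport_solution => -> ->.
have uS s t : 0 <= s -> s <= t -> t <= T ->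
    transport_solution g s = fun x => transport_solution g t (flow s t x).
  move=> s0 st tT; rewrite !uE //; [|exact: le_trans st|exact: le_trans tT].
  by apply/funext => x; rewrite (flow_comp x s0 st tT (lexx T)).
have uC t : 0 <= t -> t <= T -> class_C N.+1 (transport_solution g t).
  by move=> t0 tT; rewrite (uE t t0 tT); exact: class_C_comp Cg (flow_class t0 tT (lexx T)).
have uJ r : exists2 M, 0 <= M & forall t x, 0 <= t -> t <= T -> `|x| <= r ->
    jet_le N.+1 (transport_solution g t) x M.
  have [M M0 MP] := u_jets Cg (leqnn _) r; exists M => // t x t0 tT xr.
  by rewrite uE //; exact: MP.
split; first split.
(* Since u_s = u_t o flow s t, a time increment of u is a space increment of u_t, controlled by the
   mean value theorem and the displacement of the flow. *)
- move=> K /compact_norm_le[r r0 rP]; have [M M0 MP] := uJ (r + rad).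
  have H s t x : 0 <= s -> s <= t -> t <= T -> K x ->
      `|transport_solution g t x - transport_solution g s x| <= n%:R * M * C * (t - s) `^ gamma.
    move=> s0 st tT /rP xr; rewrite (uS s t s0 st tT) /=.
    have t0 := le_trans s0 st.
    have m0 := flow_near x s0 st tT.
    have seg q : 0 <= q <= 1 -> `|x + q *: (flow s t x - x)| <= r + rad.
      move=> q01; rewrite -[X in `|X|]subr0; apply: segment_in_ball => //; rewrite subr0.
        exact: flow_norm_le.
      by apply: le_trans xr _; rewrite lerDl rad_ge0.
    have mv : `|transport_solution g t (flow s t x) - transport_solution g t x| <=
        n%:R * M * `|flow s t x - x|.
      apply: mean_value; first by apply: class_C_le (uC t t0 tT).
      by move=> q l q01; exact: (MP t _ t0 tT (seg q q01) [:: l]).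
    rewrite distrC; apply: le_trans mv _; rewrite -mulrA -[leRHS]mulrA -[leRHS]mulrA.
    by rewrite mulrA [leRHS]mulrA; apply: ler_wpM2l => //; exact: mulr_ge0.
  exists (n%:R * M * C) => s t x /andP[s0 sT] /andP[t0 tT] Kx.
  have [st|/ltW ts] := leP s t.
    by rewrite [in leRHS]ger0_norm ?subr_ge0 //; exact: H.
  by rewrite distrC [`|t - s|]distrC [in leRHS]ger0_norm ?subr_ge0 //; exact: H.
- by move=> t /andP[t0 tT]; exact: uC.
- move=> K /compact_norm_le[r r0 rP]; have [M M0 MP] := uJ r; exists M => J Jk t x.
  by move=> /andP[t0 tT] /rP xr; exact: MP.
- by rewrite uE // ?(ltW hT) //; apply/funext => x; rewrite flow_refl // ltW.
move=> w K /compact_norm_le[r r0 rP]; have [M M0 MP] := uJ (r + rad).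
exists (Gamma_const n (2 * N + 1) A * (C * M)) => s t x s0 /ltW st tT /rP xr.
have t0 := le_trans s0 st.
rewrite [`|t - s|]ger0_norm ?subr_ge0 // -[leRHS]mulrA.
have wN := size_bseq w.
have w2 : (size w + (N.+1 - size w) = N.+1)%N by rewrite subnKC // leqW.
apply: Gamma_defect; [exact: uC|by apply: uC => //; exact: le_trans tT|].
have Cw : class_C (size w + (N.+1 - size w)) (transport_solution g t).
  by rewrite w2; exact: uC.
have K0 : (0 < N.+1 - size w)%N by rewrite subn_gt0 ltnS.
have kK : (size w + (N.+1 - size w) <= N.+1)%N by rewrite w2.
rewrite (uS s t s0 st tT); apply: (flow_taylor K0 kK s0 st tT Cw) => y yx.
rewrite w2; apply: MP => //; rewrite -[y](subrK x).
by rewrite addrC; apply: le_trans (ler_normD _ _) _; apply: lerD.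
Qed.

(** With y = flow s a x, both u_a(y), by the equation at the empty word, and u_b(flow a b y), by the
    Taylor estimate for u_b, are within O((b - a)^((N+1) gamma)) of the same expansion of u_b at
    y. *)
Lemma transport_unique g u : class_C N.+1 g -> regular_solution T W f g u ->
  forall t x, 0 <= t <= T -> u t x = transport_solution g t x.
Proof.
move=> Cg [[_ uC uB] uT uS] s x /andP[s0 sT]; rewrite /transport_solution s0 sT /=.
rewrite -uT -[in LHS](flow_refl x s0 sT).
(* One [rad] for the distance from x to the point y on its trajectory, another for the ball around y
   on which the Taylor estimate asks for bounds. *)
pose B := [set y : V | `|y| <= `|x| + rad + rad].
have [M MP] := uB B (@compact_ball R n _).
have [D DP] := uS [bseq] B (@compact_ball R n _).
have theta1 := exponent_gt1 hgamma.
apply: (@holder_constant _ _ (D + C * M) s T (fun t => u t (flow s t x)) theta1 sT) => a b sa ab bT.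
have a0 := le_trans s0 sa; have b0 := le_trans a0 ab; have aT := le_trans ab bT.
have sb := le_trans sa ab.
have [<-|nab] := eqVneq a b.
  by rewrite !subrr normr0 powR0 ?mulr0 // gt_eqF // (lt_trans ltr01).
have lab : a < b by rewrite lt_neqAle nab.
pose y := flow s a x; have yr : `|y| <= `|x| + rad by exact: flow_norm_le.
have yB : B y by apply: le_trans yr _; rewrite lerDl rad_ge0.
rewrite (flow_comp x s0 sa ab bT) -/y.
have := DP a b y a0 lab bT yB.
rewrite subn0 [`|b - a|]ger0_norm ?subr_ge0 // => H1.
have H2 := @flow_taylor 0 N.+1 a b (u b) y M (ltn0Sn N) (leqnn _) a0 ab bT (uC b _) _
  [::] isT.
have {}H2 : `|u b (flow a b y) - expansion N f N.+1 (inc a b) (u b) y| <=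
    C * M * (b - a) `^ (N.+1%:R * gamma).
  apply: H2; first by rewrite b0.
  move=> z zy J Jk; apply: MP => //; first by rewrite b0.
  rewrite /B /= -[z](subrK y) addrC; apply: le_trans (ler_normD _ _) _.
  exact: lerD.
have E : expansion N f N.+1 (inc a b) (u b) y = \sum_(v : word | (size v <= N)%N)
    Gamma f ([::] ++ v) (u b) y * increment W a b v.
  apply: eq_big => [v|v _]; first by rewrite ltnS.
  by rewrite ext_bseq mulrC.
rewrite E in H2.
rewrite mulrDl; apply: le_trans (ler_distD _ _ _) (lerD H1 _).
by rewrite distrC.
Qed.

Lemma flow_cont s t : 0 <= s -> s <= t -> t <= T -> continuous (flow s t).
Proof. by move=> s0 st tT; exact: class_C_map_cont (flow_class s0 st tT). Qed.

(** For test functions bounded on the whole space the Taylor error is uniform in x, so it integrates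
    to a multiple of the mass. *)
Lemma integrate_defect (rho : finite_borel_measure R n) K psi M s t :
  (0 < K <= N.+1)%N -> 0 <= s -> s <= t -> t <= T -> class_Cb_le K M psi ->
  `|integrate rho (psi \o flow s t) -
    \sum_(v : word | (size v < K)%N) inc s t v * integrate rho (Gamma f v psi)| <=
  C * M * (t - s) `^ (K%:R * gamma) * mass rho.
Proof.
move=> /andP[K0 KN] s0 st tT [Cpsi Bpsi].
have cpsi : continuous psi by exact: class_C_cont Cpsi.
have cF : continuous (psi \o flow s t).
  by move=> x; apply: continuous_comp; [exact: flow_cont|exact: cpsi].
have BF x : `|(psi \o flow s t) x| <= M by exact: (Bpsi [::]).
have Nm : (N.+1 <= (2 * N + 1).+1)%N by rewrite addn1 mul2n -addnn !ltnS leqW // leq_addr.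
have vm (v : word) : (size v < K)%N -> (0 + size v <= (2 * N + 1).+1)%N.
  by move=> vK; apply: leq_trans Nm; apply: leq_trans KN; exact: ltnW.
have cG (v : word) : (size v < K)%N -> continuous (Gamma f v psi).
  move=> vK; apply: (@class_C_cont _ _ 0); apply: (class_C_Gamma fC) (vm v vK) _.
  by apply: class_C_le Cpsi; rewrite add0n ltnW.
have BG (v : word) x : (size v < K)%N -> `|Gamma f v psi x| <= Gamma_const n (2 * N + 1) A * M.
  move=> vK; have vK' : (0 + size v <= K)%N by rewrite add0n ltnW.
  apply: (jet_le_Gamma fC (vm v vK) _ _ (isT : (size (@nil 'I_n) <= 0)%N)).
    exact: class_C_le vK' Cpsi.
  by move=> J Jk; apply: Bpsi; exact: leq_trans vK'.
rewrite -(integrate_sum rho _ _ cG (fun v x vK => BG v x vK)).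
have BE x : `|\sum_(v : word | (size v < K)%N) inc s t v * Gamma f v psi x| <=
    M + C * M * (t - s) `^ (K%:R * gamma).
  have := @flow_taylor 0 K s t psi x M K0 KN s0 st tT Cpsi
    (fun y _ J Jk => Bpsi J Jk y) [::] isT; rewrite /= => H.
  rewrite -[X in `|X|](subKr ((psi \o flow s t) x)).
  apply: le_trans (ler_normB _ _) _; apply: lerD => //; exact: BF.
have cE : continuous (fun x => \sum_(v : word | (size v < K)%N) inc s t v * Gamma f v psi x).
  apply: (@class_C_cont _ _ 0); apply: class_C_sum => v vK; apply: class_CZ.
  by apply/class_C0; exact: cG.
rewrite -(integrateB rho cF BF cE BE); apply: integrate_norm_le => [x|x].
  by apply: continuousB; [exact: cF|exact: cE].
exact: (@flow_taylor 0 K s t psi x M K0 KN s0 st tT Cpsi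
    (fun y _ J Jk => Bpsi J Jk y) [::] isT).
Qed.

(** A solution is a function of all real times, whereas the image measure asks for a proof that the
    flow is continuous. Clamping makes that proof available at every t. *)
Definition clamp (t : R) : R := Num.min T (Num.max 0 t).

Lemma clamp_ge0 t : 0 <= clamp t.
Proof. by rewrite le_min ltW //= le_max lexx. Qed.

Lemma clamp_le t : clamp t <= T.
Proof. by rewrite ge_min lexx. Qed.

Lemma clampE t : 0 <= t -> t <= T -> clamp t = t.
Proof. by move=> t0 tT; rewrite /clamp (max_idPr t0); apply/min_idPr. Qed.

Definition continuity_solution (mu : finite_borel_measure R n) (t : R) :
    finite_borel_measure R n :=
  borel_image mu (flow_cont (lexx 0) (clamp_ge0 t) (clamp_le t)).

Lemma integrate_continuity_solution mu t phi M : 0 <= t -> t <= T ->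
  continuous phi -> (forall x, `|phi x| <= M) ->
  integrate (continuity_solution mu t) phi = integrate mu (phi \o flow 0 t).
Proof. by move=> t0 tT cphi Bphi; rewrite (integrate_image _ _ cphi Bphi) clampE. Qed.

Lemma continuity_exists mu : measure_solution T W f mu (continuity_solution mu).
Proof.
split=> [D mD|w S [M SM]].
  have TT := ltW hT.
  rewrite /continuity_solution /borel_image /= /image_measure /pushforward; congr (mu _).
  by apply/seteqP; split=> x /=; rewrite clampE // flow_refl.
exists (C * (Gamma_const n (2 * N + 1) A * M) * mass mu) => s t phi s0 /ltW st tT /SM[Cphi Bphi].
have t0 := le_trans s0 st; have sT := le_trans st tT.
have wN := size_bseq w.
have w2 : (N.+1 - size w + size w = N.+1)%N by rewrite subnK // leqW.
have Nm : (N.+1 <= (2 * N + 1).+1)%N by rewrite addn1 mul2n -addnn !ltnS leqW // leq_addr.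
have wm : (N.+1 - size w + size w <= (2 * N + 1).+1)%N by rewrite w2.
pose psi := Gamma f w phi.
have Cpsi : class_Cb_le (N.+1 - size w) (Gamma_const n (2 * N + 1) A * M) psi.
  split; first by apply: (class_C_Gamma fC wm); rewrite w2.
  move=> J Jk x; apply: (jet_le_Gamma fC wm _ _ Jk); rewrite w2 // => K Kk; exact: Bphi.
have cpsi : continuous psi by exact: class_C_cont Cpsi.1.
have Bpsi x : `|psi x| <= Gamma_const n (2 * N + 1) A * M by exact: (Cpsi.2 [::]).
have cF : continuous (psi \o flow s t).
  by move=> x; apply: continuous_comp; [exact: flow_cont|exact: cpsi].
rewrite (integrate_continuity_solution mu t0 tT cpsi Bpsi).
have -> : integrate mu (psi \o flow 0 t) = integrate (continuity_solution mu s) (psi \o flow s t).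
  rewrite (integrate_continuity_solution mu s0 sT cF (fun x => Bpsi (flow s t x))).
  by congr integrate; apply/funext => x /=; rewrite (flow_comp x (lexx 0) s0 st tT).
have K0 : (0 < N.+1 - size w <= N.+1)%N by rewrite subn_gt0 ltnS wN leq_subr.
have := integrate_defect (continuity_solution mu s) K0 s0 st tT Cpsi.
have -> : mass (continuity_solution mu s) = mass mu by [].
rewrite [`|t - s|]ger0_norm ?subr_ge0 // [in leRHS]mulrAC.
congr (`|_ - _| <= _); apply: eq_big => [v|v _]; first by rewrite subSn // ltnS.
by rewrite Gamma_cat ext_bseq mulrC.
Qed.

Lemma Gamma_cst v (c : R) : v != [::] -> Gamma f v (fun=> c) = fun=> 0.
Proof.
case/lastP: v => // v i _; rewrite -cats1 Gamma_cat /=.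
have lie0 j e : lie (f j) (fun=> e) = fun=> 0.
  apply/funext => x; rewrite /lie big1 // => l _; by rewrite partial_cst mulr0.
by rewrite lie0; elim: v => //= j v ->; rewrite lie0.
Qed.

Lemma integrate_same (mu nu : finite_borel_measure R n) phi : same_measure mu nu ->
  integrate mu phi = integrate nu phi.
Proof.
by move=> E; congr fine; apply: eq_measure_integral => D mD _; exact: E.
Qed.

Lemma integrate_cst (mu : finite_borel_measure R n) (c : R) :
  integrate mu (fun=> c) = c * mass mu.
Proof. by rewrite /integrate Rintegral_cst. Qed.

(** Tested on the constant 1, every non-empty word gives 0, so the equation at the empty word
    directly bounds the variation of the mass. *)
Lemma mass_bounded mu rho : measure_solution T W f mu rho ->
  exists2 D, 0 <= D & forall t, 0 <= t -> t <= T -> mass (rho t) <= D.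
Proof.
move=> [rho0 /(_ [bseq] [set fun=> 1])[|D DP]].
  by have [M MP] := @class_Cb_cst R n N.+1 1; exists M => _ ->.
exists (mass (rho 0) + `|D| * T `^ (N.+1%:R * gamma)).
  by rewrite addr_ge0 ?mass_ge0 // mulr_ge0 // powR_ge0.
move=> t t0 tT; have [<-|n0] := eqVneq 0 t; first by rewrite lerDl mulr_ge0 // powR_ge0.
have tp : 0 < t by rewrite lt_neqAle n0.
have := DP 0 t (fun=> 1) (lexx 0) tp tT erefl; rewrite subn0 subr0 (ger0_norm t0) /=.
rewrite (bigD1 [bseq]) //= big1 ?addr0; last first.
  move=> v /andP[_ v0]; rewrite cats0 Gamma_cst; last by rewrite -val_eqE in v0.
  by rewrite integrate_cst !mul0r.
have [g1 _] := shuffle_char_inc hW (lexx 0) t0 tT.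
rewrite !integrate_cst !mul1r -(ext_bseq _ [bseq]) g1 mulr1 => H.
have {}H := le_trans (ler_norm _) H; rewrite lerBlDl in H.
apply: le_trans H _; rewrite lerD2l; apply: le_trans (ler_wpM2r _ (ler_norm D)) _.
  exact: powR_ge0.
apply: ler_wpM2l => //; apply: ge0_ler_powR; rewrite ?nnegrE ?(ltW hT) //.
by rewrite mulr_ge0 // ltW // (gamma_gt0 hgamma).
Qed.

(** The duality argument. For s < t the equation compares rho_t(phi o flow t tau) with an expansion
    under rho_s, and [integrate_defect] compares rho_s(phi o flow s tau) with the same expansion,
    the bound [D] on the masses making that error uniform in s. So t |-> rho_t(phi o flow t tau) is
    constant; its values at 0 and tau are the two sides. *)
Lemma continuity_transfer mu rho tau phi : measure_solution T W f mu rho ->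
  0 <= tau -> tau <= T -> class_Cb N.+1 phi ->
  integrate (rho tau) phi = integrate mu (phi \o flow 0 tau).
Proof.
move=> sol tau0 tauT [M [Cphi Bphi]]; have [rho0 rhoS] := sol.
have [D D0 DP] := mass_bounded sol.
have [E E0 EP] := jet_le_comp n N.+1 rad_ge0.
pose M' := (1 + E * rad) * M.
have Cu t : 0 <= t -> t <= tau -> class_Cb_le N.+1 M' (phi \o flow t tau).
  move=> t0 ttau; split; first exact: class_C_comp Cphi (flow_class t0 ttau tauT).
  move=> J Jk x; apply: (EP phi (flow t tau) x M rad Cphi) Jk.
  - exact: flow_class.
  - by rewrite rad_ge0 lexx.
  - by move=> K Kk; exact: Bphi.
  - by move=> l; exact: flow_disp_rad.
have [G GP] : exists G, forall s t, 0 <= s -> s < t -> t <= tau ->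
    `|integrate (rho t) (phi \o flow t tau) - \sum_(v : word | (size v < N.+1)%N)
      inc s t v * integrate (rho s) (Gamma f v (phi \o flow t tau))| <=
    G * (t - s) `^ (N.+1%:R * gamma).
  (* A single bounded set contains phi o flow t tau for all t in [0, tau], so the constant [G] does
     not depend on t. *)
  have [|G GP] := rhoS [bseq] [set psi | class_Cb_le N.+1 M' psi].
    by exists M' => psi.
  exists G => s t s0 st ttau.
  have := GP s t (phi \o flow t tau) s0 st (le_trans ttau tauT) (Cu t (le_trans s0 (ltW st)) ttau).
  rewrite subn0 [`|t - s|]ger0_norm; last by rewrite subr_ge0 ltW.
  congr (`|_ - _| <= _); apply: eq_big => [v|v _]; first by rewrite ltnS.
  by rewrite cats0 ext_bseq mulrC.
have M0 : 0 <= M' by exact: le_trans (normr_ge0 _) ((Cu 0 (lexx 0) tau0).2 [::] isT 0).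
have := @holder_constant R (N.+1%:R * gamma) (G + C * M' * D) 0 tau
  (fun t => integrate (rho t) (phi \o flow t tau)) (exponent_gt1 hgamma) tau0.
have -> : phi \o flow tau tau = phi by apply/funext => x /=; rewrite flow_refl.
rewrite (integrate_same _ rho0) => <- // s t s0 st ttau.
have [<-|nst] := eqVneq s t.
  by rewrite !subrr normr0 powR0 ?mulr0 // gt_eqF // (lt_trans ltr01) // exponent_gt1.
have lst : s < t by rewrite lt_neqAle nst.
have t0 := le_trans s0 st; have tT := le_trans ttau tauT.
have -> : phi \o flow s tau = (phi \o flow t tau) \o flow s t.
  by apply/funext => x /=; rewrite (flow_comp x s0 st ttau tauT).
have KN : (0 < N.+1 <= N.+1)%N by rewrite leqnn.
have H1 := integrate_defect (rho s) KN s0 st tT (Cu t t0 ttau).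
have H2 := GP s t s0 lst ttau; rewrite distrC in H2.
rewrite mulrDl [X in _ <= X]addrC.
apply: le_trans (ler_distD _ _ _) (lerD (le_trans H1 _) H2).
rewrite [leRHS]mulrAC; apply: ler_wpM2l; last exact: DP (le_trans st tT).
by rewrite mulr_ge0 ?powR_ge0 // mulr_ge0.
Qed.

Lemma continuity_unique mu rho rho' :
  measure_solution T W f mu rho -> measure_solution T W f mu rho' ->
  forall t, 0 <= t <= T -> same_measure (rho' t) (rho t).
Proof.
move=> sol sol' t /andP[t0 tT]; apply: (@same_measure_test _ _ N.+1) => phi Cphi.
by rewrite (continuity_transfer sol') // (continuity_transfer sol).
Qed.

End FlowSolutions.

Theorem theorem1p1 (R : realType) (T gamma : R) (d n : nat)
    (hT : 0 < T) (hd : (1 <= d)%N) (hn : (1 <= n)%N)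
    (hgamma : 0 < gamma <= 1)
    (W : R -> tensor R d (N_of gamma))
    (hW : geometric_rough_path T W)
    (f : 'I_d -> 'rV[R]_n -> 'rV[R]_n)
    (hf : forall i : 'I_d, vector_field_Cb (2 * N_of gamma + 1) (f i)) :
  (forall g : 'rV[R]_n -> R, class_C (N_of gamma + 1) g ->
     exists u : R -> 'rV[R]_n -> R,
       regular_solution T W f g u /\
       forall u' : R -> 'rV[R]_n -> R, regular_solution T W f g u' ->
         forall (t : R) (x : 'rV[R]_n), 0 <= t <= T -> u' t x = u t x) /\
  (forall mu : finite_borel_measure R n,
     exists rho : R -> finite_borel_measure R n,
       measure_solution T W f mu rho /\
       forall rho' : R -> finite_borel_measure R n,
         measure_solution T W f mu rho' ->
         forall t : R, 0 <= t <= T -> same_measure (rho' t) (rho t)).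
Proof.
have [A fC] := fields_bounded hf.
have [C C0 [flow [fclass fdisp fcomp ftaylor]]] := rough_flow hT hgamma hW hf.
split=> [g|mu].
  rewrite addn1 => Cg; exists (transport_solution T flow g); split.
    exact: (transport_exists hT hgamma fC C0 fclass fdisp fcomp ftaylor Cg).
  move=> u' solu'; exact: (transport_unique hT hgamma C0 fdisp fcomp ftaylor Cg solu').
have sol := continuity_exists hT hgamma fC C0 fclass fdisp fcomp ftaylor mu.
exists (continuity_solution hT fclass mu); split=> [|rho' sol']; first exact: sol.
exact: (continuity_unique hT hgamma hW fC C0 fclass fdisp fcomp ftaylor sol sol').
Qed.
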